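(* Let $\mathbf{K}$ be an algebraically closed field with $\mathrm{char}(\mathbf{K})\neq 2,3$. Fix non-negative integers $d,x,y,z$ with $d\ge 41$. Let $Y\subset \mathbf{P}^3$ be a general union of $x$ $4$-points, $y$ $3$-points and $z$ $2$-points (i.e. $Y=4P_1+\dots+4P_x+3Q_1+\dots+3Q_y+2R_1+\dots+2R_z$ with all supporting points general in $\mathbf P^3$). Then $Y$ has good postulation in degree $d$, i.e. \begin{itemize} \item if $20x+10y+4z\le \binom{d+3}{3}$, then $h^1(\mathbf{P}^3,\mathcal{I}_Y(d))=0$; \item if $20x+10y+4z\ge \binom{d+3}{3}$, then $h^0(\mathbf{P}^3,\mathcal{I}_Y(d))=0$. \end{itemize}
   Context: For a point $P$ of a smooth variety $A$ and an integer $m\ge1$, the $m$-point (fat point) $mP$ is the closed subscheme of $A$ with ideal sheaf $(\mathcal I_{P,A})^m$; in $\mathbf P^3$ it has length $\binom{m+2}{3}$, so $4$-, $3$-, $2$-points have lengths $20,10,4$. $\mathcal I_Y(d)$ denotes the ideal sheaf of $Y$ twisted by $\mathcal O_{\mathbf P^3}(d)$, so $h^0(\mathbf P^3,\mathcal I_Y(d))$ is the dimension of the space of degree-$d$ forms vanishing on $Y$. *)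

(* Defs.v *)
From HB Require Import structures.
From mathcomp Require Import all_boot all_order all_algebra.
Set Implicit Arguments. Unset Strict Implicit. Unset Printing Implicit Defensive.
Import Order.TTheory GRing.Theory Num.Theory.
Local Open Scope ring_scope.

Section FatPoints.
Variable K : fieldType.

(* Exponent vectors of monomials of degree d in x0,x1,x2,x3
   (the exponents are automatically <= d). *)
Definition mon (d : nat) := {a : {ffun 'I_4 -> 'I_d.+1} | (\sum_i (a i : nat) == d)%N}.

Definition form (d : nat) := {ffun mon d -> K^o}.

(* Points of P^3 given by homogeneous coordinates (a nonzero row vector). *)
Definition pt := 'rV[K]_4.

(* Value at P of the Hasse derivative D^(beta) f of the form f:
   D^(beta) x^a = prod_i C(a_i, beta_i) x^(a - beta). *)
Definition hasse_eval (d : nat) (f : form d) (beta : {ffun 'I_4 -> 'I_d.+1}) (P : pt) : K :=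
  \sum_(a : mon d) f a * \prod_(i < 4)
     (('C(val a i, beta i))%:R * P 0 i ^+ (val a i - beta i)).

(* Conditions imposed on forms of degree d by the fat points m_i P_i
   (i < n): all Hasse derivatives of order < m_i vanish at P_i.  Hasse
   derivatives with some beta_i > d vanish identically on degree-d forms,
   so indexing beta by 'I_d.+1 loses nothing. *)
Definition fat_eval (d n : nat) (mult : 'I_n -> nat) (pts : 'I_n -> pt) (f : form d)
  : {ffun 'I_n * {ffun 'I_4 -> 'I_d.+1} -> K^o} :=
  [ffun c : 'I_n * {ffun 'I_4 -> 'I_d.+1} => if (\sum_j (c.2 j : nat) < mult c.1)%N
             then hasse_eval f c.2 (pts c.1) else 0].

(* H^0(P^3, I_Y(d)) for Y = sum_i m_i P_i: forms of degree d in (I_{P_i})^{m_i}. *)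
Definition H0_IY (d n : nat) (mult : 'I_n -> nat) (pts : 'I_n -> pt) : {vspace form d} :=
  lker (linfun (@fat_eval d n mult pts)).

Definition h0_IY (d n : nat) (mult : 'I_n -> nat) (pts : 'I_n -> pt) : nat :=
  \dim (@H0_IY d n mult pts).

Definition fat_length (n : nat) (mult : 'I_n -> nat) : nat :=
  (\sum_i 'C(mult i + 2, 3))%N.

(* h^1(P^3, I_Y(d)) via the exact sequence
   0 -> H^0(I_Y(d)) -> H^0(O(d)) -> H^0(O_Y) -> H^1(I_Y(d)) -> H^1(O(d)) = 0,
   with h^0(O(d)) = C(d+3,3) and h^0(O_Y) = length Y. *)
Definition h1_IY (d n : nat) (mult : 'I_n -> nat) (pts : 'I_n -> pt) : nat :=
  (@h0_IY d n mult pts + @fat_length n mult - 'C(d + 3, 3))%N.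

(* Polynomial functions of a configuration of n points of K^4
   (= polynomials in the 4n coordinates, K being infinite). *)
Inductive polyfun (n : nat) : (('I_n -> pt) -> K) -> Prop :=
| pf_const (c : K) : polyfun (fun _ => c)
| pf_coord (i : 'I_n) (j : 'I_4) : polyfun (fun v => v i 0 j)
| pf_add f g : polyfun f -> polyfun g -> polyfun (fun v => f v + g v)
| pf_mul f g : polyfun f -> polyfun g -> polyfun (fun v => f v * g v).

(* A property holds for a general configuration of n points of P^3:
   it holds on a nonempty Zariski open subset of configurations
   (of homogeneous coordinate vectors, all nonzero). *)
Definition general_config (n : nat) (Prop_ : ('I_n -> pt) -> Prop) : Prop :=
  exists g : ('I_n -> pt) -> K,
    [/\ polyfun g, (exists v, g v != 0) &
        forall v, g v != 0 -> (forall i, v i != 0) /\ Prop_ v].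

End FatPoints.

Definition mult_xyz (x y z : nat) (i : 'I_(x + y + z)) : nat :=
  if (i < x)%N then 4%N else if (i < x + y)%N then 3%N else 2%N.

(* Main.v *)
From Stdlib Require Import ZArith.
From HB Require Import structures.
From mathcomp Require Import all_boot all_order all_algebra.
From mathcomp Require Import zify ring lra ssrZ.
Require Import Defs.
Set Implicit Arguments. Unset Strict Implicit. Unset Printing Implicit Defensive.
Import Order.TTheory GRing.Theory Num.Theory.

(* In affine coordinates the forms of degree d are the polynomials with exponents in a simplex. More
   generally consider polynomials with exponents in a finite set D and fat points of the torus. Moving
   points by t ^ F, where t -> 0 and F is a linear functional, cuts D into the parts F < c and F >= c,
   to which the points can be distributed at will, or makes one m-point remove from D the exponents
   that, in the order of F, are independent for polynomial functions of degree < m (Dumnicki's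
   reduction). Five 2-points may collide to a 4-point, so that one may assume z <= 4, and 3-points come
   in pairs but for one; hence almost all conditions come in units of 20, a 4-point or two 3-points.

   The simplex is cut into slabs of ten layers, slabs into blocks of four columns, and most of a block
   into bricks 5 x 4 x 6. All the pieces have 20 k elements and, up to translation, belong to a finite
   list. Each is exhausted by 4-points alone and by 3-points alone, which loses at most k units of
   either kind, and bricks take mixtures, so that whatever is lost is used up in the bricks. There
   remains a corner of fewer than 100 exponents for the last units, the 3-point and the 2-points. The
   removals from the finitely many pieces are checked by elimination over the integers, with pivots
   divisible by no prime but 2 and 3. *)

(** * Interpolation on sets of exponents *)

Section Exponents.
Local Open Scope ring_scope.

(** All the degenerations rest on one fact: injectivity of a linear map that depends polynomially on
    t is an open condition, so it may be tested at t = 0 once each condition has been divided by its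
    lowest power of t. Both halves of the theorem are the one bound h0 <= max(0, C(d+3,3) - length),
    proved for a single configuration; the truncated subtraction of natural numbers expresses it,
    and the defect [k] in [good] carries it through the induction. The obstacle is the arbitrary
    ratio of 4-points to 3-points. To avoid certificates for all mixtures on all pieces, a piece of
    20 k exponents is certified for pure supplies only, and then must choose from a supply exceeding
    its need by k units. This reserve, called slack, costs nothing if the pieces are served in the
    right order: the selective ones early, while the units destined for the tolerant ones are still
    unspent. A large piece must therefore contain enough tolerant volume, and this is what makes the
    degree large: slack disappears from blocks and slabs at edge length 25 and from the whole
    simplex at 38. *)

Definition expn3 : Type := (nat * nat * nat)%type.

Section Interpolation.
Variable K : closedFieldType.

Lemma nonroot_avoiding0 (p : {poly K}) : p != 0 -> exists2 t : K, t != 0 & p.[t] != 0.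
Proof.
move=> p0; have : 'X * p != 0 by rewrite mulf_neq0 ?polyX_eq0.
case/closed_nonrootP=> t; rewrite rootE hornerM hornerX mulf_eq0 negb_or => /andP[t0 pt0].
by exists t.
Qed.

(* A maximal minor that does not vanish at t = 0 does not vanish at some t != 0 either. *)
Lemma injective_open (T I : eqType) (D : seq T) (l : seq I) (phi : I -> T -> {poly K}) (r : {poly K}) :
  uniq D -> r != 0 ->
  (forall f : T -> K, (forall c, c \in l -> \sum_(p <- D) f p * (phi c p).[0] = 0) ->
     forall p, p \in D -> f p = 0) ->
  exists t : K, [/\ t != 0, r.[t] != 0 &
   forall f : T -> K, (forall c, c \in l -> \sum_(p <- D) f p * (phi c p).[t] = 0) ->
     forall p, p \in D -> f p = 0].
Proof.
move=> uD r0 inj0.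
pose A := \matrix_(i < size D, j < size l) phi (tnth (in_tuple l) j) (tnth (in_tuple D) i).
pose At (t : K) := map_mx (horner_eval t) A.
have sumE t (f : T -> K) j :
  ((\row_(i < size D) f (tnth (in_tuple D) i)) *m At t) 0 j
   = \sum_(p <- D) f p * (phi (tnth (in_tuple l) j) p).[t].
  rewrite mxE [RHS]big_tnth; apply: eq_bigr => i _.
  by rewrite !mxE /horner_eval.
have free0 : row_free (At 0).
  rewrite -kermx_eq0; apply/eqP/row_matrixP => i; rewrite row0.
  set v := row i _.
  have vA : v *m At 0 = 0 by rewrite -row_mul mulmx_ker row0.
  pose f (x : T) : K := if insub (index x D) is Some k then v 0 k else 0.
  have fE k : f (tnth (in_tuple D) k) = v 0 k.
    rewrite /f (tnth_nth (tnth (in_tuple D) k)) /= index_uniq //.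
    by case: insubP => [k' _ /val_inj -> //|]; rewrite ltn_ord.
  have vE : v = \row_i f (tnth (in_tuple D) i).
    by apply/rowP => k; rewrite [RHS]mxE fE.
  apply/rowP => k; rewrite -(fE k) [RHS]mxE; apply: inj0; last exact: mem_tnth.
  move=> c /(nthP c)[j jl <-].
  have := sumE 0 f (Ordinal jl); rewrite -vE vA mxE => /esym.
  by rewrite (tnth_nth c).
(* No minor has to be chosen: with a right inverse [B] of the matrix at 0, the polynomial det (A B)
   takes the value 1 at 0. *)
have [B AB] := row_freeP free0.
pose dp : {poly K} := \det (A *m map_mx polyC B).
have dpE t : dp.[t] = \det (At t *m B).
  have -> : dp.[t] = horner_eval t dp by [].
  rewrite -det_map_mx map_mxM -map_mx_comp (_ : map_mx _ B = B) //.
  by apply/matrixP => i j; rewrite mxE /= /horner_eval hornerC.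
have dp0 : r * dp != 0.
  rewrite mulf_neq0 //; apply/eqP => e; have := dpE 0.
  by rewrite e horner0 AB det1 => /esym/eqP; rewrite oner_eq0.
have [t t0] := nonroot_avoiding0 dp0.
rewrite hornerM mulf_eq0 negb_or => /andP[rt dt].
exists t; split=> // f hf p pD.
have freet : (\row_(i < size D) f (tnth (in_tuple D) i)) *m (At t *m B) = 0.
  rewrite mulmxA (_ : _ *m At t = 0) ?mul0mx //.
  by apply/rowP => j; rewrite sumE mxE hf // mem_tnth.
have Bu : At t *m B \in unitmx by rewrite unitmxE -dpE unitfE.
have /rowP := congr1 (mulmxr (invmx (At t *m B))) freet.
rewrite /= -mulmxA mulmxV // mulmx1 mul0mx.
have ip : (index p D < size D)%N by rewrite index_mem.
move/(_ (Ordinal ip)); rewrite !mxE (tnth_nth p) /= nth_index //.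
Qed.

Definition expo (u : K * K * K) (p : expn3) : K :=
  u.1.1 ^+ p.1.1 * u.1.2 ^+ p.1.2 * u.2 ^+ p.2.

(** [expo u p * wt b p] is u^b times the value at u of the Hasse derivative D^b of x^p. On the torus
    u^b is a unit, and keeping it avoids the exponents p - b; [vanish] is thus vanishing to order m
    at u. *)
Definition wt (b p : expn3) : K := ('C(p.1.1, b.1.1) * 'C(p.1.2, b.1.2) * 'C(p.2, b.2))%:R.

Definition deg3 (b : expn3) : nat := (b.1.1 + b.1.2 + b.2)%N.

Definition box3 (n : nat) : seq expn3 := [seq (ij, a) | ij <- [seq (i, j) | i <- iota 0 n, j <- iota 0 n], a <- iota 0 n].

Definition monos (m : nat) : seq expn3 := [seq b <- box3 m | (deg3 b < m)%N].

Lemma mem_box3 n p : (p \in box3 n) = [&& p.1.1 < n, p.1.2 < n & p.2 < n]%N.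
Proof.
case: p => [[i j] a]; apply/allpairsP/idP => /=.
  by case=> -[[i' j'] a'] /= [/allpairsP[[x y] /= [+ + [-> ->]]] + [-> -> ->]]; rewrite !mem_iota /= => -> -> ->.
case/and3P=> hi hj ha; exists ((i, j), a); split; rewrite ?mem_iota //=.
by apply/allpairsP; exists (i, j); rewrite !mem_iota.
Qed.

Lemma box3_uniq n : uniq (box3 n).
Proof.
by apply: allpairs_uniq; rewrite ?iota_uniq //; [apply: allpairs_uniq; rewrite ?iota_uniq // |];
  move=> [? ?] [? ?] _ _ [-> ->].
Qed.

Lemma mem_monos m b : (b \in monos m) = (deg3 b < m)%N.
Proof.
rewrite mem_filter mem_box3; case: b => [[i j] a]; rewrite /deg3 /=.
by apply/andP/idP => [[]//|h]; split=> //; apply/and3P; split; lia.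
Qed.

Lemma monos_uniq m : uniq (monos m). Proof. by rewrite filter_uniq ?box3_uniq. Qed.

Definition torus (u : K * K * K) : bool := [&& u.1.1 != 0, u.1.2 != 0 & u.2 != 0].

Definition vanish (D : seq expn3) (f : expn3 -> K) (m : nat) (u : K * K * K) : Prop :=
  forall b, (deg3 b < m)%N -> \sum_(p <- D) f p * expo u p * wt b p = 0.

(* For suitable points of multiplicities ms, the polynomials with exponents in D that vanish there
   form a space of dimension at most k: k linear conditions G suffice to kill them. *)
Definition good (D : seq expn3) (ms : seq nat) (k : nat) : Prop :=
  exists (P : seq (nat * (K * K * K))) (G : nat -> expn3 -> K),
   [/\ perm_eq [seq c.1 | c <- P] ms, {in P, forall c, torus c.2} &
    forall f : expn3 -> K, {in P, forall c, vanish D f c.1 c.2} ->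
      (forall i, (i < k)%N -> \sum_(p <- D) f p * G i p = 0) ->
      {in D, forall p, f p = 0}].

End Interpolation.

End Exponents.

Section Basics.
Local Open Scope ring_scope.

Section Good.
Variable K : closedFieldType.
Implicit Types (D : seq expn3) (ms : seq nat) (u : K * K * K).
Local Notation good := (good K).

Lemma vanish_perm D D' (f : expn3 -> K) m u : perm_eq D D' -> vanish D f m u -> vanish D' f m u.
Proof. by move=> pD v b hb; rewrite -(perm_big _ pD) v. Qed.

Lemma good_perm_dom D D' ms k : perm_eq D D' -> good D ms k -> good D' ms k.
Proof.
move=> pD [P [G [hP tP inj]]]; exists P, G; split=> // f vf gf p; rewrite -(perm_mem pD).
apply: inj => [c cP|i ik]; first by apply: vanish_perm (vf c cP); rewrite perm_sym.
by rewrite (perm_big _ pD) gf.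
Qed.

Lemma good_perm D ms ms' k : perm_eq ms ms' -> good D ms k -> good D ms' k.
Proof. by move=> pm [P [G [hP tP inj]]]; exists P, G; split=> //; apply: perm_trans pm. Qed.

Lemma good_nil k : good [::] [::] k.
Proof. by exists [::], (fun _ _ => 0); split. Qed.

Lemma good_le D ms k k' : (k <= k')%N -> good D ms k -> good D ms k'.
Proof.
by move=> kk' [P [G [hP tP inj]]]; exists P, G; split=> // f vf gf; apply: inj => // i ik; apply: gf; lia.
Qed.

Lemma torus1 : torus ((1, 1, 1) : K * K * K). Proof. by rewrite /torus !oner_eq0. Qed.

Lemma good_add D m ms k : good D ms k -> good D (m :: ms) k.
Proof.
move=> [P [G [hP tP inj]]]; exists ((m, (1, 1, 1)) :: P), G; split.
- by rewrite perm_cons.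
- by move=> c; rewrite inE => /orP[/eqP-> //|/tP//]; exact: torus1.
- by move=> f vf gf; apply: inj => // c cP; apply: vf; rewrite inE cP orbT.
Qed.

(** The conditions of the dropped point join the functionals [G], one for each Hasse derivative of
    order less than m. *)
Lemma good_drop D m ms k : good D (m :: ms) k -> good D ms (k + size (monos m)).
Proof.
move=> [P [G [hP tP inj]]].
have /mapP[[m' u] cP /= e] : m \in [seq c.1 | c <- P] by rewrite (perm_mem hP) mem_head.
subst m'.
exists (rem (m, u) P), (fun i => if (i < k)%N then G i else
  fun p => expo u p * wt K (nth (0, 0, 0)%N (monos m) (i - k)) p); split.
- rewrite -(perm_cons m); apply: perm_trans hP.
  by rewrite perm_sym (perm_map fst (perm_to_rem cP)).
- by move=> c /mem_rem /tP.
- move=> f vf gf; apply: inj => [c|i ik]; last by have := gf i; rewrite ik; apply; rewrite ltn_addr.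
  rewrite (perm_mem (perm_to_rem cP)) inE => /orP[/eqP-> b /= hb|/vf //].
  have hi : (index b (monos m) < size (monos m))%N by rewrite index_mem mem_monos.
  apply: etrans (gf (k + index b (monos m))%N _); last by rewrite ltn_add2l.
  apply: eq_bigr => p _.
  by rewrite ltnNge leq_addr /= addKn nth_index ?mem_monos // mulrA.
Qed.

Definition pairing (F : int * int * int) (p : expn3) : int :=
  F.1.1 * p.1.1%:Z + F.1.2 * p.1.2%:Z + F.2 * p.2%:Z.

Definition scale (t : K) (F : int * int * int) (u : K * K * K) : K * K * K :=
  (u.1.1 * t ^ F.1.1, u.1.2 * t ^ F.1.2, u.2 * t ^ F.2).

Lemma expo_scale t F u p : t != 0 -> expo (scale t F u) p = expo u p * t ^ pairing F p.
Proof.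
move=> t0; have h f n : (t ^ f) ^+ n = t ^ (f * n%:Z) by rewrite -exprz_exp.
by rewrite /expo /scale /pairing /= !exprMn !h !expfzDr //; ring.
Qed.

Lemma torus_scale t F u : t != 0 -> torus (scale t F u) = torus u.
Proof. by move=> t0; rewrite /torus /scale /= !mulf_eq0 !negb_or !expfz_neq0 // !andbT. Qed.

Lemma expr_abs (t : K) (a b : int) : a <= b -> t != 0 -> t ^+ `|b - a|%N * t ^ a = t ^ b.
Proof.
move=> ab t0; rewrite -[t ^+ _]/(t ^ (Posz _)) -expfzDr // gez0_abs; last by rewrite subr_ge0.
by rewrite subrK.
Qed.

Lemma expr_abs0 (a b : int) : (0 : K) ^+ `|b - a|%N = (a == b)%:R.
Proof. by rewrite expr0n absz_eq0 subr_eq0 eq_sym. Qed.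

End Good.

End Basics.

(** * Cutting and greedy removal *)

Section Degeneration.
Local Open Scope ring_scope.

Section Good.
Variable K : closedFieldType.
Implicit Types (D : seq expn3) (ms : seq nat) (u : K * K * K).
Local Notation good := (good K).

(* Move the points of ms1 by t ^ F with t -> 0: D1 and D2 decouple in the limit. *)
Lemma good_cut_strict D1 D2 ms1 ms2 k1 k2 F (c : int) :
  uniq D1 -> uniq D2 ->
  {in D1, forall p, pairing F p < c} -> {in D2, forall p, c < pairing F p} ->
  good D1 ms1 k1 -> good D2 ms2 k2 -> good (D1 ++ D2) (ms1 ++ ms2) (k1 + k2).
Proof.
move=> u1 u2 lt1 gt2 [P1 [G1 [hP1 tP1 inj1]]] [P2 [G2 [hP2 tP2 inj2]]].
have uD : uniq (D1 ++ D2).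
  rewrite cat_uniq u1 u2 andbT; apply/hasPn => p /gt2 h; apply/negP => /lt1.
  by rewrite ltNge (ltW h).
pose I := ((nat * (K * K * K)) * expn3 + (nat * (K * K * K)) * expn3 + (nat + nat))%type.
pose phi (x : I) (p : expn3) : {poly K} := match x with
  | inl (inl (cu, b)) => (expo cu.2 p * wt K b p)%:P *
       (if pairing F p < c then 1 else 'X ^+ `|pairing F p - c|%N)
  | inl (inr (cu, b)) => (expo cu.2 p * wt K b p)%:P *
       (if pairing F p < c then 'X ^+ `|c - pairing F p|%N else 1)
  | inr (inl i) => if pairing F p < c then (G1 i p)%:P else 0
  | inr (inr i) => if pairing F p < c then 0 else (G2 i p)%:P end.
pose l : seq I := [seq inl (inl (cu, b)) | cu <- P1, b <- monos cu.1] ++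
  [seq inl (inr (cu, b)) | cu <- P2, b <- monos cu.1] ++
  [seq inr (inl i) | i <- iota 0 k1] ++ [seq inr (inr i) | i <- iota 0 k2].
have phi1 x p : p \in D1 -> (phi x p).[0] = match x with
  | inl (inl (cu, b)) => expo cu.2 p * wt K b p
  | inl (inr (cu, b)) => 0
  | inr (inl i) => G1 i p
  | inr (inr i) => 0 end.
  move=> /lt1 h; case: x => [[[cu b]|[cu b]]|[i|i]] /=; rewrite h ?hornerC ?horner0 //.
  + by rewrite mulr1 hornerC.
  + by rewrite hornerM hornerXn expr_abs0 (lt_eqF h) mulr0.
have phi2 x p : p \in D2 -> (phi x p).[0] = match x with
  | inl (inl (cu, b)) => 0
  | inl (inr (cu, b)) => expo cu.2 p * wt K b p
  | inr (inl i) => 0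
  | inr (inr i) => G2 i p end.
  move=> /gt2 h; have h' : (pairing F p < c) = false by apply/negbTE; rewrite -leNgt ltW.
  case: x => [[[cu b]|[cu b]]|[i|i]] /=; rewrite h' ?hornerC ?horner0 //.
  + by rewrite hornerM hornerXn expr_abs0 (lt_eqF h) mulr0.
  + by rewrite mulr1 hornerC.
have sum0 f x : \sum_(p <- D1 ++ D2) f p * (phi x p).[0] = match x with
  | inl (inl (cu, b)) => \sum_(p <- D1) f p * (expo cu.2 p * wt K b p)
  | inl (inr (cu, b)) => \sum_(p <- D2) f p * (expo cu.2 p * wt K b p)
  | inr (inl i) => \sum_(p <- D1) f p * G1 i p
  | inr (inr i) => \sum_(p <- D2) f p * G2 i p end.
  rewrite big_cat /= [X in X + _]big_seq [X in _ + X]big_seq.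
  under eq_bigr => p pD do rewrite phi1 //.
  under [X in _ + X]eq_bigr => p pD do rewrite phi2 //.
  rewrite -!big_seq.
  case: x => [[[cu b]|[cu b]]|[i|i]].
  + by rewrite [X in _ + X]big1 ?addr0 // => p _; rewrite mulr0.
  + by rewrite [X in X + _]big1 ?add0r // => p _; rewrite mulr0.
  + by rewrite [X in _ + X]big1 ?addr0 // => p _; rewrite mulr0.
  + by rewrite [X in X + _]big1 ?add0r // => p _; rewrite mulr0.
have inl1 cu b : cu \in P1 -> (deg3 b < cu.1)%N -> inl (inl (cu, b)) \in l.
  move=> h1 h2; rewrite mem_cat; apply/orP; left.
  by apply/allpairsPdep; exists cu, b; rewrite mem_monos.
have inl2 cu b : cu \in P2 -> (deg3 b < cu.1)%N -> inl (inr (cu, b)) \in l.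
  move=> h1 h2; rewrite !mem_cat; apply/orP; right; apply/orP; left.
  by apply/allpairsPdep; exists cu, b; rewrite mem_monos.
have inr1 i : (i < k1)%N -> inr (inl i) \in l.
  by move=> h; rewrite !mem_cat map_f ?orbT // mem_iota.
have inr2 i : (i < k2)%N -> inr (inr i) \in l.
  by move=> h; rewrite !mem_cat map_f ?orbT // mem_iota.
have [|t [t0 _ injt]] := injective_open (l := l) (phi := phi) uD (oner_neq0 _).
  move=> f hf p; rewrite mem_cat => /orP[]; move: p; [apply: inj1|apply: inj2].
  - move=> cu cuP b hb; have := hf _ (inl1 _ _ cuP hb); rewrite sum0 => h; apply: (eq_trans _ h).
    by apply: eq_bigr => p _; rewrite [RHS]mulrA.
  - by move=> i /inr1 /hf; rewrite sum0.
  - move=> cu cuP b hb; have := hf _ (inl2 _ _ cuP hb); rewrite sum0 => h; apply: (eq_trans _ h).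
    by apply: eq_bigr => p _; rewrite [RHS]mulrA.
  - by move=> i /inr2 /hf; rewrite sum0.
(* The new unknowns are f p t^min(F p, c). In terms of them the conditions of the moved points have
   coefficient t^(F p - c) beyond c and 1 below, while those of the fixed points, multiplied by t^c,
   have coefficient t^(c - F p) below c and 1 beyond. At t = 0 each family sees its own part
   only. *)
pose th p := t ^ (if pairing F p < c then pairing F p else c).
have th0 p : th p != 0 by rewrite expfz_neq0.
exists ([seq (cu.1, scale t F cu.2) | cu <- P1] ++ P2),
  (fun i p => th p * (if (i < k1)%N then (phi (inr (inl i)) p).[t] else (phi (inr (inr (i - k1)%N)) p).[t])).
split.
- by rewrite map_cat -map_comp perm_cat.
- by move=> cu; rewrite mem_cat => /orP[/mapP[cv /tP1 h ->]|/tP2 //]; rewrite torus_scale.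
move=> f vf gf p pD; apply: (mulIf (th0 p)); rewrite mul0r.
apply: (injt (fun p => f p * th p)) => // x.
rewrite !mem_cat => /or4P[/allpairsPdep[cu [b [cuP hb ->]]]|/allpairsPdep[cu [b [cuP hb ->]]]|
    /mapP[i hi ->]|/mapP[i hi ->]] /=.
- rewrite mem_monos in hb.
  have := vf (cu.1, scale t F cu.2); rewrite mem_cat map_f // => /(_ isT b hb) h; apply: (eq_trans _ h).
  apply: eq_bigr => q _ /=; rewrite expo_scale // /th; case: ltP => hc.
    by rewrite mulr1 hornerC; ring.
  rewrite hornerM hornerC hornerXn -(expr_abs hc t0); ring.
- rewrite mem_monos in hb.
  have := vf cu; rewrite mem_cat cuP orbT => /(_ isT b hb) h.
  apply: (eq_trans _ (etrans (congr1 ( *%R (t ^ c)) h) (mulr0 _))).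
  rewrite [RHS]big_distrr /=; apply: eq_bigr => q _ /=; rewrite /th; case: ltP => hc.
    by rewrite hornerM hornerC hornerXn -(expr_abs (ltW hc) t0); ring.
  by rewrite mulr1 hornerC; ring.
- have ik : (i < k1)%N by move: hi; rewrite mem_iota.
  have := gf i; rewrite ltn_addr // => /(_ isT) h; apply: (eq_trans _ h).
  by apply: eq_bigr => q _; rewrite ik mulrA.
- have ik : (i < k2)%N by move: hi; rewrite mem_iota.
  have := gf (k1 + i)%N; rewrite ltn_add2l ik => /(_ isT) h; apply: (eq_trans _ h).
  by apply: eq_bigr => q _; rewrite ltnNge leq_addr /= addKn mulrA.
Qed.

Lemma good_cut D ms1 ms2 k1 k2 F (c : int) : uniq D ->
  good [seq p <- D | pairing F p < c] ms1 k1 ->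
  good [seq p <- D | c <= pairing F p] ms2 k2 -> good D (ms1 ++ ms2) (k1 + k2).
Proof.
move=> uD g1 g2.
have pD : perm_eq ([seq p <- D | pairing F p < c] ++ [seq p <- D | c <= pairing F p]) D.
  rewrite (eq_filter (a2 := predC (fun p => pairing F p < c)) (a1 := fun p => c <= _)) ?perm_filterC //.
  by move=> p /=; rewrite leNgt.
apply: good_perm_dom pD _.
(* Twice the functional takes even values only, so the threshold 2 c - 1 is never attained and the
   cut becomes strict. *)
pose F2 := (F.1.1 * 2, F.1.2 * 2, F.2 * 2).
have F2E p : pairing F2 p = pairing F p * 2 by rewrite /pairing /=; ring.
apply: (good_cut_strict (F := F2) (c := c * 2 - 1)) => //; rewrite ?filter_uniq //.
  by move=> p; rewrite mem_filter F2E => /andP[h _]; lia.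
by move=> p; rewrite mem_filter F2E => /andP[h _]; lia.
Qed.

(* The polynomial functions of degree < m, whose pairing with f is zero when vanish D f m u. *)
Inductive polyfn : nat -> (expn3 -> K) -> Prop :=
| polyfn_wt m b : (deg3 b < m)%N -> polyfn m (wt K b)
| polyfn_add m g h : polyfn m g -> polyfn m h -> polyfn m (fun p => g p + h p)
| polyfn_scale m a g : polyfn m g -> polyfn m (fun p => a * g p)
| polyfn_ext m g h : g =1 h -> polyfn m g -> polyfn m h.

Lemma vanish_polyfn D f m u g : vanish D f m u -> polyfn m g ->
  \sum_(p <- D) f p * expo u p * g p = 0.
Proof.
move=> vf pg; elim: pg vf => {m g} [m b hb|m g h _ ig _ ih|m a g _ ig|m g h e _ ig] vf.
- exact: vf.
- under eq_bigr do rewrite mulrDr.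
  by rewrite big_split /= ig // ih // addr0.
- under eq_bigr do rewrite mulrCA.
  by rewrite -big_distrr /= ig // mulr0.
- by apply: (eq_trans _ (ig vf)); apply: eq_bigr => p _; rewrite e.
Qed.

(* Move one m-point by t ^ F with t -> 0: the condition q_i on f becomes f (s_i) = 0. *)
Lemma good_greedy D D' (S : seq expn3) (q : nat -> expn3 -> K) m ms k F :
  uniq D -> perm_eq D (S ++ D') ->
  (forall i, (i < size S)%N -> [/\ polyfn m (q i), q i (nth (0, 0, 0)%N S i) != 0 &
     forall p, p \in D -> pairing F p <= pairing F (nth (0, 0, 0)%N S i) ->
        p != nth (0, 0, 0)%N S i -> q i p = 0]) ->
  good D' ms k -> good D (m :: ms) k.
Proof.
set s := nth _ S => uD pD hq [P [G [hP tP inj]]].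
pose I := (nat + (nat * (K * K * K)) * expn3 + nat)%type.
pose phi (x : I) (p : expn3) : {poly K} := match x with
  | inl (inl i) => if pairing F (s i) <= pairing F p
       then (q i p)%:P * 'X ^+ `|pairing F p - pairing F (s i)|%N else 0
  | inl (inr (cu, b)) => (expo cu.2 p * wt K b p)%:P
  | inr i => if p \in S then 0 else (G i p)%:P end.
pose l : seq I := [seq inl (inl i) | i <- iota 0 (size S)] ++
  [seq inl (inr (cu, b)) | cu <- P, b <- monos cu.1] ++ [seq inr i | i <- iota 0 k].
have uS : uniq (S ++ D') by rewrite -(perm_uniq pD).
have sD i : (i < size S)%N -> s i \in D.
  by move=> h; rewrite (perm_mem pD) mem_cat mem_nth.
have phiS i p : (i < size S)%N -> p \in D -> (phi (inl (inl i)) p).[0] = if p == s i then q i p else 0.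
  move=> iS pin /=; have [_ _ h] := hq i iS; case: leP => hp; last first.
    by rewrite horner0; case: eqP hp => // ->; rewrite ltxx.
  rewrite hornerM hornerC hornerXn expr_abs0; case: (altP (p =P s i)) => [->|ne].
    by rewrite eqxx mulr1.
  case: eqP => e; rewrite ?mulr0 // h ?mul0r // -/(s i) e lexx //.
have [|t [t0 _ injt]] := injective_open (l := l) (phi := phi) uD (oner_neq0 _).
  move=> f hf.
  have fS i : (i < size S)%N -> f (s i) = 0.
    move=> iS; have [_ qi _] := hq i iS.
    have := hf (inl (inl i)); rewrite mem_cat map_f ?mem_iota // => /(_ isT).
    rewrite (bigD1_seq (s i)) ?sD //= big1_seq ?addr0 => [|p /andP[pne pin]].
      rewrite -[X in _ * X]/((phi (inl (inl i)) (s i)).[0]) phiS ?sD // eqxx => /eqP.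
      by rewrite mulf_eq0 (negbTE qi) orbF => /eqP.
    by rewrite -[X in _ * X]/((phi (inl (inl i)) p).[0]) phiS // (negbTE pne) mulr0.
  have fS' p : p \in S -> f p = 0.
    by move=> /(nthP (0, 0, 0)%N)[i iS <-]; apply: fS.
  have sumD (g : expn3 -> K) : \sum_(p <- D) f p * g p = \sum_(p <- D') f p * g p.
    rewrite (perm_big _ pD) big_cat /= big1_seq ?add0r // => p /andP[_ /fS' ->].
    by rewrite mul0r.
  move=> p; rewrite (perm_mem pD) mem_cat => /orP[/fS' //|].
  move: p; apply: inj => [cu cuP b hb|i ik].
    have := hf (inl (inr (cu, b))); rewrite !mem_cat.
    have -> : inl (inr (cu, b)) \in [seq inl (inr (cu, b)) : I | cu <- P, b <- monos cu.1].
      by apply/allpairsPdep; exists cu, b; rewrite mem_monos.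
    rewrite orbT => /(_ isT) h; apply: (eq_trans _ h); rewrite sumD.
    by apply: eq_bigr => p _; rewrite /= hornerC [RHS]mulrA.
  have := hf (inr i); rewrite !mem_cat map_f ?mem_iota // !orbT => /(_ isT) h; apply: (eq_trans _ h).
  rewrite sumD big_seq [RHS]big_seq; apply: eq_bigr => p pD' /=.
  have /negbTE -> : p \notin S.
    by move: uS; rewrite cat_uniq => /and3P[_ /hasPn hn _]; apply: hn.
  by rewrite hornerC.
exists ((m, scale t F (1, 1, 1)) :: P), (fun i p => (phi (inr i) p).[t]); split.
- by rewrite /= perm_cons.
- by move=> cu; rewrite inE => /orP[/eqP->|/tP //]; rewrite torus_scale // torus1.
move=> f vf gf; apply: injt => x.
rewrite !mem_cat => /or3P[/mapP[i hi ->]|/allpairsPdep[cu [b [cuP hb ->]]]|/mapP[i hi ->]] /=.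
- have iS : (i < size S)%N by move: hi; rewrite mem_iota.
  have [pq _ hz] := hq i iS.
  have := vanish_polyfn (vf _ (mem_head _ _)) pq => /= h.
  apply: (mulIf (expfz_neq0 (pairing F (s i)) t0)); rewrite mul0r; apply: (eq_trans _ h).
  rewrite big_distrl /= big_seq [RHS]big_seq.
  apply: eq_bigr => p pin; rewrite expo_scale // [expo (1, 1, 1) p](_ : _ = 1); last first.
    by rewrite /expo /= !expr1n !mulr1.
  case: leP => hp; first by rewrite hornerM hornerC hornerXn -(expr_abs hp t0); ring.
  rewrite horner0 hz ?mulr0 ?mul0r // ?(ltW hp) //.
  by apply: contraTN hp => /eqP <-; rewrite ltxx.
- rewrite mem_monos in hb.
  have := vf cu; rewrite inE cuP orbT => /(_ isT b hb) h; apply: (eq_trans _ h).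
  by apply: eq_bigr => p _; rewrite hornerC [LHS]mulrA.
- by apply: (gf i); move: hi; rewrite mem_iota.
Qed.

End Good.

End Degeneration.

(** * Translations and collisions *)

Section Translation.
Local Open Scope ring_scope.

Definition shift3 (v p : expn3) : expn3 := ((v.1.1 + p.1.1)%N, (v.1.2 + p.1.2)%N, (v.2 + p.2)%N).

Lemma shift3_inj v : injective (shift3 v).
Proof. by move=> [[a b] c] [[a' b'] c'] [/addnI-> /addnI-> /addnI->]. Qed.

Lemma shift3K v p : (v.1.1 <= p.1.1)%N -> (v.1.2 <= p.1.2)%N -> (v.2 <= p.2)%N ->
  shift3 v ((p.1.1 - v.1.1)%N, (p.1.2 - v.1.2)%N, (p.2 - v.2)%N) = p.
Proof. by case: p => [[i j] a] /= h1 h2 h3; rewrite /shift3 /= !subnKC. Qed.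

Lemma mem_shift3 v D p : (p \in map (shift3 v) D) =
  [&& v.1.1 <= p.1.1, v.1.2 <= p.1.2, v.2 <= p.2 &
      ((p.1.1 - v.1.1)%N, (p.1.2 - v.1.2)%N, (p.2 - v.2)%N) \in D]%N.
Proof.
apply/mapP/and4P => [[q qD ->]|[h1 h2 h3 h]]; last first.
  by exists ((p.1.1 - v.1.1)%N, (p.1.2 - v.1.2)%N, (p.2 - v.2)%N); rewrite ?shift3K.
by rewrite /shift3 /= !leq_addr !addKn; case: q qD => [[i j] a] /= ->.
Qed.

Section Good.
Variable K : closedFieldType.
Implicit Types (D : seq expn3) (ms : seq nat) (u : K * K * K).
Local Notation good := (good K).
Local Notation wt := (wt K).

(** The witness is morally p -> g (p - v), a polynomial of the same degree. Exponents being natural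
    numbers, it is built by unit steps from Pascal's rule C(n+1, k+1) - C(n, k) = C(n, k+1). *)
Lemma polyfn_shift m (g : expn3 -> K) v : polyfn m g ->
  exists2 g', polyfn m g' & forall p, g' (shift3 v p) = g p.
Proof.
have step (e : expn3) : (forall b m', (deg3 b < m')%N ->
      exists2 g' : expn3 -> K, polyfn m' g' & forall p, g' (shift3 e p) = wt b p) ->
    forall m' (g' : expn3 -> K), polyfn m' g' ->
      exists2 h, polyfn m' h & forall p, h (shift3 e p) = g' p.
  move=> hw m' g'; elim=> {m' g'} [m' b /hw//|m' g1 g2 _ [h1 p1 e1] _ [h2 p2 e2]|m' a g1 _ [h1 p1 e1]|m' g1 g2 e12 _ [h1 p1 e1]].
  - by exists (fun p => h1 p + h2 p); [exact: polyfn_add|move=> p; rewrite e1 e2].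
  - by exists (fun p => a * h1 p); [exact: polyfn_scale|move=> p; rewrite e1].
  - by exists h1 => // p; rewrite e1 e12.
have unit1 : forall m' (g' : expn3 -> K), polyfn m' g' ->
    exists2 h, polyfn m' h & forall p, h (shift3 (1, 0, 0)%N p) = g' p.
  apply: step => -[[b1 b2] b3] m'; elim: b1 => [|b1 ih] hb.
    by exists (wt (0, b2, b3)%N); [exact: polyfn_wt|move=> p; rewrite /wt /= !bin0].
  have [|g' pg eg] := ih; first by move: hb; rewrite /deg3 /=; lia.
  exists (fun p => wt (b1.+1, b2, b3) p + -1 * g' p).
    by apply: polyfn_add (polyfn_wt _ hb) (polyfn_scale _ pg).
  by move=> p; rewrite eg /wt /= add1n binS !mulnDl !natrD mulN1r addrK.
have unit2 : forall m' (g' : expn3 -> K), polyfn m' g' ->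
    exists2 h, polyfn m' h & forall p, h (shift3 (0, 1, 0)%N p) = g' p.
  apply: step => -[[b1 b2] b3] m'; elim: b2 => [|b2 ih] hb.
    by exists (wt (b1, 0, b3)%N); [exact: polyfn_wt|move=> p; rewrite /wt /= !bin0].
  have [|g' pg eg] := ih; first by move: hb; rewrite /deg3 /=; lia.
  exists (fun p => wt (b1, b2.+1, b3) p + -1 * g' p).
    by apply: polyfn_add (polyfn_wt _ hb) (polyfn_scale _ pg).
  by move=> p; rewrite eg /wt /= add1n binS mulnDr !mulnDl !natrD mulN1r addrK.
have unit3 : forall m' (g' : expn3 -> K), polyfn m' g' ->
    exists2 h, polyfn m' h & forall p, h (shift3 (0, 0, 1)%N p) = g' p.
  apply: step => -[[b1 b2] b3] m'; elim: b3 => [|b3 ih] hb.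
    by exists (wt (b1, b2, 0)%N); [exact: polyfn_wt|move=> p; rewrite /wt /= !bin0].
  have [|g' pg eg] := ih; first by move: hb; rewrite /deg3 /=; lia.
  exists (fun p => wt (b1, b2, b3.+1) p + -1 * g' p).
    by apply: polyfn_add (polyfn_wt _ hb) (polyfn_scale _ pg).
  by move=> p; rewrite eg /wt /= add1n binS mulnDr !natrD mulN1r addrK.
case: v => [[v1 v2] v3] pg.
elim: v1 => [|v1 [h ph eh]].
  elim: v2 => [|v2 [h ph eh]].
    elim: v3 => [|v3 [h ph eh]]; first by exists g => // -[[i j] a].
    have [h' ph' eh'] := unit3 _ _ ph; exists h' => // p; rewrite -eh -eh'.
    by congr h'; rewrite /shift3 /= !add0n add1n.
  have [h' ph' eh'] := unit2 _ _ ph; exists h' => // p; rewrite -eh -eh'.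
  by congr h'; rewrite /shift3 /= !add0n add1n.
have [h' ph' eh'] := unit1 _ _ ph; exists h' => // p; rewrite -eh -eh'.
by congr h'; rewrite /shift3 /= !add0n add1n.
Qed.

Lemma expo_shift u v p : expo u (shift3 v p) = expo u v * expo u p.
Proof. by rewrite /expo /= !exprD; ring. Qed.

Lemma expo_neq0 u p : torus u -> expo u p != 0.
Proof. by case/and3P=> h1 h2 h3; rewrite /expo !mulf_neq0 ?expf_neq0. Qed.

(** Translating exponents by v multiplies a polynomial by x^v, a unit on the torus, so the same
    points with the same multiplicities serve. *)
Lemma good_shift v D ms k : good D ms k -> good (map (shift3 v) D) ms k.
Proof.
move=> [P [G [hP tP inj]]].
exists P, (fun i p => G i ((p.1.1 - v.1.1)%N, (p.1.2 - v.1.2)%N, (p.2 - v.2)%N)); split=> // f vf gf.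
move=> _ /mapP[p pD ->]; apply: (inj (fun p => f (shift3 v p))) p pD => [c cP b hb|i ik].
  have [g pg eg] := polyfn_shift v (polyfn_wt K hb).
  have := vanish_polyfn (vf c cP) pg; rewrite big_map => h.
  apply: (mulfI (expo_neq0 v (tP c cP))); rewrite mulr0; apply: (eq_trans _ h).
  by rewrite big_distrr /=; apply: eq_bigr => p _; rewrite expo_shift eg; ring.
have := gf i ik; rewrite big_map => h; apply: (eq_trans _ h).
by apply: eq_bigr => -[[i1 i2] i3] _; rewrite /shift3 /= !addKn.
Qed.

Lemma polyfn_le m m' (g : expn3 -> K) : (m <= m')%N -> polyfn m g -> polyfn m' g.
Proof.
move=> le h; elim: h le => {m g} [m b hb|m g h _ ig _ ih|m a g _ ig|m g h e _ ig] le.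
- by apply: polyfn_wt; apply: leq_trans le.
- by apply: polyfn_add; [apply: ig|apply: ih].
- by apply: polyfn_scale; apply: ig.
- by apply: polyfn_ext e _; apply: ig.
Qed.

Lemma polyfn_const m a : polyfn m.+1 (fun=> a : K).
Proof.
apply: (@polyfn_ext _ _ (fun p => a * wt (0, 0, 0)%N p)) => [p|].
  by rewrite /wt /= !bin0 mulr1.
by apply: polyfn_scale; apply: polyfn_wt.
Qed.

Lemma mul_bin_self n k : (n * 'C(n, k) = k.+1 * 'C(n, k.+1) + k * 'C(n, k))%N.
Proof.
case: (leqP k n) => [le|lt]; last by rewrite !bin_small ?muln0 // ltnW.
by rewrite mul_bin_left -mulnDl subnK.
Qed.

(** Multiplication by a coordinate raises the degree by at most one, because n C(n, k) = (k+1) C(n,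
    k+1) + k C(n, k). This brings the falling factorials of the checker into [polyfn] without any
    division. *)
Lemma polyfn_coord (sel : expn3 -> nat) (inc : expn3 -> expn3) m (g : expn3 -> K) :
  (forall b, deg3 (inc b) = (deg3 b).+1) ->
  (forall b p, (sel p)%:R * wt b p = (sel b).+1%:R * wt (inc b) p + (sel b)%:R * wt b p) ->
  polyfn m g -> polyfn m.+1 (fun p => (sel p)%:R * g p).
Proof.
move=> hdeg hw; elim=> {m g} [m b hb|m g h _ ig _ ih|m a g _ ig|m g h e _ ig].
- apply: (polyfn_ext (fun p => esym (hw b p))); apply: polyfn_add; apply: polyfn_scale; apply: polyfn_wt.
    by rewrite hdeg ltnS.
  by rewrite ltnW // ltnS ltnW.
- apply: polyfn_ext (polyfn_add ig ih) => p; by rewrite mulrDr.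
- apply: polyfn_ext (polyfn_scale a ig) => p; by rewrite mulrCA.
- by apply: polyfn_ext ig => p; rewrite e.
Qed.

Lemma polyfn_x1 m (g : expn3 -> K) : polyfn m g -> polyfn m.+1 (fun p => p.1.1%:R * g p).
Proof.
apply: (@polyfn_coord (fun p => p.1.1) (fun b => (b.1.1.+1, b.1.2, b.2))) => // b p.
by rewrite /wt -!natrM -natrD !mulnA -!mulnDl -mul_bin_self.
Qed.

Lemma polyfn_x2 m (g : expn3 -> K) : polyfn m g -> polyfn m.+1 (fun p => p.1.2%:R * g p).
Proof.
apply: (@polyfn_coord (fun p => p.1.2) (fun b => (b.1.1, b.1.2.+1, b.2))) => [b|b p].
  by rewrite /deg3 /=; lia.
rewrite /wt -!natrM -natrD; congr _%:R => /=.
transitivity ('C(p.1.1, b.1.1) * (p.1.2 * 'C(p.1.2, b.1.2)) * 'C(p.2, b.2))%N; first by ring.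
by rewrite mul_bin_self; ring.
Qed.

Lemma polyfn_x3 m (g : expn3 -> K) : polyfn m g -> polyfn m.+1 (fun p => p.2%:R * g p).
Proof.
apply: (@polyfn_coord (fun p => p.2) (fun b => (b.1.1, b.1.2, b.2.+1))) => [b|b p].
  by rewrite /deg3 /=; lia.
rewrite /wt -!natrM -natrD; congr _%:R => /=.
transitivity ('C(p.1.1, b.1.1) * 'C(p.1.2, b.1.2) * (p.2 * 'C(p.2, b.2)))%N; first by ring.
by rewrite mul_bin_self; ring.
Qed.

End Good.

End Translation.

Section Collision.
Local Open Scope ring_scope.

Section Good.
Variable K : closedFieldType.
Implicit Types (D : seq expn3) (ms : seq nat) (u : K * K * K).
Local Notation good := (good K).
Local Notation wt := (wt K).

(** Functionals that determine f on D form a matrix with a right inverse, whose columns are the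
    [lam q]. In a collision [lam q] is the combination of the conditions of the colliding points
    that isolates the derivative of index q. *)
Lemma dual_basis (T I : eqType) (D : seq T) (l : seq I) (phi : I -> T -> K) :
  uniq D ->
  (forall f : T -> K, (forall c, c \in l -> \sum_(p <- D) f p * phi c p = 0) ->
     {in D, forall p, f p = 0}) ->
  exists lam : T -> 'I_(size l) -> K, {in D &, forall p q,
     \sum_(j < size l) phi (tnth (in_tuple l) j) p * lam q j = (p == q)%:R}.
Proof.
move=> uD inj.
pose A := \matrix_(i < size D, j < size l) phi (tnth (in_tuple l) j) (tnth (in_tuple D) i).
have free : row_free A.
  rewrite -kermx_eq0; apply/eqP/row_matrixP => i; rewrite row0.
  set v := row i _.
  have vA : v *m A = 0 by rewrite -row_mul mulmx_ker row0.
  pose f (x : T) : K := if insub (index x D) is Some k then v 0 k else 0.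
  have fE k : f (tnth (in_tuple D) k) = v 0 k.
    rewrite /f (tnth_nth (tnth (in_tuple D) k)) /= index_uniq //.
    by case: insubP => [k' _ /val_inj -> //|]; rewrite ltn_ord.
  apply/rowP => k; rewrite -(fE k) [RHS]mxE; apply: inj; last exact: mem_tnth.
  move=> c /(nthP c)[j jl <-].
  have /rowP/(_ (Ordinal jl)) := vA; rewrite !mxE => h; apply: (eq_trans _ h).
  rewrite big_tnth; apply: eq_bigr => x _; rewrite fE !mxE.
  by rewrite [in RHS](tnth_nth c).
have [B AB] := row_freeP free.
exists (fun q j => if insub (index q D) is Some k then B j k else 0) => p q pD qD.
have ip : (index p D < size D)%N by rewrite index_mem.
have iq : (index q D < size D)%N by rewrite index_mem.
have /matrixP/(_ (Ordinal ip) (Ordinal iq)) := AB; rewrite !mxE => h.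
transitivity ((Ordinal ip == Ordinal iq)%:R : K); last first.
  congr (nat_of_bool _)%:R; rewrite -val_eqE /=; apply/eqP/eqP => [e|-> //].
  by rewrite -(nth_index p pD) e nth_index.
rewrite -h; apply: eq_bigr => j _; rewrite !mxE (tnth_nth p (in_tuple D)) /= nth_index //.
by rewrite insubT.
Qed.

(** This is the Taylor expansion at 1, evaluated at 1 + z, of the b-th Hasse derivative of x^p in
    one variable. It reduces to the binomial theorem by C(p, d) C(d, b) = C(p, b) C(p-b, d-b); the
    factor (1 + z)^b replaces the exponent p - b by p. *)
Lemma binomial_hasse (z : K) n p b : (p < n)%N ->
  (1 + z) ^+ b * \sum_(0 <= d < n) ('C(p, d) * 'C(d, b))%:R * z ^+ d =
  'C(p, b)%:R * z ^+ b * (1 + z) ^+ p.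
Proof.
move=> pn; case: (leqP b p) => bp; last first.
  rewrite bin_small // !mul0r big1 ?mulr0 // => d _.
  case: (leqP d p) => dp; first by rewrite (bin_small (leq_ltn_trans dp bp)) muln0 mul0r.
  by rewrite (bin_small dp) mul0r.
rewrite (big_cat_nat (n := b)) //=; last exact: ltnW (leq_ltn_trans bp pn).
rewrite big_nat big1 ?add0r => [|d /andP[_ db]]; last by rewrite (bin_small db) muln0 mul0r.
rewrite (big_cat_nat (n := p.+1)) //=; last exact: leqW.
have -> : \sum_(p.+1 <= d < n) ('C(p, d) * 'C(d, b))%:R * z ^+ d = 0.
  by rewrite big_nat big1 // => d /andP[pd _]; rewrite (bin_small pd) mul0r.
rewrite addr0.
have -> : (1 + z) ^+ p = (1 + z) ^+ b * (1 + z) ^+ (p - b) by rewrite -exprD subnKC.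
rewrite mulrCA; congr (_ * _).
rewrite [1 + z]addrC exprDn -{1}[b]add0n big_addn big_mkord subSn // big_distrr /=.
rewrite (reindex_inj rev_ord_inj) /=; apply: eq_bigr => i _.
have hi : (i <= p - b)%N by rewrite -ltnS.
rewrite expr1n mulr1 subSS.
have e : ('C(p, p - b - i + b) * 'C(p - b - i + b, b) = 'C(p, b) * 'C(p - b, i))%N.
  have fac x y : (y <= x)%N -> ('C(x, y) * (y`! * (x - y)`!) = x`!)%N by exact: bin_fact.
  have pos : (0 < b`! * (p - b - i)`! * i`!)%N by rewrite !muln_gt0 !fact_gt0.
  have h1 := fac p (p - b - i + b)%N; have h2 := fac (p - b - i + b)%N b.
  have h3 := fac p b bp; have h4 := fac (p - b)%N i hi.
  have e1 : (p - (p - b - i + b) = i)%N by lia.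
  have e2 : (p - b - i + b - b = p - b - i)%N by lia.
  rewrite e1 in h1; rewrite e2 in h2.
  have h1' := h1 ltac:(lia); have h2' := h2 ltac:(lia).
  apply/eqP; rewrite -(eqn_pmul2r pos); apply/eqP.
  transitivity ('C(p, p - b - i + b) * ('C(p - b - i + b, b) * (b`! * (p - b - i)`!) * i`!))%N; first by ring.
  rewrite h2' h1' -h3 -h4; ring.
rewrite e natrM -mulr_natr exprD; ring.
Qed.

Definition tangent (t : K) (v : K * K * K) : K * K * K := (1 + t * v.1.1, 1 + t * v.1.2, 1 + t * v.2).

Lemma big_box3 (V : nmodType) n (E : expn3 -> V) :
  \sum_(d <- box3 n) E d =
  \sum_(0 <= i < n) \sum_(0 <= j < n) \sum_(0 <= a < n) E (i, j, a).
Proof. by rewrite !big_allpairs; rewrite /index_iota subn0. Qed.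

(* The right hand side is a derivative at tangent t v, the left hand side its Taylor expansion
   in terms of the derivatives at (1, 1, 1). *)
Lemma expo_tangent t v n p b : (p.1.1 < n)%N -> (p.1.2 < n)%N -> (p.2 < n)%N ->
  expo (tangent t v) b * \sum_(d <- box3 n) wt d p * wt b d * (t ^+ deg3 d * expo v d) =
  t ^+ deg3 b * expo v b * (expo (tangent t v) p * wt b p).
Proof.
move=> h1 h2 h3; rewrite big_box3.
pose S (z : K) (x y : nat) := \sum_(0 <= d < n) ('C(x, d) * 'C(d, y))%:R * z ^+ d.
have -> : \sum_(0 <= i < n) \sum_(0 <= j < n) \sum_(0 <= a < n)
      wt (i, j, a) p * wt b (i, j, a) * (t ^+ deg3 (i, j, a) * expo v (i, j, a)) =
    S (t * v.1.1) p.1.1 b.1.1 * S (t * v.1.2) p.1.2 b.1.2 * S (t * v.2) p.2 b.2.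
  rewrite /S -mulrA big_distrl /=; apply: eq_bigr => i _.
  rewrite big_distrl /= big_distrr /=; apply: eq_bigr => j _.
  rewrite !big_distrr /=; apply: eq_bigr => a _.
  by rewrite /wt /expo /deg3 /= !natrM !exprMn !exprD; ring.
rewrite /expo /tangent /=.
transitivity (((1 + t * v.1.1) ^+ b.1.1 * S (t * v.1.1) p.1.1 b.1.1) *
  ((1 + t * v.1.2) ^+ b.1.2 * S (t * v.1.2) p.1.2 b.1.2) *
  ((1 + t * v.2) ^+ b.2 * S (t * v.2) p.2 b.2)); first by ring.
rewrite /S !binomial_hasse // /wt /deg3 !natrM !exprMn !exprD; ring.
Qed.

(* Let the points of ms' run into the m-point along u (1 + t v): their conditions on
   Taylor polynomials of degree < m being independent, the limit is the whole m-point. *)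
Lemma good_collision D ms ms' m k : uniq D ->
  good (monos m) ms' 0 -> good D (m :: ms) k -> good D (ms' ++ ms) k.
Proof.
move=> uD [Q [G0 [hQ tQ injQ]]] [P [G [hP tP inj]]].
have /mapP[[m' u] cP /= e] : m \in [seq c.1 | c <- P] by rewrite (perm_mem hP) mem_head.
subst m'; set P' := rem (m, u) P.
have memP c : (c \in P) = (c == (m, u)) || (c \in P') by rewrite (perm_mem (perm_to_rem cP)) inE.
have tu : torus u by exact: (tP _ cP).
pose l' := [seq (c, b) | c <- Q, b <- monos c.1].
have [|lam lamP] := @dual_basis _ _ (monos m) l' (fun x d => expo x.1.2 d * wt x.2 d) (monos_uniq m).
  move=> f hf p pm; apply: injQ => // c cQ b hb.
  have := hf (c, b); case: allpairsPdep => [_ /(_ isT) h|[]]; last first.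
    by exists c, b; rewrite mem_monos.
  by apply: (eq_trans _ h); apply: eq_bigr => q _; rewrite [RHS]mulrA.
(* The weight of the derivative d at u in the combination [lam q] of the conditions of the moved
   points. In degrees below m only d = q survives; after division by t^(deg q), the terms of degree
   at least m keep a positive power of t and vanish in the limit. *)
pose M q d : K := \sum_(j < size l') expo (tnth (in_tuple l') j).1.2 d *
    wt (tnth (in_tuple l') j).2 d * lam q j.
have ME q d : (deg3 q < m)%N -> (deg3 d < m)%N -> M q d = (d == q)%:R.
  by move=> hq hd; apply: lamP; rewrite mem_monos.
(* The box of side [n] contains every derivative that is nonzero on a monomial of D, hence the whole
   Taylor expansion; the summand m puts [monos m] into the box as well. *)
pose n := (m + \max_(p <- D) (deg3 p).+1)%N.
have nD p : p \in D -> (deg3 p < n)%N.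
  by move=> pD; rewrite /n ltn_addl // (@leq_bigmax_seq _ D predT (fun p => (deg3 p).+1) p).
pose I := (expn3 + (nat * (K * K * K)) * expn3 + nat)%type.
pose phi (x : I) (p : expn3) : {poly K} := match x with
  | inl (inl q) => (expo u p)%:P * ((wt q p)%:P +
      \sum_(d <- box3 n | (m <= deg3 d)%N) (M q d * wt d p)%:P * 'X ^+ (deg3 d - deg3 q)%N)
  | inl (inr (cu, b)) => (expo cu.2 p * wt b p)%:P
  | inr i => (G i p)%:P end.
pose l : seq I := [seq inl (inl q) | q <- monos m] ++
  [seq inl (inr (cu, b)) | cu <- P', b <- monos cu.1] ++ [seq inr i | i <- iota 0 k].
(* Where [r] does not vanish, the moved points lie in the torus. *)
pose r : {poly K} := \prod_(c <- Q) ((1 + c.2.1.1 *: 'X) * (1 + c.2.1.2 *: 'X) * (1 + c.2.2 *: 'X)).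
have hr t : r.[t] = \prod_(c <- Q) ((tangent t c.2).1.1 * (tangent t c.2).1.2 * (tangent t c.2).2).
  rewrite horner_prod; apply: eq_bigr => c _.
  by rewrite !hornerE /tangent /= ![t * _]mulrC.
have r0 : r != 0.
  apply/eqP => e; have := hr 0; rewrite e horner0 big1 => [/esym/eqP|c _]; first by rewrite oner_eq0.
  by rewrite /tangent !mul0r !addr0 !mulr1.
have [|t [t0 rt injt]] := injective_open (l := l) (phi := phi) uD r0.
  move=> f hf; apply: inj => [c|i ik]; last first.
    have := hf (inr i); rewrite !mem_cat map_f ?mem_iota // !orbT => /(_ isT) h.
    by apply: (eq_trans _ h); apply: eq_bigr => p _; rewrite hornerC.
  rewrite memP => /orP[/eqP ->|cP'] b /= hb.
    have := hf (inl (inl b)); rewrite mem_cat map_f ?mem_monos // => /(_ isT) h.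
    apply: (eq_trans _ h); apply: eq_bigr => p _ /=.
    rewrite hornerM hornerD !hornerC horner_sum big1 ?addr0 ?mulrA // => d hd.
    rewrite hornerM hornerXn expr0n subn_eq0 leqNgt (leq_trans hb hd).
    by rewrite mulr0.
  have := hf (inl (inr (c, b))); rewrite !mem_cat.
  have -> : inl (inr (c, b)) \in [seq inl (inr (cu, b)) : I | cu <- P', b <- monos cu.1].
    by apply/allpairsPdep; exists c, b; rewrite mem_monos.
  rewrite orbT => /(_ isT) h; apply: (eq_trans _ h); apply: eq_bigr => p _ /=.
  by rewrite hornerC [RHS]mulrA.
pose move c : nat * (K * K * K) :=
  (c.1, (u.1.1 * (tangent t c.2).1.1, u.1.2 * (tangent t c.2).1.2, u.2 * (tangent t c.2).2)).
have expo_move c p : expo (move c).2 p = expo u p * expo (tangent t c.2) p.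
  by rewrite /expo /= !exprMn; ring.
have tang c : c \in Q -> torus (tangent t c.2).
  move=> cQ; move: rt; rewrite hr prodf_seq_neq0 => /allP/(_ c cQ) /=.
  by rewrite !mulf_eq0 !negb_or -andbA.
exists ([seq move c | c <- Q] ++ P'), G; split.
- rewrite map_cat -map_comp (eq_map (g := fst)) // perm_cat //.
  rewrite -(perm_cons m); apply: perm_trans hP.
  by rewrite perm_sym (perm_map fst (perm_to_rem cP)).
- move=> c; rewrite mem_cat => /orP[/mapP[c' c'Q ->]|/mem_rem/tP //].
  have /and3P[h1 h2 h3] := tang c' c'Q; have /and3P[g1 g2 g3] := tu.
  by rewrite /torus /= !mulf_neq0.
move=> f vf gf; apply: injt => x.
rewrite !mem_cat => /or3P[/mapP[q hq ->]|/allpairsPdep[cu [b [cuP hb ->]]]|/mapP[i hi ->]] /=; last first.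
- rewrite mem_iota in hi; apply: (eq_trans _ (gf i hi)).
  by apply: eq_bigr => p _; rewrite hornerC.
- rewrite mem_monos in hb.
  have := vf cu; rewrite mem_cat cuP orbT => /(_ isT b hb) h; apply: (eq_trans _ h).
  by apply: eq_bigr => p _; rewrite hornerC [LHS]mulrA.
rewrite mem_monos in hq.
have hcond c b : c \in Q -> (deg3 b < c.1)%N ->
    \sum_(p <- D) f p * expo u p * \sum_(d <- box3 n) wt d p * wt b d * (t ^+ deg3 d * expo c.2 d) = 0.
  move=> cQ hb; have := vf (move c); rewrite mem_cat map_f // => /(_ isT b hb) h.
  apply: (mulfI (expo_neq0 b (tang c cQ))); rewrite mulr0.
  apply: (eq_trans _ (etrans (congr1 ( *%R (t ^+ deg3 b * expo c.2 b)) h) (mulr0 _))).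
  rewrite !big_distrr /= big_seq [RHS]big_seq; apply: eq_bigr => p /nD; rewrite /deg3 => hp.
  rewrite expo_move; rewrite mulrCA expo_tangent; [|lia..]; ring.
have hM : \sum_(p <- D) f p * expo u p * \sum_(d <- box3 n) wt d p * t ^+ deg3 d * M q d = 0.
  transitivity (\sum_(j < size l') lam q j * (\sum_(p <- D) f p * expo u p *
     \sum_(d <- box3 n) wt d p * wt (tnth (in_tuple l') j).2 d *
        (t ^+ deg3 d * expo (tnth (in_tuple l') j).1.2 d))).
    rewrite [RHS](eq_bigr (fun j => \sum_(p <- D) lam q j * (f p * expo u p *
     \sum_(d <- box3 n) wt d p * wt (tnth (in_tuple l') j).2 d *
        (t ^+ deg3 d * expo (tnth (in_tuple l') j).1.2 d)))); last by move=> j _; rewrite big_distrr.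
    rewrite exchange_big /=; apply: eq_bigr => p _.
    under [RHS]eq_bigr => j _ do rewrite mulrCA.
    rewrite -big_distrr /=; congr (_ * _).
    under [RHS]eq_bigr => j _ do rewrite big_distrr /=.
    rewrite exchange_big /=; apply: eq_bigr => d _.
    rewrite /M big_distrr /=; apply: eq_bigr => j _; ring.
  rewrite big1 // => j _.
  have := mem_tnth j (in_tuple l'); rewrite [_ \in _](_ : _ = (tnth (in_tuple l') j \in l')) //.
  case/allpairsPdep=> c [b [cQ hb ->]] /=.
  by rewrite mem_monos in hb; rewrite hcond ?mulr0.
apply: (mulfI (expf_neq0 (deg3 q) t0)); rewrite mulr0; apply: (eq_trans _ hM).
rewrite big_distrr /=; apply: eq_bigr => p _.
rewrite (bigID (fun d => (m <= deg3 d)%N) predT) /= hornerM hornerD !hornerC horner_sum.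
have -> : \sum_(d <- box3 n | ~~ (m <= deg3 d)%N) wt d p * t ^+ deg3 d * M q d = wt q p * t ^+ deg3 q.
  rewrite big_mkcond (bigD1_seq q) ?box3_uniq ?mem_box3 //=; last first.
    by rewrite /n; move: hq; rewrite /deg3; lia.
  rewrite -ltnNge hq ME // eqxx mulr1 big1 ?addr0 // => d dq.
  case: leqP => //= hd.
  by rewrite ME // (negbTE dq) mulr0.
set X := \sum_(_ <- _ | _) _; set Y := \sum_(_ <- _ | _) _.
suff -> : Y = t ^+ deg3 q * X by ring.
rewrite /X big_distrr; apply: eq_bigr => d hd /=.
rewrite -[in LHS](subnKC (leq_trans (ltnW hq) hd)) exprD.
by rewrite hornerM hornerC hornerXn; ring.
Qed.
End Good.

End Collision.

(** * A checker for greedy removals *)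

Section Checking.
Local Open Scope ring_scope.

Definition keyed : Type := (Z * expn3)%type.

Definition key (F : Z * Z * Z) (p : expn3) : Z :=
  Z.add (Z.add (Z.mul F.1.1 (Z.of_nat p.1.1)) (Z.mul F.1.2 (Z.of_nat p.1.2))) (Z.mul F.2 (Z.of_nat p.2)).

Fixpoint falling (n : nat) (x : Z) : seq Z :=
  if n is n'.+1 then Zpos xH :: map (Z.mul x) (falling n' (Z.pred x)) else [::].

(** Four falling factorials per variable suffice, since the certificates use multiplicities at most
    4, that is, degrees at most 3. The centre [x0] will be the first exponent in the current order,
    which keeps the integers small where elimination begins. *)
Definition basis_at (bs : seq expn3) (x0 p : expn3) : seq Z :=
  let fx := falling 4 (Z.sub (Z.of_nat p.1.1) (Z.of_nat x0.1.1)) in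
  let fy := falling 4 (Z.sub (Z.of_nat p.1.2) (Z.of_nat x0.1.2)) in
  let fz := falling 4 (Z.sub (Z.of_nat p.2) (Z.of_nat x0.2)) in
  map (fun b => Z.mul (Z.mul (nth Z0 fx b.1.1) (nth Z0 fy b.1.2)) (nth Z0 fz b.2)) bs.

Fixpoint dot (u v : seq Z) : Z :=
  match u, v with
  | a :: u', b :: v' => match b with Z0 => dot u' v' | _ => Z.add (Z.mul a b) (dot u' v') end
  | _, _ => Z0
  end.

Fixpoint addmul (c : Z) (u v : seq Z) : seq Z :=
  match u, v with
  | x :: u', y :: v' => match y with Z0 => x | _ => Z.add x (Z.mul c y) end :: addmul c u' v'
  | [::], _ => map (Z.mul c) v
  | _, [::] => u
  end.

Definition head0 (r : seq Z) : bool := Z.eqb (head Z0 r) Z0.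

(* A row is the value of an integer polynomial at the current point followed by the coefficients
   of the polynomial in the basis of products of falling factorials centred at x0. *)
Fixpoint pick_pivot (best : seq Z) (rows acc : seq (seq Z)) : seq Z * seq (seq Z) :=
  if rows is r :: rows' then
    if head0 r then pick_pivot best rows' (r :: acc)
    else if head0 best || Z.ltb (Z.abs (head Z0 r)) (Z.abs (head Z0 best))
      then pick_pivot r rows' (best :: acc) else pick_pivot best rows' (r :: acc)
  else (best, acc).

Definition clear_head (piv r : seq Z) : seq Z :=
  match head Z0 r with
  | Z0 => r
  | v => match head Z0 piv with
         | Zpos xH => addmul (Z.opp v) r piv
         | Zneg xH => addmul v r piv
         | w => addmul (Z.opp (Z.div v w)) r piv
         end
  end.

(** Euclid's algorithm on the values at the current exponent, by unimodular row operations: one row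
    retains their gcd up to sign and the others get the value 0. As no denominators arise, the
    result holds in every field where this gcd is invertible. Should the fuel run out, a nonzero
    value remains and [scan] fails. *)
Fixpoint euclid (fuel : nat) (piv : seq Z) (rows : seq (seq Z)) : seq Z * seq (seq Z) :=
  let rows' := map (clear_head piv) rows in
  if all head0 rows' then (piv, rows')
  else if fuel is f.+1 then
    let (piv', rows'') := pick_pivot piv rows' [::] in euclid f piv' rows''
  else (piv, rows').

(* The divisors of a power of 6 are invertible in characteristic different from 2 and 3. *)
Definition smooth (v : Z) : bool :=
  match v with
  | Zpos xH | Zneg xH => true
  | _ => Z.eqb (Z.modulo (Z.pow (Zpos 6) (Zpos 30)) v) Z0
  end.

Section Checker.
Variables (bs : seq expn3) (x0 : expn3).

(** An exponent at which all remaining polynomials vanish depends on the previous ones and stays in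
    the set. At any other exponent a pivot polynomial is spent, the exponent is removed, and the
    remaining rows vanish there. So each pivot vanishes at every exponent that precedes its own. *)
Fixpoint scan (Q : seq (seq Z)) (L acc : seq keyed) : option (seq keyed) :=
  match Q, L with
  | q :: Q', kp :: L' =>
    let w := basis_at bs x0 kp.2 in
    let (piv, rest) := pick_pivot (dot w q :: q) (map (fun q => dot w q :: q) Q') [::] in
    if head0 piv then scan Q L' (kp :: acc)
    else let (piv, rest) := euclid 30 piv rest in
      if smooth (head Z0 piv) && all head0 rest then scan (map behead rest) L' acc else None
  | _, _ => Some (catrev acc L)
  end.
End Checker.

Definition unit_rows (n : nat) : seq (seq Z) :=
  [seq [seq if i == j then Zpos xH else Z0 | j <- iota 0 n] | i <- iota 0 n].

(** The test for strictly increasing keys says that the functional separates the exponents still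
    present. It also rules out repetitions, as [good_greedy] requires. *)
Fixpoint remove_points (bs : seq expn3) (rows : seq (seq Z)) (n : nat) (L : seq keyed) : option (seq keyed) :=
  if n is n'.+1 then
    if sorted (fun a b : keyed => Z.ltb a.1 b.1) L then
      obind (remove_points bs rows n') (scan bs (head (0, 0, 0)%N (map snd L)) rows L [::])
    else None
  else Some L.

Definition sort_by (F : Z * Z * Z) (D : seq expn3) : seq keyed :=
  sort (fun a b : keyed => Z.leb a.1 b.1) (map (fun p => (key F p, p)) D).

(* A certificate lists triples (F, m, n): n successive m-points remove monomials in the order
   given by the linear functional F. *)
Fixpoint run (cs : seq (Z * Z * Z * nat * nat)) (D : seq expn3) : option (seq expn3) :=
  if cs is (F, m, n) :: cs' then
    let bs := monos m in
    obind (fun L => run cs' (map snd L)) (remove_points bs (unit_rows (size bs)) n (sort_by F D))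
  else Some D.

Definition step (a b c : Z) (m n : nat) : Z * Z * Z * nat * nat := (a, b, c, m, n).

Definition expand (cs : seq (Z * Z * Z * nat * nat)) : seq nat :=
  flatten [seq nseq c.2 c.1.2 | c <- cs].

Definition certifies (cs : seq (Z * Z * Z * nat * nat)) (D : seq expn3) (ms : seq nat) (k : nat) : bool :=
  (if run cs D is Some D' then (size D' == k) && uniq D' else false) &&
    perm_eq (expand cs) ms && all (fun c => 0 < c.1.2)%N cs.

Arguments euclid : simpl never.
Arguments smooth : simpl never.

Definition pairing_vec (F : Z * Z * Z) : int * int * int :=
  (int_of_Z F.1.1, int_of_Z F.1.2, int_of_Z F.2).

Lemma key_pairing F p : int_of_Z (key F p) = pairing (pairing_vec F) p.
Proof.
have e n : int_of_Z (Z.of_nat n) = n%:Z by case: n => //= n; rewrite SuccNat2Pos.id_succ.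
rewrite /key -[Z.add _ _]/((F.1.1 : Z) * Z.of_nat p.1.1 + F.1.2 * Z.of_nat p.1.2 + F.2 * Z.of_nat p.2).
by rewrite !rmorphD !rmorphM /= !e.
Qed.

Lemma int_of_Z_le a b : (int_of_Z a <= int_of_Z b) = Z.leb a b.
Proof. by apply/idP/idP; lia. Qed.

Section Soundness.
Variable K : closedFieldType.
Hypotheses (char2 : 2%:R != 0 :> K) (char3 : 3%:R != 0 :> K).
Local Notation good := (good K).

Definition inK (z : Z) : K := (int_of_Z z)%:~R.

Lemma inKD x y : inK (Z.add x y) = inK x + inK y.
Proof. by rewrite /inK -[Z.add x y]/(x + y) rmorphD rmorphD. Qed.

Lemma inKM x y : inK (Z.mul x y) = inK x * inK y.
Proof. by rewrite /inK -[Z.mul x y]/(x * y) rmorphM rmorphM. Qed.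

Lemma inK_nat n : inK (Z.of_nat n) = n%:R.
Proof. by case: n => // n; rewrite /inK /= SuccNat2Pos.id_succ pmulrn. Qed.

Lemma polyfn_sum m (T : Type) (s : seq T) (g : T -> expn3 -> K) :
  (forall t, polyfn m (g t)) -> (0 < m)%N -> polyfn m (fun p => \sum_(t <- s) g t p).
Proof.
move=> hg m0; elim: s => [|t s ih].
  apply: (@polyfn_ext _ _ (fun=> 0)) => [p|]; first by rewrite big_nil.
  by case: m m0 {hg} => // m _; exact: polyfn_const.
by apply: polyfn_ext (polyfn_add (hg t) ih) => p; rewrite big_cons.
Qed.

Lemma polyfn_falling (sel : expn3 -> nat) :
  (forall m (g : expn3 -> K), polyfn m g -> polyfn m.+1 (fun p => (sel p)%:R * g p)) ->
  forall n c m i g, polyfn m g ->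
    polyfn (m + i) (fun p => inK (nth Z0 (falling n (Z.add (Z.of_nat (sel p)) c)) i) * g p).
Proof.
move=> hsel; elim=> [|n ih] c m [|i] g pg /=.
- rewrite addn0; apply: (polyfn_ext _ (polyfn_scale 0 pg)) => p; by rewrite /inK.
- apply: polyfn_le (leq_addr _ _) _.
  apply: (polyfn_ext _ (polyfn_scale 0 pg)) => p; by rewrite /inK.
- by rewrite addn0; apply: (polyfn_ext _ pg) => p; rewrite /inK mul1r.
have h := ih (Z.pred c) m i g pg.
rewrite addnS; apply: (polyfn_ext _ (polyfn_add (hsel _ _ h)
   (polyfn_scale (inK c) (polyfn_le (leqnSn _) h)))) => p.
set x := Z.of_nat _; have -> : Z.add x (Z.pred c) = Z.pred (Z.add x c) by lia.
have [lt|ge] := ltnP i (size (falling n (Z.pred (Z.add x c)))).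
  by rewrite (nth_map Z0) // inKM inKD inK_nat; ring.
by rewrite !nth_default ?size_map // /inK /=; ring.
Qed.

Lemma inK_dot (u v : seq Z) n : (size u <= n)%N ->
  inK (dot u v) = \sum_(i < n) inK (nth Z0 u i) * inK (nth Z0 v i).
Proof.
elim: u v n => [|a u ih] [|b v] n /= hn.
- by rewrite big1 // => i _; rewrite nth_nil /inK mul0r.
- by rewrite big1 // => i _; rewrite nth_nil /inK mul0r.
- by rewrite big1 // => i _; rewrite nth_nil /inK mulr0.
case: n hn => // n hn; rewrite big_ord_recl /= -ih //.
have -> : inK (match b with Z0 => dot u v | _ => Z.add (Z.mul a b) (dot u v) end)
   = inK (Z.add (Z.mul a b) (dot u v)) by case: b => //; rewrite Z.mul_0_r Z.add_0_l.
by rewrite inKD inKM.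
Qed.

Lemma dot0 v : dot [::] v = Z0. Proof. by []. Qed.

Lemma dot_addmul w c u v : dot w (addmul c u v) = Z.add (dot w u) (Z.mul c (dot w v)).
Proof.
have d0 (x : seq Z) : dot x [::] = Z0 by case: x.
have dz a b x y : dot (a :: x) (b :: y) = Z.add (Z.mul a b) (dot x y) by case: b => //=; lia.
have dmap x y : dot x (map (Z.mul c) y) = Z.mul c (dot x y).
  elim: x y => [|a x ih] [|b y]; rewrite ?[map _ [::]]/= ?d0 ?dot0 ?Z.mul_0_r //.
  by rewrite [map _ _]/= !dz ih; lia.
elim: w u v => [|a w ih] u v; first by rewrite !dot0 Z.mul_0_r.
case: u v => [|x u] [|y v]; rewrite ?[addmul _ [::] _]/= ?[addmul _ (_ :: _) [::]]/= ?d0 ?dmap.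
- by rewrite Z.mul_0_r.
- by rewrite -[Z.mul c y :: _]/(map (Z.mul c) (y :: v)) dmap; lia.
- lia.
by rewrite [addmul _ _ _]/= !dz ih; case: y; lia.
Qed.

Lemma smooth_neq0 v : smooth v -> inK v != 0.
Proof.
rewrite /smooth => hv; have /Z.eqb_eq h : Z.eqb (Z.modulo (Z.pow (Zpos 6) (Zpos 30)) v) Z0 by case: v hv => [|[]|[]].
have [q e] : exists q, Z.mul v q = Z.pow (Zpos 6) (Zpos 30).
  have [e|ne] := eqVneq v Z0; first by rewrite e in h.
  by exists (Z.div (Z.pow (Zpos 6) (Zpos 30)) v); apply/esym/Z_div_exact_full_2 => //; apply/eqP.
have : inK (Z.pow (Zpos 6) (Zpos 30)) != 0.
  have -> : Z.pow (Zpos 6) (Zpos 30) = Z.of_nat 6 ^+ 30 by rewrite -[LHS]/(Z.pow (Z.of_nat 6) 30); vm_compute.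
  have -> : inK (Z.of_nat 6 ^+ 30) = (inK (Z.of_nat 6)) ^+ 30 by rewrite /inK !rmorphXn.
  by rewrite inK_nat expf_neq0 // (natrM _ 2 3) mulf_neq0.
by rewrite -e inKM mulf_eq0 negb_or => /andP[].
Qed.

Section Rows.
Variable P : seq Z -> Prop.
Hypothesis P_addmul : forall c u v, P u -> P v -> P (addmul c u v).

(** Elimination only permutes rows and adds multiples of rows to others, so a property closed under
    [addmul] passes to the result, whichever pivots are taken. *)
Lemma pick_pivotP best rows acc : P best -> {in rows, forall r, P r} -> {in acc, forall r, P r} ->
  let r := pick_pivot best rows acc in P r.1 /\ {in r.2, forall r, P r}.
Proof.
elim: rows best acc => [|r rows ih] best acc hb hr ha //=.
have hr0 : P r by apply: hr; rewrite mem_head.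
have hrs : {in rows, forall r, P r} by move=> s hs; apply: hr; rewrite inE hs orbT.
have hc s : P s -> {in s :: acc, forall r, P r} by move=> hs t; rewrite inE => /orP[/eqP ->//|/ha].
by case: ifP => _; [|case: ifP => _]; apply: ih => //; apply: hc.
Qed.

Lemma clear_headP piv r : P piv -> P r -> P (clear_head piv r).
Proof.
by move=> hp hr; rewrite /clear_head; case: (head Z0 r) => // v;
  case: (head Z0 piv) => [|[?|?|]|[?|?|]]; apply: P_addmul.
Qed.

Lemma euclidP fuel piv rows : P piv -> {in rows, forall r, P r} ->
  let r := euclid fuel piv rows in P r.1 /\ {in r.2, forall r, P r}.
Proof.
elim: fuel piv rows => [|f ih] piv rows hp hr; rewrite /euclid -/euclid /=.
  set rows' := map _ rows.
  suff h : {in rows', forall r, P r} by case: ifP.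
  by move=> s /mapP[r rr ->]; apply: clear_headP => //; apply: hr.
set rows' := map _ rows.
have h : {in rows', forall r, P r}.
  by move=> s /mapP[r rr ->]; apply: clear_headP => //; apply: hr.
case: ifP => _ //.
have [] := @pick_pivotP piv rows' [::] hp h => //.
by case: (pick_pivot _ _ _) => p2 r2 /= h1 h2; apply: ih.
Qed.

End Rows.

Definition eval_row bs x0 (q : seq Z) (p : expn3) : K := inK (dot (basis_at bs x0 p) q).

Lemma polyfn_eval_row m x0 q : (0 < m)%N -> polyfn m (eval_row (monos m) x0 q).
Proof.
move=> m0.
pose N := size (monos m).
pose g (i : 'I_N) p := inK (nth Z0 q i) * inK (nth Z0 (basis_at (monos m) x0 p) i).
apply: (@polyfn_ext _ _ (fun p => \sum_(i <- index_enum 'I_N) g i p)).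
  move=> p; rewrite /eval_row (@inK_dot _ _ N); last by rewrite size_map.
  by apply: eq_bigr => i _; rewrite mulrC.
apply: polyfn_sum => // i; apply: polyfn_scale.
have := mem_nth (0, 0, 0)%N (ltn_ord i); rewrite mem_monos; set b := nth _ _ _ => hb.
have h := polyfn_falling (@polyfn_x1 K) 4 (Z.opp (Z.of_nat x0.1.1)) b.1.1
  (polyfn_falling (@polyfn_x2 K) 4 (Z.opp (Z.of_nat x0.1.2)) b.1.2
  (polyfn_falling (@polyfn_x3 K) 4 (Z.opp (Z.of_nat x0.2)) b.2 (polyfn_const 0 (1 : K)))).
apply: (polyfn_ext _ (polyfn_le _ h)) => [p|]; last first.
  by move: hb; rewrite /deg3 /=; clear; lia.
by rewrite (nth_map (0, 0, 0)%N) // !inKM -/b -!Z.add_opp_r; ring.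
Qed.

Lemma head_addmul c u v : head Z0 (addmul c u v) = Z.add (head Z0 u) (Z.mul c (head Z0 v)).
Proof. by case: u v => [|x u] [|y v] //=; [lia..|case: y; lia]. Qed.

Lemma behead_addmul c u v : behead (addmul c u v) = addmul c (behead u) (behead v).
Proof. by case: u v => [|x [|x' u]] [|y v]. Qed.

Lemma eval_row_addmul bs x0 c u v p :
  eval_row bs x0 (addmul c u v) p = eval_row bs x0 u p + inK c * eval_row bs x0 v p.
Proof. by rewrite /eval_row dot_addmul inKD inKM. Qed.

Lemma pick_pivot_head0 best rows acc : head0 (pick_pivot best rows acc).1 ->
  head0 best && all head0 rows.
Proof.
elim: rows best acc => [|r rows ih] best acc /=; first by move=> ->.
case: ifP => hr; first by move=> /ih.
case: ifP => [_ /ih|/norP[hb _] /ih]; first by rewrite hr.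
by rewrite (negbTE hb).
Qed.

(** [pre] holds exponents already passed, where all surviving rows vanish. Pairing each removed
    exponent with its pivot polynomial yields the triangular system that [good_greedy] asks for. *)
Lemma scanP bs x0 (pre : seq expn3) Q L acc L' :
  {in Q, forall q, {in pre, forall p, eval_row bs x0 q p = 0}} ->
  sorted (fun a b : keyed => Z.ltb a.1 b.1) L ->
  scan bs x0 Q L acc = Some L' ->
  exists S : seq (keyed * seq Z),
   [/\ perm_eq (acc ++ L) (map fst S ++ L'), {subset map fst S <= L} &
     {in S, forall s, eval_row bs x0 s.2 s.1.2 != 0 /\
        {in pre, forall p, eval_row bs x0 s.2 p = 0} /\
        {in L, forall t, Z.leb t.1 s.1.1 -> t != s.1 -> eval_row bs x0 s.2 t.2 = 0}}].
Proof.
elim: L Q pre acc => [|kp L ih] Q pre acc hQ hL.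
  case: Q hQ => [|q Q] hQ [<-]; exists [::]; split=> //=; by rewrite cats0 catrevE cats0 perm_sym perm_rev.
case: Q hQ => [|q Q] hQ.
  by move=> [<-]; exists [::]; split=> //=; rewrite catrevE perm_cat2r perm_sym perm_rev.
rewrite /scan -/(scan bs x0).
set w := basis_at bs x0 kp.2.
(* The invariant of elimination at one exponent: the stored head is the value there of the
   polynomial in the tail, and that polynomial vanishes at all exponents passed before. *)
pose P (r : seq Z) := dot w (behead r) = head Z0 r /\ {in pre, forall p, eval_row bs x0 (behead r) p = 0}.
have P_addmul c u v : P u -> P v -> P (addmul c u v).
  move=> [hu pu] [hv pv]; rewrite /P behead_addmul head_addmul dot_addmul hu hv; split=> // p pp.
  by rewrite eval_row_addmul pu // pv // mulr0 addr0.
have PQ : P (dot w q :: q) by split=> // p pp; apply: hQ; rewrite ?mem_head.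
have PQ' : {in [seq dot w q :: q | q <- Q], forall r, P r}.
  by move=> r /mapP[q' q'Q ->]; split=> // p pp; apply: hQ; rewrite // inE q'Q orbT.
have [] := @pick_pivotP P _ _ [::] PQ PQ'; first by [].
case epick: (pick_pivot _ _ _) => [piv rest] /= hpiv hrest.
have ltL t : t \in L -> Z.ltb kp.1 t.1.
  move: hL => /=; rewrite path_sortedE => [/andP[/allP h _] /h //|a b c h1 h2]; lia.
have kL : kp \notin L by apply/negP => /ltL; rewrite Z.ltb_irrefl.
have sL : sorted (fun a b : keyed => Z.ltb a.1 b.1) L by exact: path_sorted hL.
case: ifP => [h0|h0].
  have /ih /(_ sL) {}ih : {in q :: Q, forall q', {in kp.2 :: pre, forall p, eval_row bs x0 q' p = 0}}.
    move=> q' q'Q p; rewrite inE => /orP[/eqP ->|]; last exact: hQ.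
    have /andP[hq /allP hQ0] := @pick_pivot_head0 (dot w q :: q) [seq dot w q :: q | q <- Q] [::]
      (etrans (congr1 (fun x => head0 x.1) epick) h0).
    move: q'Q; rewrite /eval_row -/w inE => /orP[/eqP ->|q'Q]; first by move/Z.eqb_eq: hq => /= ->.
    by move/Z.eqb_eq: (hQ0 _ (map_f (fun q => dot w q :: q) q'Q)) => /= ->.
  move=> /ih[S [pS sS hS]]; exists S; split.
  - by apply: perm_trans pS; rewrite -cat1s catA perm_cat2r perm_catC.
  - by move=> t /sS; rewrite inE => ->; rewrite orbT.
  - move=> s /hS[h1 [h2 h3]]; split=> //; split; first by move=> p pp; apply: h2; rewrite inE pp orbT.
    by move=> t; rewrite inE => /orP[/eqP -> _ _|/h3 //]; apply: h2; rewrite mem_head.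
have [] := @euclidP P P_addmul 30 piv rest hpiv hrest.
case: (euclid _ _ _) => piv' rest' [hv1 hv2] hrest'.
case hb: (smooth (head Z0 piv') && all head0 rest'); last by [].
have [hsm /allP hz] := andP hb.
have /ih /(_ sL) {}ih : {in map behead rest', forall q', {in kp.2 :: pre, forall p, eval_row bs x0 q' p = 0}}.
  move=> q' /mapP[r rr ->] p; have [hr1 hr2] := hrest' r rr.
  rewrite inE => /orP[/eqP ->|]; last exact: hr2.
  by rewrite /eval_row -/w hr1; move/Z.eqb_eq: (hz r rr) => ->.
move=> /ih[S [pS sS hS]]; exists ((kp, behead piv') :: S); split.
- by rewrite -(cat1s kp L) perm_catCA /= perm_cons.
- by move=> t; rewrite /= !inE => /orP[->//|/sS ->]; rewrite orbT.
move=> s; rewrite inE => /orP[/eqP ->|] /=.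
  split; first by rewrite /eval_row -/w hv1; exact: smooth_neq0.
  split; first exact: hv2.
  by move=> t; rewrite inE => /orP[/eqP ->|/ltL ht /= hle]; [rewrite eqxx|case: (Z.lt_irrefl kp.1); apply: Z.lt_le_trans (proj1 (Z.ltb_lt _ _) ht) (proj1 (Z.leb_le _ _) hle)].
move=> /hS[h1 [h2 h3]]; split=> //; split; first by move=> p pp; apply: h2; rewrite inE pp orbT.
by move=> t; rewrite inE => /orP[/eqP -> _ _|/h3 //]; apply: h2; rewrite mem_head.
Qed.

Lemma remove_pointsP F m n L L' ms k : (0 < m)%N ->
  {in L, forall t, t.1 = key F t.2} ->
  remove_points (monos m) (unit_rows (size (monos m))) n L = Some L' ->
  {subset L' <= L} /\
  (good (map snd L') ms k -> good (map snd L) (nseq n m ++ ms) k).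
Proof.
move=> m0; elim: n L => [|n ih] L hL /=; first by case=> <-; split.
case: ifP => // sL; set x0 := head _ _; set rows := unit_rows _.
case es: (scan _ _ _ _ _) => [L1|] //= e.
have [|S [pS sS hS]] := @scanP (monos m) x0 [::] rows L [::] L1 _ sL es; first by [].
rewrite cat0s in pS.
have sL1 : {subset L1 <= L} by move=> t ht; rewrite (perm_mem pS) mem_cat ht orbT.
have [|s1 g1] := ih L1 _ e; first by move=> t /sL1 /hL.
split=> [t /s1 /sL1 //|gL'].
have uk : uniq (map fst L).
  apply: (@sorted_uniq _ (fun a b => Z.ltb a b)); [|by move=> x; apply: Z.ltb_irrefl|by rewrite sorted_map].
  by move=> a b c; lia.
have keyE t : t \in L -> t = (key F t.2, t.2) by move=> /hL <-; case: t.
have uD : uniq (map snd L).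
  rewrite map_inj_in_uniq; first exact: map_uniq uk.
  by move=> s t sL' tL' est; rewrite (keyE _ sL') (keyE _ tL') est.
have pD : perm_eq (map snd L) (map snd (map fst S) ++ map snd L1) by rewrite -map_cat perm_map.
pose s0 : keyed * seq Z := (Z0, (0, 0, 0)%N, [::]).
apply: (good_greedy (F := pairing_vec F) (q := fun i => eval_row (monos m) x0 (nth s0 S i).2) uD pD) (g1 gL').
move=> i; rewrite !size_map => iS.
have iS' : nth s0 S i \in S by apply: mem_nth.
have [h1 [_ h2]] := hS _ iS'.
have -> : nth (0, 0, 0)%N (map snd (map fst S)) i = (nth s0 S i).1.2.
  by rewrite -map_comp (nth_map s0).
split=> //; first exact: polyfn_eval_row.
have sin : (nth s0 S i).1 \in L by apply: sS; apply: map_f.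
move=> p /mapP[t tL ->]; rewrite -!key_pairing -!hL // int_of_Z_le => hle ne.
by apply: h2 => //; apply: contraNneq ne => ->.
Qed.

Lemma run_sound cs D D' ms k : all (fun c => 0 < c.1.2)%N cs ->
  run cs D = Some D' -> good D' ms k -> good D (expand cs ++ ms) k.
Proof.
elim: cs D => [|[[F m] n] cs ih] D /=; first by move=> _ [<-].
move=> /andP[m0 hcs]; case er: (remove_points _ _ _ _) => [L|] //= e gD'.
have [|_ h] := @remove_pointsP F m n _ L (expand cs ++ ms) k m0 _ er.
  by move=> t; rewrite mem_sort => /mapP[p _ ->].
have := h (ih _ hcs e gD'); rewrite /expand /= -catA; apply: good_perm_dom.
apply: (@perm_trans _ (map snd (map (fun p => (key F p, p)) D))).
  by apply: perm_map; rewrite perm_sort.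
by rewrite -map_comp map_id_in.
Qed.

(** The exponents that survive a certificate are killed by their own coefficient functionals; their
    number is the defect in [certifies]. *)
Lemma good_dirac D : uniq D -> good D [::] (size D).
Proof.
move=> uD; exists [::], (fun i p => (p == nth (0, 0, 0)%N D i)%:R); split=> // f _ hf p pD.
have ip : (index p D < size D)%N by rewrite index_mem.
have := hf _ ip; rewrite nth_index // (bigD1_seq p) //= eqxx mulr1 big1 ?addr0 // => q /negbTE ->.
by rewrite mulr0.
Qed.

Lemma certifies_sound cs D ms k : certifies cs D ms k -> good D ms k.
Proof.
rewrite /certifies; case e: (run _ _) => [D'|] //= /andP[/andP[/andP[/eqP <- uD] pms] hcs].
by apply: good_perm pms _; rewrite -[expand cs]cats0; apply: run_sound e (good_dirac uD).
Qed.
End Soundness.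

End Checking.

(** * Absorption of points *)

Section Absorption.
Local Open Scope ring_scope.

Section Good.
Variable K : closedFieldType.
Implicit Types (D : seq expn3) (ms : seq nat).
Local Notation good := (good K).
Local Notation wt := (wt K).

(** Vandermonde's convolution expands C(v + p, b) in the C(p, i) with i <= b. This is the direction
    opposite to [polyfn_shift]; it serves to divide by a monomial in [good_unshift]. *)
Lemma polyfn_comp_shift m (g : expn3 -> K) v : polyfn m g -> polyfn m (fun p => g (shift3 v p)).
Proof.
elim=> {m g} [m b hb|m g h _ ig _ ih|m a g _ ig|m g h e _ ig].
- pose c (t : 'I_b.1.1.+1 * 'I_b.1.2.+1 * 'I_b.2.+1) : K :=
    ('C(v.1.1, b.1.1 - t.1.1) * 'C(v.1.2, b.1.2 - t.1.2) * 'C(v.2, b.2 - t.2))%:R.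
  apply: (@polyfn_ext _ _ (fun p => \sum_t c t * wt (t.1.1 : nat, t.1.2 : nat, t.2 : nat) p)).
    move=> p; rewrite /wt /= (addnC v.1.1) (addnC v.1.2) (addnC v.2).
    rewrite -(binomial.Vandermonde p.1.1) -(binomial.Vandermonde p.1.2) -(binomial.Vandermonde p.2).
    rewrite -(pair_bigA _ (fun t1 t2 => c (t1, t2) * wt (t1.1 : nat, t1.2 : nat, t2 : nat) p)) /=.
    rewrite -(pair_bigA _ (fun i j => \sum_k c (i, j, k) * wt (i : nat, j : nat, k : nat) p)) /=.
    rewrite !natrM !natr_sum !big_distrl /=; apply: eq_bigr => i _.
    rewrite -mulrA big_distrlr /= big_distrr /=; apply: eq_bigr => j _.
    rewrite big_distrr /=; apply: eq_bigr => k _.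
    by rewrite /c /wt /= !natrM; ring.
  apply: polyfn_sum; last exact: leq_ltn_trans hb.
  move=> [[i j] k]; apply: polyfn_scale; apply: polyfn_wt; apply: leq_ltn_trans hb.
  by rewrite /deg3 /= !leq_add // -ltnS ltn_ord.
- exact: polyfn_add ig ih.
- exact: polyfn_scale ig.
- by apply: polyfn_ext ig => p; apply: e.
Qed.

Lemma good_unshift v D ms k : good (map (shift3 v) D) ms k -> good D ms k.
Proof.
move=> [P [G [hP tP inj]]].
exists P, (fun i p => G i (shift3 v p)); split=> // f vf gf p pD.
pose f' (q : expn3) := f ((q.1.1 - v.1.1)%N, (q.1.2 - v.1.2)%N, (q.2 - v.2)%N).
have f'E q : f' (shift3 v q) = f q by case: q => [[i j] a]; rewrite /f' /shift3 /= !addKn.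
rewrite -f'E; apply: inj (map_f _ pD) => [c cP b hb|i ik]; rewrite big_map.
  have h := vanish_polyfn (vf c cP) (polyfn_comp_shift v (polyfn_wt K hb)).
  apply: (eq_trans _ (etrans (congr1 ( *%R (expo c.2 v)) h) (mulr0 _))).
  by rewrite big_distrr /=; apply: eq_bigr => q _; rewrite f'E expo_shift; ring.
by apply: (eq_trans _ (gf i ik)); apply: eq_bigr => q _; rewrite f'E.
Qed.

Lemma good_empty ms r : good [::] ms r.
Proof. by elim: ms => [|m ms ih]; [exact: good_nil|exact: good_add]. Qed.

Lemma good_add_seq D ms ms' k : good D ms k -> good D (ms ++ ms') k.
Proof.
elim: ms' => [|m ms' ih] h; first by rewrite cats0.
by apply: good_perm (good_add m (ih h)); rewrite -cat1s perm_catCA.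
Qed.

(* D eats k units out of any supply of X + Y >= k + slack units, a unit being
   one 4-point or a pair of 3-points, and hands the other points over to Om. *)
Definition absorbs D (Om : seq expn3) (k slack : nat) : Prop :=
  [/\ uniq D, size D = (20 * k + size Om)%N &
   forall X Y, (k + slack <= X + Y)%N -> exists X1 Y1,
     [/\ (X1 <= X)%N, (Y1 <= Y)%N, (X1 + Y1 = k)%N &
      forall ms r, good Om ms r -> good D (nseq X1 4 ++ nseq (2 * Y1) 3 ++ ms) r]].

Lemma absorbs_slack D Om k slack slack' : (slack <= slack')%N -> absorbs D Om k slack -> absorbs D Om k slack'.
Proof. by move=> le [u s h]; split=> // X Y hXY; apply: h; lia. Qed.

Lemma absorbs_shift v D Om k slack : absorbs D Om k slack -> absorbs (map (shift3 v) D) Om k slack.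
Proof.
move=> [u s h]; split; rewrite ?size_map ?(map_inj_uniq (@shift3_inj v)) //.
by move=> X Y /h[X1 [Y1 [h1 h2 h3 g]]]; exists X1, Y1; split=> // ms r /g; apply: good_shift.
Qed.

Lemma absorbs_refl Om : uniq Om -> absorbs Om Om 0 0.
Proof. by move=> u; split=> // X Y _; exists 0%N, 0%N; split=> // ms r. Qed.

(** Among 2 k units at least k are of the same kind, so with slack k two pure certificates replace
    all mixtures. *)
Lemma absorbs_pure D k : uniq D -> size D = (20 * k)%N ->
  good D (nseq k 4) 0 -> good D (nseq (2 * k) 3) 0 -> absorbs D [::] k k.
Proof.
move=> u s g4 g3; split; rewrite ?addn0 // => X Y h.
have [le|lt] := leqP k X.
  by exists k, 0%N; split=> // [|ms r _]; rewrite ?addn0 // catA; apply/good_add_seq/(good_le (leq0n r)); rewrite cats0.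
exists 0%N, k; split=> // [|ms r _]; first by lia.
by rewrite [nseq 0 4]/= cat0s; apply/good_add_seq/(good_le (leq0n r)).
Qed.

(** D2 is served before D1: it may count the k1 units still reserved for D1 as part of its slack,
    whereas D1 has to manage with [slack] alone. Hence the more tolerant part should be D1. *)
Lemma absorbs_cut D D1 D2 Om F (c : int) k1 k2 slack1 slack2 slack :
  uniq D ->
  (forall p, (p \in D1) = (p \in D) && (pairing F p < c)) ->
  (forall p, (p \in D2) = (p \in D) && (c <= pairing F p)) ->
  absorbs D1 [::] k1 slack1 -> absorbs D2 Om k2 slack2 ->
  (slack1 <= slack)%N -> (slack2 <= slack + k1)%N ->
  absorbs D Om (k1 + k2) slack.
Proof.
move=> uD e1 e2 [u1 s1 h1] [u2 s2 h2] hs1 hs2.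
have p1 : perm_eq D1 [seq p <- D | pairing F p < c].
  by apply: uniq_perm; rewrite ?filter_uniq // => p; rewrite e1 mem_filter andbC.
have p2 : perm_eq D2 [seq p <- D | c <= pairing F p].
  by apply: uniq_perm; rewrite ?filter_uniq // => p; rewrite e2 mem_filter andbC.
split=> // [|X Y hXY].
  have -> : size D = (size D1 + size D2)%N.
    rewrite (perm_size p1) (perm_size p2) !size_filter -(count_predC (fun p => pairing F p < c)).
    by congr (_ + _)%N; apply: eq_count => p /=; rewrite leNgt.
  by rewrite s1 s2 /= addn0 mulnDr addnA.
have [|X2 [Y2 [a2 b2 c2 g2]]] := h2 X Y; first by lia.
have [|X1 [Y1 [a1 b1 c1 g1]]] := h1 (X - X2)%N (Y - Y2)%N; first by lia.
exists (X1 + X2)%N, (Y1 + Y2)%N; split; try lia.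
move=> ms r gO.
have := good_cut uD (good_perm_dom p1 (g1 [::] 0%N (good_empty _ _))) (good_perm_dom p2 (g2 ms r gO)).
rewrite cats0; apply: good_perm.
by apply/permP => p; rewrite !count_cat !count_nseq; case: (p 4); case: (p 3); lia.
Qed.

End Good.

End Absorption.

(** * Certificate formats and the distribution of the last points *)

Definition cert := seq (Z * Z * Z * nat * nat).

Definition tile_ok (D : seq expn3) (c : cert * cert) : bool :=
  let k := (size D %/ 20)%N in
  [&& size D == 20 * k, certifies c.1 D (nseq k 4) 0 & certifies c.2 D (nseq (2 * k) 3) 0]%N.

Definition units (M k : nat) : seq nat := if M == 4 then nseq k 4 else nseq (2 * k) 3.

(* For b extra 3-points: (P, T, U) where P uses up the whole units and the b 3-points that fit in Om,
   T continues with single 2-points and U with one more unit. *)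
Definition corner_ok (Om : seq expn3) (M b : nat) (c : cert * cert * cert) : bool :=
  let: (P, T, U) := c in
  let k := ((size Om - 10 * b) %/ 20)%N in
  let r := ((size Om - 10 * b) %% 20)%N in
  let q := minn 4 (r %/ 4) in
  let ms := (units M k ++ nseq b 3)%SEQ in
  [&& certifies (P ++ take q T) Om (ms ++ nseq q 2) (r - 4 * q),
      [|| r <= 4 * q, q == 4 | certifies (P ++ take q.+1 T) Om (ms ++ nseq q.+1 2) 0] &
      certifies (P ++ U) Om (units M k.+1 ++ nseq b 3) 0]%N.

Section Assembly.
Variable K : closedFieldType.
Local Notation good := (good K).
Local Notation absorbs := (absorbs K).

(** [Om] has to settle whatever does not come in units: an odd 3-point ([b]) and up to four 2-points
    ([c]). The first clause requires the expected dimension, with truncated subtraction; the second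
    requires that a surplus unit leaves nothing. [M] is the kind of the whole units used here, to be
    chosen as the one in good supply. *)
Definition completes (Om : seq expn3) (M : nat) : Prop := forall b, (b <= 1)%N ->
  let k := ((size Om - 10 * b) %/ 20)%N in
  let r := ((size Om - 10 * b) %% 20)%N in
  (forall c, (c <= 4)%N -> good Om (units M k ++ nseq b 3 ++ nseq c 2) (r - 4 * c)) /\
  good Om (units M k.+1 ++ nseq b 3) 0.

Lemma good_drop_seq D m n ms k : good D (nseq n m ++ ms) k -> good D ms (k + n * size (monos m)).
Proof.
elim: n k => [|n ih] k; first by rewrite addn0.
by move=> /= /good_drop /ih; rewrite mulSn addnA.
Qed.

(** The [kb] units of kind [M] that the corner needs are set aside before D draws on the supply. In
    [good_surplus] one more is set aside. *)
Lemma good_exact D Om k M b c X Y : absorbs D Om k 0 ->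
  M \in [:: 3; 4] ->
  completes Om M -> (b <= 1)%N -> (c <= 4)%N -> let kb := ((size Om - 10 * b) %/ 20)%N in
  (kb <= if M == 4 then X else Y)%N -> (X + Y = k + kb)%N ->
  good D (nseq X 4 ++ nseq (2 * Y + b) 3 ++ nseq c 2) ((size Om - 10 * b) %% 20 - 4 * c).
Proof.
move=> [_ _ hD] hM hO hb hc kb hk hXY; have [/(_ c hc) g _] := hO b hb.
pose X' := (if M == 4 then X - kb else X)%N; pose Y' := (if M == 4 then Y else Y - kb)%N.
have [|X1 [Y1 [hX1 hY1 hs hg]]] := hD X' Y'.
  by move: hk; rewrite /X' /Y'; case: eqP => _; lia.
apply: good_perm (hg _ _ g); apply/permP => p; rewrite !count_cat !count_nseq.
move: hk hX1 hY1; rewrite /units /X' /Y' -/kb; case: eqP => _; rewrite !count_nseq.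
  by case: (p 4); case: (p 3); case: (p 2); lia.
by case: (p 4); case: (p 3); case: (p 2); lia.
Qed.

Lemma good_surplus D Om k M b c X Y : absorbs D Om k 0 ->
  M \in [:: 3; 4] ->
  completes Om M -> (b <= 1)%N -> let kb := ((size Om - 10 * b) %/ 20)%N in
  (kb < if M == 4 then X else Y)%N -> (k + kb < X + Y)%N ->
  good D (nseq X 4 ++ nseq (2 * Y + b) 3 ++ nseq c 2) 0.
Proof.
move=> [_ _ hD] hM hO hb kb hk hXY; have [_ g] := hO b hb.
pose X' := (if M == 4 then X - kb.+1 else X)%N; pose Y' := (if M == 4 then Y else Y - kb.+1)%N.
have [|X1 [Y1 [hX1 hY1 hs hg]]] := hD X' Y'.
  by move: hk; rewrite /X' /Y'; case: eqP => _; lia.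
apply: good_perm (good_add_seq (nseq (X' - X1) 4 ++ nseq (2 * (Y' - Y1)) 3 ++ nseq c 2) (hg _ _ g)).
apply/permP => p; rewrite !count_cat !count_nseq.
move: hk hX1 hY1; rewrite /units /X' /Y' -/kb; case: eqP => _; rewrite !count_nseq.
  by case: (p 4); case: (p 3); case: (p 2); lia.
by case: (p 4); case: (p 3); case: (p 2); lia.
Qed.

Hypothesis five_double : good (monos 4) (nseq 5 2) 0.

(** A 4-point and five 2-points both have length 20, so the exchange preserves the expected
    dimension. *)
Lemma good_merge D ms k : uniq D -> good D (4 :: ms)%N k -> good D (nseq 5 2 ++ ms)%N k.
Proof. by move=> uD; apply: good_collision. Qed.

(** By [size Om < 20 * k] the corner takes kb <= k units, so that among k + kb units one of the two
    kinds occurs at least kb times. By [10 <= size Om] the corner has room for an odd 3-point. *)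
Lemma good_all D Om k : absorbs D Om k 0 -> completes Om 4 -> completes Om 3 ->
  (10 <= size Om)%N -> (size Om < 20 * k)%N ->
  forall x y z, good D (nseq x 4 ++ nseq y 3 ++ nseq z 2) (size D - (20 * x + 10 * y + 4 * z)).
Proof.
move=> hD h4 h3 n10 nk; have [uD sD _] := hD.
have exact_fit X Y b c : (b <= 1)%N -> (c <= 4)%N -> let kb := ((size Om - 10 * b) %/ 20)%N in
    (X + Y = k + kb)%N ->
    good D (nseq X 4 ++ nseq (2 * Y + b) 3 ++ nseq c 2) ((size Om - 10 * b) %% 20 - 4 * c).
  move=> hb hc kb hXY; have hk : (kb <= k)%N by rewrite /kb; lia.
  have [le|lt] := leqP kb X; first by apply: (good_exact (M := 4) hD).
  by apply: (good_exact (M := 3) hD) => //=; lia.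
have small X Y b c : (b <= 1)%N -> (c <= 4)%N ->
    good D (nseq X 4 ++ nseq (2 * Y + b) 3 ++ nseq c 2) (size D - (20 * (X + Y) + 10 * b + 4 * c)).
  move=> hb hc; set kb := ((size Om - 10 * b) %/ 20)%N; set r := ((size Om - 10 * b) %% 20)%N.
  have e : (size Om = 20 * kb + r + 10 * b)%N by have := divn_eq (size Om - 10 * b) 20; rewrite -/kb -/r; lia.
  have hk : (kb <= k)%N by lia.
  have [lt|gt|eq] := ltngtP (X + Y)%N (k + kb)%N.
  (* Too few units: t + 1 further 4-points give an exact fit, one of them is replaced by five
     2-points, and then t 4-points and 5 - c 2-points are dropped. Each dropped point raises the
     bound by its length, which gives the expected dimension. *)
  - pose t := (k + kb - (X + Y)).-1.
    have := exact_fit (X + t.+1)%N Y b 0 hb isT; rewrite -/kb -/r cats0 => /(_ ltac:(lia)) g.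
    have := good_merge (ms := nseq (X + t) 4 ++ nseq (2 * Y + b) 3) uD (k := r - 4 * 0).
    move=> /(_ ltac:(by rewrite -[4 :: _]/(nseq (X + t).+1 4 ++ _) -addnS)) {}g.
    apply: (@good_le _ _ _ (r - 4 * 0 + (5 - c) * size (monos 2) + t * size (monos 4))).
      by rewrite -[size (monos 2)]/4 -[size (monos 4)]/20; lia.
    apply: good_drop_seq; apply: good_drop_seq; apply: good_perm g; apply/permP => p.
    by rewrite !count_cat !count_nseq; case: (p 4); case: (p 3); case: (p 2); lia.
  - apply: good_le (leq0n _) _; have [lt|ge] := ltnP kb X; first by apply: (good_surplus (M := 4) _ hD).
    by apply: (good_surplus (M := 3) _ hD) => //=; lia.
  - by apply: good_le (exact_fit X Y b c hb hc eq); rewrite -/r; lia.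
move=> x y z.
(* Each group of five 2-points is traded for one more 4-point, until at most four 2-points
   remain. *)
have merge q c : (c <= 4)%N -> forall x,
    good D (nseq x 4 ++ nseq y 3 ++ nseq (5 * q + c) 2) (size D - (20 * x + 10 * y + 4 * (5 * q + c))).
  move=> hc; elim: q => [|q ih] x'.
    have := small x' (y %/ 2)%N (y %% 2)%N c (ltac:(by rewrite -ltnS ltn_mod)) hc.
    have -> : (2 * (y %/ 2) + y %% 2 = y)%N by rewrite mulnC -divn_eq.
    by apply: good_le; have := divn_eq y 2; lia.
  have g := good_merge uD (ih x'.+1).
  apply: good_perm (good_le _ g); last by lia.
  by apply/permP => p; rewrite !count_cat !count_nseq; case: (p 4); case: (p 3); case: (p 2); lia.
by have := merge (z %/ 5)%N (z %% 5)%N (ltac:(by rewrite -ltnS ltn_mod)) x; rewrite (mulnC 5) -divn_eq.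
Qed.
End Assembly.

Section Checks.
Variable K : closedFieldType.
Hypotheses (char2 : (2%:R != 0 :> K)%R) (char3 : (3%:R != 0 :> K)%R).
Local Notation good := (good K).

Lemma tile_okP D c : uniq D -> tile_ok D c -> absorbs K D [::] (size D %/ 20) (size D %/ 20).
Proof.
move=> u /and3P[/eqP s c4 c3]; apply: absorbs_pure => //; [exact: (certifies_sound char2 char3 c4)|exact: (certifies_sound char2 char3 c3)].
Qed.

Lemma corner_okP Om M c0 c1 : corner_ok Om M 0 c0 -> corner_ok Om M 1 c1 -> completes K Om M.
Proof.
have h b c : corner_ok Om M b c -> let k := ((size Om - 10 * b) %/ 20)%N in
  let r := ((size Om - 10 * b) %% 20)%N in
  (forall c, (c <= 4)%N -> good Om (units M k ++ nseq b 3 ++ nseq c 2) (r - 4 * c)) /\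
  good Om (units M k.+1 ++ nseq b 3) 0.
  case: c => [[P T] U] /and3P[hA hB hS] k r; split; last by exact: (certifies_sound char2 char3 hS).
  move: hA hB; rewrite -/k -/r; set q := minn 4 _; set ms := units M k ++ _ => hA hB.
  have hq : (q <= 4)%N by rewrite geq_minl.
  have hr : (4 * q <= r)%N.
    by have := geq_minr 4 (r %/ 4); rewrite -/q => h; have := leq_divM r 4; lia.
  (* With at most q 2-points, the others are dropped from the first certificate, where all their
     conditions count. With more than q, necessarily q = r %/ 4 and fewer than four exponents are
     left over; one more 2-point exhausts them and any further ones are idle. *)
  move=> c hc; rewrite catA -/ms; have [cq|qc] := leqP c q.
    have gA := certifies_sound char2 char3 hA.
    apply: (@good_le _ _ _ (r - 4 * q + (q - c) * size (monos 2))).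
      by rewrite -[size _]/4; lia.
    apply: good_drop_seq; apply: good_perm gA; apply/permP => p.
    by rewrite !count_cat !count_nseq; case: (p 2%N); lia.
  have q4 : (q == 4) = false by apply/negbTE; lia.
  have rq : (r - 4 * c = 0)%N.
    have : (r < 4 * q.+1)%N.
      have : (q = r %/ 4)%N by move: q4; rewrite /q /minn; case: ifP => // _ /eqP.
      by move=> ->; rewrite mulnC ltn_ceil.
    by lia.
  rewrite rq; move: hB; rewrite q4 /= => /orP[le|hB].
    have gA := certifies_sound char2 char3 hA.
    have -> : (c = q + (c - q))%N by lia.
    rewrite nseqD catA; apply: good_add_seq; apply: good_le gA; lia.
  have -> : (c = q.+1 + (c - q.+1))%N by lia.
  by rewrite nseqD catA; apply: good_add_seq; apply: (certifies_sound char2 char3 hB).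
move=> h0 h1 [|[|b]] // _; [exact: h h0|exact: h h1].
Qed.

End Checks.

(** * Tilings *)

Definition region (n : nat) (P : pred expn3) : seq expn3 := [seq p <- box3 n | P p].

Lemma region_uniq n P : uniq (region n P).
Proof. by rewrite filter_uniq ?box3_uniq. Qed.

Lemma mem_region n P p : (p \in region n P) = P p && [&& p.1.1 < n, p.1.2 < n & p.2 < n].
Proof. by rewrite mem_filter mem_box3. Qed.

(* Otherwise the conversion test would enumerate regions. *)
Opaque region.

(** Membership in a translated region is spelled out by inequalities, so that tiling identities
    become linear arithmetic. *)
Definition in_shifted (v : expn3) (n : nat) (P : pred expn3) (p : expn3) : bool :=
  let q := (p.1.1 - v.1.1, p.1.2 - v.1.2, p.2 - v.2) in
  [&& v.1.1 <= p.1.1, v.1.2 <= p.1.2, v.2 <= p.2, P q, q.1.1 < n, q.1.2 < n & q.2 < n].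

Lemma mem_shifted v n P p : (p \in map (shift3 v) (region n P)) = in_shifted v n P p.
Proof. by rewrite mem_shift3 mem_region. Qed.

Lemma perm_shifted v n P n1 P1 (Q : pred expn3) :
  (forall p, in_shifted v n1 P1 p = [&& P p, p.1.1 < n, p.1.2 < n, p.2 < n & Q p]) ->
  perm_eq (map (shift3 v) (region n1 P1)) [seq p <- region n P | Q p].
Proof.
move=> e; apply: uniq_perm; rewrite ?(map_inj_uniq (@shift3_inj v)) ?filter_uniq ?box3_uniq // => p.
by rewrite mem_shifted e mem_filter mem_region [RHS]andbC -!andbA.
Qed.

(* The simplex i + j + a <= N, i >= 1, with a few cells near its vertex j = N added in the
   layer i = 0 or removed from the layer i = 1, so that slabs of ten layers have 20 k cells. *)
Definition in_layered (N e h : nat) (p : expn3) : bool :=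
  (p.1.1 + p.1.2 + p.2 <= N) &&
  [|| 2 <= p.1.1, (p.1.1 == 1) && (h <= 6 * (N - p.1.1 - p.1.2) + p.2) |
      (p.1.1 == 0) && (6 * (N - p.1.1 - p.1.2) + p.2 < e)].

(** The layers 1 to 10 of the simplex contain 5 N^2 - 40 N + 120 cells, which is 0 modulo 20 for N
    even and 5 for N odd. With s = N - i - j and a <= s, the values 6 s + a below 14 are 0, 6, 7,
    12, 13, and there are ten of them below 24. So the thresholds 14 and 24 stand for 5 and 10
    cells, and the corrections of the four states are 0, 5, 10, -5. For odd N, passing from each
    state to the next makes the slab divisible by 20; for even N the state stays 0. The value 6 s +
    a is linear in the exponents, which allows a functional to cut along the correction. *)
Definition added (b : nat) : nat := nth 0 [:: 0; 14; 24; 0] b.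
Definition removed (b : nat) : nat := nth 0 [:: 0; 0; 0; 14] b.
Definition next (N b : nat) : nat := if odd N then b.+1 %% 4 else b.

Definition layered (N b : nat) : seq expn3 := region N.+1 (in_layered N (added b) (removed b)).

Definition in_slab (N e h e' h' : nat) (p : expn3) : bool :=
  in_layered N e h p && ~~ ((10 <= p.1.1) && in_layered (N - 10) e' h' (p.1.1 - 10, p.1.2, p.2)).

Definition slab (N b : nat) : seq expn3 :=
  region N.+1 (in_slab N (added b) (removed b) (added (next N b)) (removed (next N b))).

(** The column over (i, j) has height l - i - j, so for l >= 12 a block has 40 l - 4 * 45 - 10 * 6 =
    20 (2 l - 12) cells. *)
Definition block (l : nat) : seq expn3 :=
  region l (fun p => [&& p.1.1 < 10, p.1.2 < 4 & p.1.1 + p.1.2 + p.2 < l]).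

Definition brick : seq expn3 := region 6 (fun p => [&& p.1.1 < 5, p.1.2 < 4 & p.2 < 6]).

Definition slice : seq expn3 := region 18 (fun p => [&& p.1.1 < 10, p.1.2 < 4 & p.2 < 6]).

Definition admissible (N b : nat) : bool := (b < 4) && (odd N || (b == 0)).

Lemma cells_small N b : admissible N b ->
  [/\ added b <= 24, removed b <= 14, added (next N b) <= 24 & removed (next N b) <= 14] /\
  (odd N \/ [/\ added b = 0, removed b = 0, added (next N b) = 0 & removed (next N b) = 0]).
Proof.
rewrite /admissible /next; case: (odd N); last by case/andP=> _ /eqP ->; split=> //; right.
by rewrite andbT; case: b => [|[|[|[|b]]]] // _; split=> //; left.
Qed.

Ltac unand := repeat match goal with H : is_true (_ && _) |- _ => case/andP: H => ? ? end.
Ltac mem_lia := apply/idP/idP => ?; unand; repeat (apply/andP; split); lia.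

(* The cases are i = 0, i = 1, 2 <= i < 10, i = 10, i = 11 and 12 <= i. *)
Ltac split_layers i :=
  move: i => [|[|i]]; last (have [?|[[|[|?]] ->]] : i < 8 \/ exists k, i = k.+4.+4;
    [by have [?|?] := ltnP i 8; [left|right; exists (i - 8); lia]
    |rewrite [10 <= _](_ : _ = false); last by [lia]|..]).

Section Geometry.
Variable K : closedFieldType.
Local Notation absorbs := (absorbs K).

Lemma absorbs_cut_region n P n1 P1 v1 n2 P2 v2 Om F (c : int) k1 k2 slack1 slack2 slack :
  (forall p, in_shifted v1 n1 P1 p = [&& P p, p.1.1 < n, p.1.2 < n, p.2 < n & (pairing F p < c)%R]) ->
  (forall p, in_shifted v2 n2 P2 p = [&& P p, p.1.1 < n, p.1.2 < n, p.2 < n & (c <= pairing F p)%R]) ->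
  absorbs (region n1 P1) [::] k1 slack1 -> absorbs (region n2 P2) Om k2 slack2 ->
  slack1 <= slack -> slack2 <= slack + k1 -> absorbs (region n P) Om (k1 + k2) slack.
Proof.
move=> e1 e2 h1 h2; apply: (absorbs_cut (F := F) (c := c) (region_uniq n P) _ _
  (absorbs_shift v1 h1) (absorbs_shift v2 h2)) => p.
  by rewrite mem_shifted mem_region e1 -!andbA.
by rewrite mem_shifted mem_region e2 -!andbA.
Qed.

Definition brick_units (a : nat) : seq nat := nseq a 4 ++ nseq (2 * (6 - a)) 3.

(* Five 4-points and two 3-points are special on a brick (the rank drops by two), hence the
   separate hypothesis for two bricks with eleven 4-points. *)
Lemma slice_absorbs :
  {in [:: 0; 1; 2; 3; 4; 6], forall a, good K brick (brick_units a) 0} ->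
  good K slice (nseq 11 4 ++ nseq 2 3) 0 -> size slice = 240 ->
  absorbs slice [::] 12 0.
Proof.
move=> hbrick h11 hs; split; [exact: region_uniq|exact: hs|] => X Y hXY.
have pair a1 a2 : a1 \in [:: 0; 1; 2; 3; 4; 6] -> a2 \in [:: 0; 1; 2; 3; 4; 6] ->
    good K slice (nseq (a1 + a2) 4 ++ nseq (2 * (12 - (a1 + a2))) 3) 0.
  move=> ha1 ha2.
  have c1 : a1 <= 6 by move: ha1; rewrite !inE; lia.
  have c2 : a2 <= 6 by move: ha2; rewrite !inE; lia.
  have e1 : perm_eq (map (shift3 (0, 0, 0)) brick) [seq p <- slice | (pairing (1, 0, 0) p < 5)%R].
    by apply: perm_shifted => -[[i j] a]; rewrite /in_shifted /pairing /=; mem_lia.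
  have e2 : perm_eq (map (shift3 (5, 0, 0)) brick) [seq p <- slice | (5 <= pairing (1, 0, 0) p)%R].
    by apply: perm_shifted => -[[i j] a]; rewrite /in_shifted /pairing /=; mem_lia.
  have us : uniq slice := region_uniq _ _.
  apply: good_perm (good_cut us (good_perm_dom e1 (good_shift _ (hbrick _ ha1)))
    (good_perm_dom e2 (good_shift _ (hbrick _ ha2)))).
  by apply/permP => p; rewrite !count_cat !count_nseq; case: (p 4); case: (p 3); lia.
have all_units a : a <= 12 -> good K slice (nseq a 4 ++ nseq (2 * (12 - a)) 3) 0.
  (* The 4-points are shared between the two bricks as a + 0, 4 + 1 or 6 + (a - 6), so that no brick
     gets five. Only 11 = 6 + 5 admits no such sharing. *)
  move=> ha; have [->//|n11] := eqVneq a 11.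
  have [a6|a6] := leqP a 4; first by have := pair a 0; rewrite addn0; apply; rewrite ?inE //; lia.
  have [->|n5] := eqVneq a 5; first exact: (pair 4 1).
  have e : 6 + (a - 6) = a by lia.
  by have := pair 6 (a - 6); rewrite e; apply; rewrite !inE; lia.
exists (minn X 12), (12 - minn X 12); split; [lia..|] => ms r _.
by rewrite catA; apply/good_add_seq/(good_le (leq0n r))/all_units/geq_minr.
Qed.

(** A slice takes any 12 units and is served last, so each slice peeled off lowers the slack by 12.
    Certified blocks, with l <= 18, have slack at most 2 * 18 - 12 = 24; two slices bring it to 0,
    from l = 25 on. *)
Lemma block_absorbs :
  absorbs slice [::] 12 0 -> (forall l, 13 <= l <= 18 -> absorbs (block l) [::] (2 * l - 12) 24) ->
  forall l, 13 <= l -> absorbs (block l) [::] (2 * l - 12) (24 - 12 * ((l - 13) %/ 6)).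
Proof.
move=> hslice hcap.
elim/ltn_ind => l ih hl; have [le|gt] := leqP l 18.
  have -> : (l - 13) %/ 6 = 0 by apply: divn_small; lia.
  by apply: hcap; rewrite hl.
have -> : 2 * l - 12 = 12 + (2 * (l - 6) - 12) by lia.
have hl6 : 13 <= l - 6 by lia.
have hlt : l - 6 < l by lia.
apply: (absorbs_cut_region (F := (0, 0, 1)%R) (c := 6%R) (v1 := (0, 0, 0)) (v2 := (0, 0, 6)) _ _ hslice (ih _ hlt hl6)).
- by move=> [[i j] a]; rewrite /in_shifted /pairing /=; mem_lia.
- by move=> [[i j] a]; rewrite /in_shifted /pairing /=; mem_lia.
- exact: leq0n.
- lia.
Qed.

(** Peeling off the columns j < 4 leaves the slab for N - 4 in the same state, since the corrections
    depend on j only through N - j and the state changes only with the parity. The certified slabs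
    have at most 660 cells, whence the slack 33. From N = 25 on, a block has slack 0 and at least 38
    units, which cover the 33. *)
Lemma slab_absorbs :
  (forall l, 13 <= l -> absorbs (block l) [::] (2 * l - 12) (24 - 12 * ((l - 13) %/ 6))) ->
  (forall N b, 12 <= N <= 15 -> admissible N b -> exists k, absorbs (slab N b) [::] k 33) ->
  forall N b, 12 <= N -> admissible N b -> exists k,
    (25 <= N -> 2 * N - 12 <= k) /\ absorbs (slab N b) [::] k (if N < 25 then 33 else 0).
Proof.
move=> hblock hend; elim/ltn_ind => N ih b hN hb; have [le|gt] := leqP N 15.
  have [|k hk] := hend N b _ hb; first by lia.
  by exists k; split; [lia|rewrite ifT //; lia].
have oddN : odd (N - 4) = odd N by rewrite oddB ?addbF //; lia.
have [|||k [_ hk]] := ih (N - 4) _ b; [lia|lia|by move: hb; rewrite /admissible oddN|].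
have nextN : next (N - 4) b = next N b by rewrite /next oddN.
exists (2 * N - 12 + k); split; first by lia.
have hN13 : 13 <= N by lia.
apply: (absorbs_cut_region (F := (0, 1, 0)%R) (c := 4%R) (v1 := (1, 0, 0)) (v2 := (0, 4, 0)) _ _ (hblock _ hN13) hk).
- move=> [[i j] a].
  rewrite /in_shifted /pairing /in_slab /in_layered /=.
  have [[hA hR hA' hR'] hz] := cells_small hb.
  (* An odd N above 15 is at least 17. Then the corrected cells, at worst those of layer 10 with N -
     10 - j < 4, lie in columns j >= 4 and so outside the block. *)
  have {}hz : 17 <= N \/ [/\ added b = 0, removed b = 0, added (next N b) = 0 & removed (next N b) = 0].
    by case: hz => hz; [left; lia|right].
  case: hz => [hz|[-> -> -> ->]];
    split_layers i; rewrite /= ?orbF ?andbT ?subn0; mem_lia.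
- move=> [[i j] a].
  rewrite /in_shifted /pairing /in_slab /in_layered nextN /=.
  have [[hA hR hA' hR'] hz] := cells_small hb.
  have {}hz : 17 <= N \/ [/\ added b = 0, removed b = 0, added (next N b) = 0 & removed (next N b) = 0].
    by case: hz => hz; [left; lia|right].
  case: hz => [hz|[-> -> -> ->]];
    split_layers i; rewrite /= ?orbF ?andbT ?subn0; mem_lia.
- by case: (ltnP N 25) => h; lia.
- by case: (ltnP N 25) => h1; case: (ltnP (N - 4) 25) => h2; lia.
Qed.
End Geometry.

(** * Certificates *)

(* For layered N b: the corner key >= c, a certificate for its complement, and those of corner_ok
   for (M, b) = (4, 0), (4, 1), (3, 0), (3, 1). *)
Record base_cert := BaseCert {
  base_N : nat; base_b : nat; base_F1 : Z; base_F2 : Z; base_F3 : Z; base_c : Z;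
  base_rest : cert * cert;
  corner40 : cert * cert * cert; corner41 : cert * cert * cert;
  corner30 : cert * cert * cert; corner31 : cert * cert * cert }.

(** At most 1299 cells outside the corner means slack at most 64; a corner below 100 is smaller than
    the 20 * 64 exponents that a large simplex has outside it. *)
Definition base_ok (c : base_cert) : bool :=
  let D := layered (base_N c) (base_b c) in
  let inside p := Z.leb (base_c c) (key (base_F1 c, base_F2 c, base_F3 c) p) in
  let Om := [seq p <- D | inside p] in
  let R := [seq p <- D | ~~ inside p] in
  [&& 10 <= size Om, size Om < 100, size R <= 1299, tile_ok R (base_rest c),
      corner_ok Om 4 0 (corner40 c), corner_ok Om 4 1 (corner41 c),
      corner_ok Om 3 0 (corner30 c) & corner_ok Om 3 1 (corner31 c)].

(* All certificates were found by a randomised search over the functionals F. *)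
Definition tetrahedron_cert : cert :=
  [:: step (-984) (-1979) (-1996) 2 1; step 1961 1031 (-2000) 2 1; step 2040 989 1977 2 1;
    step (-2007) (-38) (-1017) 2 1; step 988 (-25) 16 2 1].

Definition brick_certs : seq (nat * cert) := [::
  (0, [:: step (-965) 1960 964 3 1; step (-5) 1981 2016 3 1; step (-29) 1031 25 3 1;
    step (-978) 1039 17 3 1; step (-2024) 984 (-1008) 3 1; step (-1002) (-2009) (-18) 3 1;
    step 2035 (-1019) 1993 3 1; step (-30) 1018 6 3 1; step 2037 (-967) 38 3 1;
    step (-1984) (-1998) (-1021) 3 1; step 1035 19 1984 3 1; step 2002 (-36) (-1007) 3 1]);
  (1, [:: step (-968) 1973 (-995) 4 1; step (-998) 962 (-977) 3 1; step (-1966) 2015 965 3 1;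
    step (-11) 1993 (-1973) 3 1; step 1983 (-994) 2 3 1; step (-1995) 31 979 3 1;
    step (-2011) 2001 (-1010) 3 1; step 5 (-1038) 4 3 1; step 1 (-1983) 995 3 1;
    step (-1982) 1008 1989 3 1; step (-2027) 973 (-1000) 3 1]);
  (2, [:: step 1995 1 (-1006) 4 1; step (-2037) 996 30 4 1; step (-1988) (-1017) (-980) 3 1;
    step (-38) (-25) 2025 3 1; step (-2006) (-978) 2021 3 1; step 1023 1015 29 3 1;
    step (-1982) (-980) (-965) 3 1; step (-2036) 968 999 3 1; step (-16) 24 986 3 1;
    step 1040 (-1028) (-1022) 3 1]);
  (3, [:: step 16 7 1968 4 1; step (-15) 1019 964 4 1; step (-2003) (-1991) 2034 4 1;
    step (-28) (-2005) 16 3 1; step 1978 2010 2018 3 1; step 28 (-12) (-1025) 3 1;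
    step 2040 1001 (-1005) 3 1; step 1967 2011 1991 3 1; step 2013 (-967) 993 3 1]);
  (4, [:: step (-1962) (-33) (-1030) 4 1; step (-2027) (-2028) 997 4 1; step 1972 1989 (-1034) 4 1;
    step 1015 2020 1034 4 1; step 2031 (-1965) 1013 3 1; step (-1991) 1986 (-986) 3 1;
    step (-989) (-1995) 29 3 1; step (-2007) (-966) (-995) 3 1]);
  (6, [:: step 978 1993 1969 4 1; step 987 (-6) 1036 4 1; step (-1994) (-1032) 2035 4 1;
    step 996 (-19) (-1998) 4 1; step 1980 (-1976) (-2012) 4 1; step 1036 1967 1007 4 1])].

Definition slice_cert : cert :=
  [:: step (-2005) (-7) 1016 4 7; step 2023 (-978) (-1997) 3 1; step 988 1027 (-1022) 4 1;
    step 1000 1022 (-2025) 3 1; step 979 (-1966) (-22) 4 1; step 2005 1996 16 4 1;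
    step 1008 (-12) (-1) 4 1].

Definition block_certs : seq (cert * cert) := [::
  ([:: step (-1071) 792 1576 4 10; step 1033 2017 1992 4 1; step (-989) (-1985) (-24) 4 1;
    step (-2013) (-1011) 1013 4 1; step 2022 (-993) 1013 4 1],
   [:: step 1380 606 (-1755) 3 24; step (-963) 2024 1029 3 1; step 1026 2022 974 3 1;
     step 1962 984 (-11) 3 1; step (-1016) 1969 (-1031) 3 1]);
  ([:: step 477 839 (-1126) 4 12; step 2037 (-2033) (-990) 4 1; step (-968) (-1973) 1986 4 1;
    step (-35) 2035 1989 4 1; step (-1021) (-1) 14 4 1],
   [:: step 1405 635 (-1780) 3 28; step (-2002) 34 1981 3 1; step 1035 1987 (-31) 3 1;
     step 2006 1966 971 3 1; step (-2024) 1989 1039 3 1]);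
  ([:: step 1174 (-730) (-1630) 4 14; step 1967 996 1034 4 1; step (-2001) (-2039) (-1990) 4 1;
    step (-1024) 1983 1000 4 1; step (-2013) (-2025) 38 4 1],
   [:: step 1130 514 (-1442) 3 32; step (-962) 1007 1004 3 1; step 1970 (-972) (-989) 3 1;
     step 978 (-997) 1969 3 1; step (-978) 1978 (-1008) 3 1]);
  ([:: step 1315 (-886) (-1872) 4 16; step (-22) (-962) 1993 4 1; step 31 2021 8 4 1; step 3 2011 1965 4 1;
    step 961 1978 (-994) 4 1],
   [:: step 1478 1986 (-1133) 3 36; step (-1991) (-961) 999 3 1; step (-32) (-966) 35 3 1;
     step (-2030) (-1999) (-980) 3 1; step (-21) 1010 (-1975) 3 1]);
  ([:: step (-706) 496 1721 4 18; step (-5) 2022 (-1982) 4 1; step 1982 970 (-1995) 4 1;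
    step 2003 (-2000) (-963) 4 1; step 1008 (-2014) (-1027) 4 1],
   [:: step 549 944 1351 3 40; step (-962) 1024 (-995) 3 1; step (-2024) 2013 979 3 1;
     step 5 (-1019) (-34) 3 1; step (-960) 962 979 3 1]);
  ([:: step (-779) 1036 1282 4 20; step 1968 1017 983 4 1; step (-27) (-974) 39 4 1;
    step (-1978) (-1999) (-1971) 4 1; step (-995) 35 1961 4 1],
   [:: step (-1070) (-520) (-1940) 3 44; step 2023 1969 4 3 1; step 1023 (-2012) (-34) 3 1;
     step (-1974) (-1975) (-38) 3 1; step 29 (-962) (-30) 3 1])].

Definition slab_certs : seq (nat * nat * (cert * cert)) := [::
  (12, 0, ([:: step 1962 (-1935) (-906) 4 14; step (-1031) 1985 1971 4 1; step (-1037) 23 (-987) 4 1;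
    step (-13) 1973 1 4 1; step 8 1009 996 4 1],
   [:: step 1134 (-464) (-1791) 3 32; step 2024 30 2027 3 1; step 1040 (-966) 1011 3 1;
     step 976 (-1999) 1035 3 1; step 21 2021 1993 3 1]));
  (14, 0, ([:: step 1757 (-1683) (-558) 4 23; step (-1978) 1033 1005 4 1; step 2027 977 22 4 1;
    step (-1998) 989 1 4 1; step (-1036) (-2018) (-996) 4 1],
   [:: step 911 409 586 3 50; step (-2032) (-2031) 1988 3 1; step 976 (-2030) (-1005) 3 1;
     step 1964 (-990) (-1961) 3 1; step 1963 (-976) (-1977) 3 1]));
  (13, 0, ([:: step 1172 (-868) (-1330) 4 18; step (-1986) 1991 2018 4 1; step 34 2027 2 4 1;
    step (-2020) 2010 2028 4 1; step (-1997) (-1039) 1983 4 1],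
   [:: step 1412 (-519) (-1636) 3 40; step (-1967) 1028 1038 3 1; step 2020 3 34 3 1; step 2004 27 998 3 1;
     step (-2008) (-1039) 1009 3 1]));
  (13, 1, ([:: step (-1103) 1400 446 4 18; step 1977 (-17) 33 4 1; step (-2006) 16 (-1988) 4 1;
    step 1970 (-2005) (-2003) 4 1; step 7 (-1982) (-31) 4 1],
   [:: step 1868 575 (-1515) 3 40; step (-1995) (-18) 1981 3 1; step (-6) (-2038) 2012 3 1;
     step 1022 37 1036 3 1; step 2023 (-2030) 22 3 1]));
  (13, 2, ([:: step 957 (-1730) (-422) 4 19; step (-1972) 8 1986 4 1; step 996 1976 1015 4 1;
    step 1028 (-981) (-1961) 4 1; step (-1993) (-19) 7 4 1],
   [:: step (-1921) 1617 587 3 42; step 1996 (-26) (-1986) 3 1; step 1024 (-2004) (-2010) 3 1;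
     step 998 1001 1981 3 1; step 2017 (-2002) 31 3 1]));
  (13, 3, ([:: step (-1942) 997 (-566) 4 18; step 1035 (-3) (-960) 4 1; step (-1988) 1013 (-997) 4 1;
    step 22 (-2) 963 4 1; step 2031 (-1028) (-1017) 4 1],
   [:: step 602 1995 (-1659) 3 40; step (-2002) (-30) 969 3 1; step (-34) 2024 (-972) 3 1;
     step 1000 1997 (-1972) 3 1; step (-4) (-2014) 1030 3 1]));
  (15, 0, ([:: step 1931 840 1241 4 28; step 1016 976 (-1984) 4 1; step (-973) (-1013) (-1961) 4 1;
    step (-2031) 984 (-1012) 4 1; step 1022 (-977) (-1001) 4 1],
   [:: step 1580 (-1357) 486 3 60; step (-21) (-2015) (-1031) 3 1; step (-1028) 35 (-2029) 3 1;
     step 1965 (-17) 1007 3 1; step 1006 969 986 3 1]));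
  (15, 1, ([:: step 1803 553 (-1527) 4 28; step (-23) (-997) 2011 4 1; step 5 (-987) 14 4 1;
    step (-1975) (-29) 1984 4 1; step 2026 2021 2014 4 1],
   [:: step 1590 634 (-1158) 3 60; step 2024 29 1000 3 1; step 967 (-1001) (-7) 3 1;
     step (-2002) (-2021) 998 3 1; step 974 9 (-2030) 3 1]));
  (15, 2, ([:: step 884 (-1657) (-499) 4 29; step 1974 962 994 4 1; step 1015 (-1033) (-2009) 4 1;
    step (-979) (-32) (-1034) 4 1; step 1025 1 (-1982) 4 1],
   [:: step 1945 (-1284) 493 3 62; step (-28) 1026 (-1973) 3 1; step 1037 (-1973) (-1984) 3 1;
     step 7 991 39 3 1; step (-1983) (-1038) 34 3 1]));
  (15, 3, ([:: step 1658 (-1465) (-452) 4 28; step 2034 1968 2024 4 1; step (-1978) 994 961 4 1;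
    step (-1980) 1971 12 4 1; step 1008 2032 (-2038) 4 1],
   [:: step 697 1950 (-1500) 3 60; step (-2009) (-978) 1028 3 1; step 1010 2028 965 3 1;
     step (-2035) (-975) 2022 3 1; step (-31) 30 (-1029) 3 1]))].

Definition base_certs : seq base_cert := [::
  BaseCert 10 0 (-99) (-26) 101 49
   ([:: step 712 (-1451) 960 4 4; step (-2021) 15 (-970) 4 1; step 1035 1971 1987 4 1;
     step (-1036) 2001 (-2015) 4 1; step (-1030) (-975) 992 4 1],
    [:: step 983 1719 1277 3 12; step (-16) (-2038) (-1978) 3 1; step (-976) (-1019) 19 3 1;
      step (-1971) 2011 1993 3 1; step 987 (-1976) 1023 3 1])
   ([:: step 4 (-39) 28 4 1; step 1002 1016 (-996) 4 1;
     step (-987) (-1998) (-1029) 4 1], [:: ], [:: step 1 1 1 4 1])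
   ([:: step 2040 1984 993 4 1; step (-975) (-2009) (-1996) 4 1;
     step 18 2010 1036 3 1], [:: step 1978 2036 1028 2 1; step 1974 999 2005 2 1;
     step (-2020) (-964) 25 2 1], [:: step 1010 2024 975 4 1])
   ([:: step 1014 (-1988) 1993 3 1; step 1031 (-1998) (-26) 3 1; step 1008 1999 (-1969) 3 1;
     step (-19) 1023 (-994) 3 1; step (-1028) 1012 1961 3 1;
     step (-1962) 1029 24 3 1], [:: ], [:: step 1 1 1 3 1; step 1 1 1 3 1])
   ([:: step 2000 20 (-1978) 3 1; step (-34) (-1034) 1025 3 1; step (-31) (-2031) (-985) 3 1;
     step (-1966) (-2022) (-981) 3 1; step 2005 (-1975) (-2029) 3 1], [:: step 12 (-1966) 1983 2 1;
     step (-1014) (-9) 1031 2 1; step (-2017) (-2003) 3 2 1], [:: step (-1033) (-37) 1971 3 1;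
     step 1 1 1 3 1]);
  BaseCert 11 0 (-47) 106 (-21) 178
   ([:: step (-1868) 1334 632 4 6; step 975 1 (-1016) 4 1; step 1028 2029 986 4 1; step 17 1978 2001 4 1;
     step 981 (-1997) 28 4 1],
    [:: step (-1944) 952 1437 3 16; step 1984 1964 (-999) 3 1; step 1969 (-35) (-2038) 3 1;
      step 1036 973 14 3 1; step 2035 1964 (-2034) 3 1])
   ([:: step 966 (-2009) 1002 4 1; step 2022 (-2037) 36 4 1; step (-1974) 2025 1015 4 1;
     step (-1025) (-974) (-2019) 4 1], [:: step 1030 1015 27 2 1;
     step (-987) 8 1991 2 1], [:: step 38 2017 (-999) 4 1])
   ([:: step (-1021) 2021 1967 4 1; step 2038 (-1031) (-1) 4 1; step 968 (-1000) (-976) 4 1;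
     step (-32) (-1973) (-1023) 3 1], [:: step 1005 (-39) (-17) 2 1; step 1963 1969 1026 2 1;
     step 1009 (-1981) 1960 2 1; step (-1039) 2011 1995 2 1], [:: step 18 (-1961) (-23) 4 1])
   ([:: step 2037 (-31) (-1961) 3 1; step 18 (-977) 961 3 1; step (-20) (-962) 1007 3 1;
     step (-2003) 1997 (-977) 3 1; step 16 (-27) (-2011) 3 1; step (-33) 2038 36 3 1;
     step (-1980) 1002 (-985) 3 1; step (-2008) (-1038) 2007 3 1], [:: step 979 22 (-34) 2 1;
     step (-976) 978 1961 2 1], [:: step 1984 1968 (-1015) 3 1; step 1 1 1 3 1])
   ([:: step (-25) (-1974) (-1997) 3 1; step (-1963) 1996 (-1019) 3 1; step 1989 987 (-1976) 3 1;
     step 1001 1989 964 3 1; step 2013 (-1028) 1960 3 1; step (-960) 986 (-1966) 3 1;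
     step 2005 (-1034) 2028 3 1], [:: step (-2014) (-1013) (-11) 2 1; step (-27) (-3) (-1038) 2 1;
     step 1020 2011 (-15) 2 1; step 39 993 (-2004) 2 1], [:: step 1991 (-985) 968 3 1;
     step (-2035) (-1025) 1013 3 1]);
  BaseCert 11 1 (-47) 106 (-21) 178
   ([:: step (-1968) 1451 660 4 6; step 2015 4 (-32) 4 1; step 970 986 27 4 1; step 987 1980 2027 4 1;
     step 977 2 (-1001) 4 1],
    [:: step (-1709) 765 1222 3 16; step (-18) (-2029) (-1980) 3 1; step 39 (-10) 21 3 1;
      step (-19) 972 (-2007) 3 1; step (-998) (-2029) 5 3 1])
   ([:: step 984 970 1000 4 1; step (-1992) 966 (-1017) 4 1; step 39 (-991) 965 4 1;
     step (-1009) 2024 (-1025) 4 1], [:: step (-1969) (-1963) 2009 2 1; step 2027 (-1994) 2020 2 1;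
     step (-1005) (-997) (-967) 2 1], [:: step 2001 (-2004) 1022 4 1])
   ([:: step 1988 1005 (-1010) 4 1; step (-1997) 1031 1037 4 1; step (-37) (-1000) 1994 4 1;
     step 2006 977 2032 4 1;
     step (-2023) 1029 990 3 1], [:: step 2028 (-36) (-2009) 2 1], [:: step 2014 2009 (-1960) 4 1])
   ([:: step (-1010) 997 (-1987) 3 1; step (-2028) 2034 (-1035) 3 1; step (-1001) (-1004) 2021 3 1;
     step (-2003) 988 998 3 1; step (-2008) 17 (-2012) 3 1; step 11 1024 1038 3 1;
     step (-994) (-1021) 2014 3 1; step 1034 30 965 3 1], [:: step (-1) 1993 2021 2 1;
     step 966 (-2009) 1002 2 1; step (-2030) (-980) 7 2 1], [:: step 2018 (-1995) 1993 3 1;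
     step (-2016) (-1989) 995 3 1])
   ([:: step (-970) 1975 (-2039) 3 1; step (-24) (-1039) (-1016) 3 1; step 1968 (-1966) (-33) 3 1;
     step 1020 (-4) 32 3 1; step 13 2040 (-2032) 3 1; step (-1970) 2032 (-1024) 3 1;
     step (-1978) 1962 (-23) 3 1; step (-966) 2000 1962 3 1;
     step 1981 (-1019) (-1970) 3 1], [:: step 2009 (-2012) 1964 2 1], [:: step (-992) 1999 1019 3 1;
     step 1 1 1 3 1]);
  BaseCert 11 2 (-47) 106 (-21) 178
   ([:: step (-1498) 1005 566 4 6; step 1964 2030 (-2004) 4 1; step 968 993 1020 4 1;
     step 2004 1015 1004 4 1; step 963 (-29) 1018 4 1],
    [:: step (-1125) 485 853 3 16; step 1001 (-1966) 1980 3 1; step (-15) (-11) (-1969) 3 1;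
      step (-1000) (-1027) (-2001) 3 1; step 2032 (-1014) (-1962) 3 1])
   ([:: step 1030 1015 27 4 1; step (-987) 8 1991 4 1; step 38 2017 (-999) 4 1;
     step (-1021) 2021 1967 4 1], [:: step 2038 (-1031) (-1) 2 1; step 968 (-1000) (-976) 2 1;
     step (-32) (-1973) (-1023) 2 1; step (-3) (-1991) (-6) 2 1], [:: step 1005 (-39) (-17) 4 1])
   ([:: step 1963 1969 1026 4 1; step 2037 (-31) (-1961) 4 1; step 18 (-977) 961 4 1;
     step (-20) (-962) 1007 4 1; step (-2003) 1997 (-977) 3 1], [:: step 16 (-27) (-2011) 2 1;
     step (-33) 2038 36 2 1], [:: step (-1980) 1002 (-985) 4 1])
   ([:: step (-2008) (-1038) 2007 3 1; step 979 22 (-34) 3 1; step (-976) 978 1961 3 1;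
     step 1984 1968 (-1015) 3 1; step 971 (-37) (-1003) 3 1; step 4 (-960) (-1974) 3 1;
     step (-2011) (-1003) (-39) 3 1; step (-2024) 983 39 3 1], [:: step (-970) 1975 (-2039) 2 1;
     step (-1987) (-1980) 22 2 1; step (-2020) (-2010) (-3) 2 1;
     step 966 (-1971) 1972 2 1], [:: step (-991) 2013 982 3 1; step 974 1981 (-2023) 3 1])
   ([:: step (-8) 2020 (-1987) 3 1; step 20 (-1988) 997 3 1; step 1039 (-1010) 6 3 1; step 1983 988 28 3 1;
     step 979 964 1974 3 1; step 1986 (-995) (-2021) 3 1; step 20 1030 (-964) 3 1; step 1014 5 (-975) 3 1;
     step (-1027) (-10) 1964 3 1], [:: step 2000 (-1011) (-1991) 2 1;
     step 2039 3 (-2026) 2 1], [:: step (-2024) (-39) (-5) 3 1; step 1 1 1 3 1]);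
  BaseCert 11 3 (-47) 106 (-21) 178
   ([:: step (-1834) 1364 650 4 6; step 1031 2003 (-2028) 4 1; step (-29) 2024 (-972) 4 1;
     step 2007 (-36) 1990 4 1; step 997 (-1021) 1985 4 1],
    [:: step (-1896) 911 1370 3 16; step 968 38 1964 3 1; step 1015 2016 37 3 1;
      step 2034 2038 (-2031) 3 1; step (-2034) 25 985 3 1])
   ([:: step (-1001) (-1994) (-1980) 4 1; step (-1972) 2030 1991 4 1; step (-25) (-1014) (-1010) 4 1;
     step (-2010) 1965 (-964) 4 1], [:: step 8 (-14) (-1023) 2 1], [:: step (-1039) 1977 1963 4 1])
   ([:: step 21 (-1969) (-976) 4 1; step (-1024) (-1988) (-1981) 4 1; step 4 21 2007 4 1;
     step 1980 1999 (-986) 3 1], [:: step 985 (-1982) (-1039) 2 1; step 32 1033 2013 2 1;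
     step (-981) (-2014) 40 2 1], [:: step 2000 3 (-2007) 4 1])
   ([:: step (-1005) (-1996) (-35) 3 1; step 1978 1022 (-1984) 3 1; step (-1027) (-1025) 969 3 1;
     step (-25) (-1036) (-8) 3 1; step 13 (-1020) (-990) 3 1; step 1012 (-1004) (-987) 3 1;
     step 2010 (-3) (-2006) 3 1;
     step (-971) 1976 1981 3 1], [:: step (-2030) 1018 2001 2 1], [:: step (-40) (-2027) (-1975) 3 1;
     step 1 1 1 3 1])
   ([:: step 2 2028 (-980) 3 1; step (-960) (-2003) 1034 3 1; step 986 996 (-1961) 3 1;
     step 1012 (-1995) 1980 3 1; step 1984 (-1005) (-984) 3 1; step 1025 (-972) 989 3 1;
     step (-995) (-2023) 2029 3 1], [:: step (-1010) (-2007) 1979 2 1; step (-1007) 1023 (-14) 2 1;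
     step 1031 1999 (-22) 2 1], [:: step (-1975) (-1978) (-2009) 3 1; step (-7) (-1981) 9 3 1]);
  BaseCert 12 0 (-26) (-62) 79 161
   ([:: step 606 (-1832) 1511 4 10; step (-2007) (-1028) (-995) 4 1; step (-16) 1025 34 4 1;
     step 1020 1960 969 4 1; step 8 (-32) 2010 4 1],
    [:: step (-804) (-1840) (-419) 3 24; step 1960 1999 (-1024) 3 1; step (-1005) 18 (-1977) 3 1;
      step (-2038) 1039 (-1995) 3 1; step 1981 (-988) (-27) 3 1])
   ([:: step 992 2028 (-1980) 4 1; step 2004 987 (-2015) 4 1; step (-1960) (-35) (-2013) 4 1;
     step 2002 (-980) (-38) 4 1], [:: step (-1034) 14 1975 2 1], [:: step 1033 1018 (-1031) 4 1])
   ([:: step 1962 (-15) (-972) 4 1; step (-2030) 31 (-2013) 4 1; step 1022 31 1025 4 1;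
     step 19 (-1024) (-35) 3 1], [:: step (-1985) 972 976 2 1; step 998 (-962) (-1978) 2 1;
     step 38 1977 2020 2 1; step (-39) (-985) 2037 2 1], [:: step (-1970) 1966 (-2001) 4 1])
   ([:: step 963 (-1036) 2002 3 1; step (-2014) 1967 (-17) 3 1; step 1034 33 2012 3 1;
     step 1030 2003 (-1995) 3 1; step 28 22 (-981) 3 1; step 970 2014 2039 3 1;
     step (-1002) 975 (-1001) 3 1;
     step 1000 (-2004) (-32) 3 1], [:: step 2000 31 (-31) 2 1], [:: step 20 2021 10 3 1; step 1 1 1 3 1])
   ([:: step 1975 35 (-966) 3 1; step (-963) (-974) 32 3 1; step (-1981) 1006 963 3 1;
     step (-1039) (-2020) (-997) 3 1; step (-30) (-24) (-2038) 3 1; step 1002 (-1028) 2020 3 1;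
     step 10 1 975 3 1], [:: step (-964) (-1006) (-1022) 2 1; step (-1031) 973 (-1974) 2 1;
     step (-2024) (-21) (-960) 2 1; step (-1017) 1026 2034 2 1], [:: step 975 999 (-971) 3 1;
     step (-1) (-30) (-1967) 3 1]);
  BaseCert 13 0 65 (-104) (-51) 185
   ([:: step 1925 737 (-1489) 4 15; step (-995) (-1010) 989 4 1; step (-2033) (-2034) 1992 4 1;
     step 1994 (-2007) 2037 4 1; step (-1964) (-1) 2009 4 1],
    [:: step 1900 (-1623) 591 3 34; step 2003 (-1030) (-1036) 3 1; step 1005 1017 960 3 1;
      step (-27) 25 22 3 1; step (-2000) 36 997 3 1])
   ([:: step 2026 (-22) 1964 4 1; step 4 2032 1972 4 1;
     step (-1023) (-16) 1010 4 1], [:: step (-983) (-3) (-966) 2 1; step 990 (-24) 1031 2 1;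
     step 1006 2018 (-1967) 2 1; step 2001 (-1980) 1990 2 1], [:: step 998 3 (-2032) 4 1])
   ([:: step (-2021) 2006 1036 4 1; step 2005 965 (-19) 4 1; step (-994) 1040 (-10) 4 1;
     step (-1980) 996 961 3 1], [:: step (-2026) 2000 2036 2 1;
     step (-981) 1009 33 2 1], [:: step (-2012) 1000 30 4 1])
   ([:: step 988 (-982) (-21) 3 1; step (-2023) 1008 1977 3 1; step 1020 (-965) (-999) 3 1;
     step 39 1029 1993 3 1; step 1983 (-1021) 1035 3 1;
     step 2001 (-16) (-1999) 3 1], [:: step 2006 (-27) 1028 2 1; step 1014 (-1971) (-998) 2 1;
     step (-964) 1013 2020 2 1; step 972 2013 (-966) 2 1], [:: step 995 985 1976 3 1;
     step 988 2003 1036 3 1])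
   ([:: step (-1975) (-1978) (-2009) 3 1; step (-7) (-1981) 9 3 1; step (-974) (-1011) (-1040) 3 1;
     step 2026 (-1996) 2000 3 1; step 970 (-989) (-2030) 3 1; step (-1000) (-26) 1988 3 1;
     step 1960 2025 (-28) 3 1], [:: step 1996 16 2014 2 1;
     step (-1992) (-1017) (-2018) 2 1], [:: step 961 2025 2031 3 1; step 1 1 1 3 1]);
  BaseCert 13 1 (-37) 115 (-68) 432
   ([:: step (-1074) 1370 1877 4 15; step 1988 (-26) (-1996) 4 1; step 1977 (-25) 24 4 1;
     step 1038 (-1016) (-1974) 4 1; step 1017 2010 (-999) 4 1],
    [:: step (-454) 1529 (-1740) 3 34; step (-1019) 1969 1975 3 1; step (-1962) 2030 (-26) 3 1;
      step 981 8 (-37) 3 1; step 1990 0 2029 3 1])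
   ([:: step (-1036) 1005 (-7) 4 1; step (-1991) 2010 (-1019) 4 1; step (-37) 1001 27 4 1;
     step (-4) (-988) 22 4 1], [:: ], [:: step 1 1 1 4 1])
   ([:: step (-2019) (-36) 1967 4 1; step (-38) 1012 18 4 1; step 964 2031 (-1984) 4 1;
     step 34 (-965) 1974 3 1], [:: step (-987) 1030 (-964) 2 1; step (-1027) (-971) (-1034) 2 1;
     step 12 2009 (-1978) 2 1], [:: step 1960 (-2009) (-29) 4 1])
   ([:: step (-21) 1966 988 3 1; step 1982 2015 38 3 1; step (-1009) 2017 1002 3 1;
     step (-18) (-1022) 2004 3 1; step 12 (-1031) (-1021) 3 1; step 1964 1004 (-1979) 3 1;
     step 960 (-984) 1975 3 1; step (-965) (-2011) 20 3 1], [:: ], [:: step 1 1 1 3 1; step 1 1 1 3 1])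
   ([:: step 2022 2000 (-5) 3 1; step (-1963) (-1960) 2021 3 1; step 1035 (-1004) 35 3 1;
     step (-998) (-1008) 31 3 1; step (-26) 1984 1026 3 1; step (-992) 991 (-2003) 3 1;
     step 1974 (-981) (-25) 3 1], [:: step 1976 1023 (-965) 2 1; step 1974 (-999) 2008 2 1;
     step (-2036) 977 1990 2 1], [:: step 1018 (-1027) 1007 3 1; step 1 1 1 3 1]);
  BaseCert 13 2 (-53) 62 (-91) 61
   ([:: step (-735) (-438) (-1748) 4 15; step 2013 (-1025) 1987 4 1; step (-13) 1013 2012 4 1;
     step (-1993) 2038 (-1975) 4 1; step 1996 2012 2009 4 1],
    [:: step 601 1609 (-1887) 3 34; step (-988) (-8) 2009 3 1; step (-1978) (-1961) 1038 3 1;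
      step (-35) (-1033) 1014 3 1; step (-19) 2022 (-1980) 3 1])
   ([:: step (-1023) 1967 1007 4 1; step (-10) 1010 1997 4 1; step (-996) 2028 995 4 1;
     step (-1007) (-979) 1040 4 1], [:: step 6 2021 30 2 1;
     step (-2022) 964 30 2 1], [:: step 2016 2038 (-1991) 4 1])
   ([:: step 37 (-2003) (-1038) 4 1; step 1002 (-1016) 1972 4 1; step (-31) (-35) 1982 4 1;
     step (-1036) 1987 (-1972) 3 1], [:: step (-961) 971 1003 2 1; step (-1971) 2022 (-15) 2 1;
     step 997 (-963) (-969) 2 1; step (-2040) 1980 (-40) 2 1], [:: step (-1990) 1994 2024 4 1])
   ([:: step (-965) 2027 (-1964) 3 1; step (-1977) (-1003) (-30) 3 1; step (-1984) (-1026) (-2012) 3 1;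
     step 1976 (-21) 2015 3 1; step (-1960) 1012 970 3 1; step 1996 (-987) 27 3 1;
     step 1992 (-2000) (-987) 3 1; step 1970 2008 (-39) 3 1], [:: step 2011 18 1996 2 1;
     step 17 (-975) 1982 2 1], [:: step 1993 25 (-1997) 3 1; step 1 1 1 3 1])
   ([:: step (-1967) (-1966) 969 3 1; step (-2003) 971 32 3 1; step (-38) (-1001) (-2012) 3 1;
     step (-5) (-38) 986 3 1; step 36 17 2001 3 1; step (-4) 1016 999 3 1;
     step (-33) 2020 1000 3 1], [:: step 1015 (-1024) 2015 2 1; step (-1028) (-1039) (-989) 2 1;
     step (-1989) (-1963) (-1022) 2 1; step (-24) (-1040) 1985 2 1], [:: step 2017 (-1996) (-9) 3 1;
     step 971 (-1974) (-1011) 3 1]);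
  BaseCert 13 3 28 (-119) 118 551
   ([:: step 445 (-1888) 1254 4 14; step 31 2008 997 4 1; step (-29) 2014 (-33) 4 1;
     step 2023 (-1983) 1998 4 1; step 1981 964 (-31) 4 1],
    [:: step 1646 (-1211) 733 3 32; step (-1993) (-960) (-36) 3 1; step (-2023) 993 1982 3 1;
      step 1002 (-974) 1005 3 1; step 1968 8 (-22) 3 1])
   ([:: step (-2024) (-1029) (-32) 4 1; step (-1997) (-1037) 3 4 1; step (-1968) (-4) (-1980) 4 1;
     step 1985 1965 (-1992) 4 1], [:: step (-2003) (-1017) (-1030) 2 1; step (-960) (-2033) 1025 2 1;
     step (-2013) 2006 28 2 1], [:: step (-6) (-1967) 2013 4 1])
   ([:: step 967 20 (-983) 4 1; step 991 2017 2031 4 1; step (-18) 1034 1970 4 1;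
     step (-19) 1995 (-22) 4 1; step (-24) (-2030) 973 3 1], [:: ], [:: step 1 1 1 4 1])
   ([:: step (-2001) (-1034) 36 3 1; step 37 2017 (-995) 3 1; step (-2022) 965 1013 3 1;
     step 984 (-2033) 2021 3 1; step (-1008) 1980 (-1977) 3 1; step 1014 1013 21 3 1;
     step (-2020) (-1997) (-1008) 3 1; step (-1996) (-1986) 8 3 1], [:: step (-1021) 27 2002 2 1;
     step (-40) 1017 996 2 1; step (-961) (-1975) 1007 2 1], [:: step 1978 973 (-1022) 3 1; step 1 1 1 3 1])
   ([:: step 25 975 2018 3 1; step 23 (-35) 2003 3 1; step 21 (-1013) (-1033) 3 1; step 996 2018 33 3 1;
     step 1983 (-6) 997 3 1; step (-21) 966 997 3 1; step 1965 9 (-2033) 3 1; step (-978) (-2038) 1995 3 1;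
     step 1018 (-965) (-1997) 3 1], [:: ], [:: step 1 1 1 3 1; step 1 1 1 3 1]);
  BaseCert 14 0 (-118) 117 (-42) 468
   ([:: step (-1004) 1805 569 4 21; step 973 (-998) 2022 4 1; step (-27) 39 (-1973) 4 1;
     step 1009 (-2006) 1030 4 1; step 1987 1999 1015 4 1],
    [:: step (-1221) 1882 484 3 46; step 1967 2011 (-1968) 3 1; step 964 1023 1013 3 1;
      step 1982 1010 (-7) 3 1; step 2036 (-1019) 33 3 1])
   ([:: step 975 (-1023) 40 4 1; step 36 (-2013) (-39) 4 1;
     step (-1995) 2012 1032 4 1], [:: ], [:: step 1 1 1 4 1])
   ([:: step 998 (-2004) 2018 3 1; step (-1011) 1975 1987 4 1;
     step 986 (-33) 23 4 1], [:: step (-34) 1992 2040 2 1; step (-2015) (-1983) 1986 2 1;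
     step (-1963) (-1982) 968 2 1], [:: step 1003 1986 (-994) 4 1])
   ([:: step 971 (-1014) 998 3 1; step 1016 (-1029) 1999 3 1; step (-1967) 2013 (-1989) 3 1;
     step 2037 (-1031) (-979) 3 1; step 1031 2018 (-39) 3 1;
     step (-2017) (-31) (-1994) 3 1], [:: ], [:: step 1 1 1 3 1; step 1 1 1 3 1])
   ([:: step 12 988 (-1030) 3 1; step (-1963) (-1984) 1999 3 1; step 1969 972 (-1004) 3 1;
     step (-18) (-1003) 974 3 1; step 1006 972 (-993) 3 1], [:: step (-1003) (-973) (-1009) 2 1;
     step (-1005) 1023 1007 2 1; step (-1967) 997 (-2022) 2 1], [:: step 2016 987 (-34) 3 1;
     step 1 1 1 3 1]);
  BaseCert 15 0 (-33) 118 (-108) 716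
   ([:: step 431 1327 757 4 27; step 1982 2028 (-1997) 4 1; step (-972) 40 (-1008) 4 1;
     step (-1004) 2027 (-6) 4 1; step (-1961) (-37) 2012 4 1],
    [:: step 680 1935 (-1542) 3 58; step 20 1009 2030 3 1; step 2035 2012 2029 3 1;
      step (-31) (-1002) 39 3 1; step (-970) 2000 1986 3 1])
   ([:: step (-968) (-1004) 2037 4 1; step (-1968) (-1976) 994 4 1;
     step (-3) (-1975) 2015 4 1], [:: ], [:: step 1 1 1 4 1])
   ([:: step (-2027) (-1978) (-1994) 3 1; step 978 2037 (-1986) 4 1;
     step (-1035) 985 975 4 1], [:: step (-1965) 1987 (-991) 2 1; step 1021 1018 2033 2 1;
     step 1031 2012 1015 2 1], [:: step (-1980) (-973) (-25) 4 1])
   ([:: step (-1008) (-1976) 1005 3 1; step 2000 (-2005) 1027 3 1; step (-2022) 1981 (-21) 3 1;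
     step 2029 971 2 3 1; step (-1965) 1011 1972 3 1;
     step 1977 (-1032) 1986 3 1], [:: ], [:: step 1 1 1 3 1; step 1 1 1 3 1])
   ([:: step (-2009) 1978 (-1021) 3 1; step (-16) 988 (-992) 3 1; step (-2024) 1040 2028 3 1;
     step 2036 (-1989) (-966) 3 1; step 1966 (-1023) 1012 3 1], [:: step 1016 1014 (-1036) 2 1;
     step 2039 2013 (-2032) 2 1; step 996 (-2026) 2019 2 1], [:: step 1020 1026 19 3 1; step 1 1 1 3 1]);
  BaseCert 15 1 (-37) 104 (-91) 520
   ([:: step (-1842) 1537 (-572) 4 26; step 2004 975 969 4 1; step (-2039) 998 (-2004) 4 1;
     step 2036 1013 (-2014) 4 1; step (-11) (-1971) (-36) 4 1],
    [:: step 536 1782 (-1501) 3 56; step (-1018) (-975) 2032 3 1; step 29 2033 2016 3 1;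
      step (-1966) (-6) (-2033) 3 1; step 1995 (-1000) 1036 3 1])
   ([:: step 1972 (-970) 2003 4 1; step (-1984) (-1963) 2029 4 1; step 2025 (-17) 2040 4 1;
     step 32 (-2019) 6 4 1], [:: step 1033 (-2030) (-2021) 2 1;
     step (-2034) (-2034) 1968 2 1], [:: step (-2018) (-2008) 977 4 1])
   ([:: step 1974 1040 (-1021) 3 1; step 30 9 1980 4 1; step (-978) 1986 989 4 1;
     step (-2020) 2034 (-2008) 4 1], [:: step 2036 1026 1962 2 1; step 1014 (-12) (-15) 2 1;
     step (-962) (-2016) 2035 2 1; step (-974) 3 (-2013) 2 1], [:: step 1011 2028 25 4 1])
   ([:: step 1994 (-2) 1015 3 1; step 1030 (-1999) 1987 3 1; step 999 969 4 3 1; step (-1027) 992 2007 3 1;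
     step 2037 1036 1007 3 1; step 1007 (-979) 1964 3 1; step 2028 1978 (-1976) 3 1;
     step 987 (-6) 2024 3 1], [:: step (-1994) 2003 2035 2 1;
     step (-974) (-1025) 1032 2 1], [:: step (-2030) 1995 (-1013) 3 1; step 1 1 1 3 1])
   ([:: step 2012 968 1024 3 1; step (-1040) 1016 2001 3 1; step 1005 1009 (-2012) 3 1;
     step (-1974) 12 998 3 1; step 3 2011 1984 3 1; step 2009 (-2029) 30 3 1;
     step 1963 1037 (-6) 3 1], [:: step 23 969 24 2 1; step (-2033) (-2027) 1032 2 1;
     step (-1033) (-32) (-1991) 2 1; step 38 (-1997) 1973 2 1], [:: step (-988) 2000 (-2003) 3 1;
     step 995 1022 1026 3 1]);
  BaseCert 15 2 (-52) 115 (-110) 650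
   ([:: step (-681) 1537 (-1905) 4 27; step 1966 992 1962 4 1; step (-2016) 1030 19 4 1;
     step 1968 (-987) (-37) 4 1; step (-2004) 29 (-970) 4 1],
    [:: step 544 1793 (-1506) 3 58; step 1972 (-983) 1016 3 1; step (-978) 1033 (-1977) 3 1;
      step (-16) 978 39 3 1; step (-2012) 2039 (-1009) 3 1])
   ([:: step 2007 (-1960) 1002 4 1; step 1028 (-976) 1974 4 1;
     step 1037 (-1033) 1002 4 1], [:: step (-1972) 2040 1012 2 1; step (-1006) (-1978) (-21) 2 1;
     step (-34) (-1036) (-2012) 2 1], [:: step (-4) (-33) (-1005) 4 1])
   ([:: step 2034 969 4 4 1; step (-2021) 2008 1033 4 1; step 2016 (-1030) 29 4 1;
     step (-1005) 1022 (-1025) 3 1], [:: ], [:: step 1 1 1 4 1])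
   ([:: step (-2040) (-22) 9 3 1; step (-14) 1983 1024 3 1; step 1975 1009 11 3 1;
     step 1984 (-1975) 988 3 1; step 1961 (-1982) 2002 3 1;
     step (-19) 29 2025 3 1], [:: step (-1004) (-985) (-1022) 2 1; step (-1008) (-984) 1976 2 1;
     step 31 1002 28 2 1], [:: step 998 (-1973) 972 3 1; step 1 1 1 3 1])
   ([:: step (-1962) (-1004) 1037 3 1; step (-1968) (-1040) 994 3 1; step 1983 (-1035) (-1026) 3 1;
     step 2007 (-31) (-1965) 3 1; step 2024 (-992) 1985 3 1; step (-1038) 1027 2028 3 1;
     step (-964) 1032 982 3 1], [:: ], [:: step 1 1 1 3 1; step 1 1 1 3 1]);
  BaseCert 15 3 (-56) (-74) 105 431
   ([:: step (-1803) (-539) 946 4 25; step 35 (-20) 1976 4 1; step (-27) 1963 40 4 1;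
     step (-2034) (-2037) 1023 4 1; step (-1015) 2037 1034 4 1],
    [:: step (-1607) 876 (-515) 3 54; step 986 (-965) (-1006) 3 1; step 2037 960 (-10) 3 1;
      step (-8) (-2027) 1978 3 1; step (-2026) (-1965) (-1974) 3 1])
   ([:: step (-4) 1010 (-1032) 4 1; step (-2036) (-2009) (-2031) 4 1; step (-980) 1027 (-988) 4 1;
     step (-975) (-1026) 2009 4 1], [:: step (-2014) 4 1992 2 1; step 961 7 986 2 1;
     step 1982 10 (-1964) 2 1; step (-1986) (-2021) (-1963) 2 1], [:: step (-1993) 1010 2016 4 1])
   ([:: step (-2007) 1039 2014 4 1; step 966 (-1998) (-2028) 4 1; step 1983 (-966) (-1039) 4 1;
     step (-991) (-966) 1981 4 1; step 1002 960 (-2014) 3 1], [:: step 38 28 2020 2 1;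
     step (-2021) (-1027) 2022 2 1], [:: step (-1037) (-970) (-1018) 4 1])
   ([:: step (-2037) 2031 (-1986) 3 1; step (-1021) (-2027) (-1000) 3 1; step (-967) 1028 (-1023) 3 1;
     step 975 (-1018) (-1028) 3 1; step 1960 976 (-1980) 3 1; step (-983) 3 1987 3 1;
     step (-2021) (-2006) (-1033) 3 1; step 2038 (-1976) (-1991) 3 1], [:: step 1037 1023 (-2017) 2 1;
     step 27 (-22) (-2025) 2 1; step 2037 992 (-2038) 2 1;
     step (-1968) 986 977 2 1], [:: step (-1032) 34 40 3 1; step (-8) 1981 1992 3 1])
   ([:: step 1018 1969 969 3 1; step (-1011) (-1022) 1013 3 1; step 967 (-1999) (-25) 3 1;
     step (-35) 10 (-973) 3 1; step 1020 (-967) (-2023) 3 1; step 2022 1984 1015 3 1;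
     step (-1992) 2000 2013 3 1; step 1004 (-8) (-965) 3 1;
     step 9 15 (-995) 3 1], [:: step (-1036) 992 (-1963) 2 1;
     step (-1030) (-18) (-1982) 2 1], [:: step (-2024) (-1005) 1024 3 1; step 1 1 1 3 1]);
  BaseCert 16 0 (-81) 99 (-113) 345
   ([:: step 1054 1872 (-1301) 4 32; step (-2034) (-1007) 16 4 1; step (-2000) 9 (-1978) 4 1;
     step (-1981) 1022 23 4 1; step 2038 (-2018) 981 4 1],
    [:: step 659 1458 (-1180) 3 68; step (-29) 1970 1984 3 1; step (-2022) 1020 2020 3 1;
      step (-1020) 2025 (-996) 3 1; step 1993 993 2007 3 1])
   ([:: step 2002 27 (-6) 4 1; step 8 (-28) 1033 4 1; step 2013 1002 32 4 1;
     step (-1992) 1038 977 4 1], [:: step (-995) (-1969) (-1997) 2 1; step (-1978) 981 (-17) 2 1;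
     step 2006 962 (-985) 2 1; step 2029 (-2010) 1986 2 1], [:: step (-976) (-1020) 2028 4 1])
   ([:: step (-2) (-966) 1978 4 1; step (-986) (-996) 999 4 1; step 6 (-1) 962 4 1;
     step (-964) (-1019) (-2028) 4 1; step 994 1010 (-975) 3 1], [:: step (-961) (-970) 2031 2 1;
     step (-35) 2012 (-1982) 2 1], [:: step 2013 990 (-2007) 4 1])
   ([:: step 2019 1997 (-4) 3 1; step 968 9 (-1987) 3 1; step (-34) 1025 987 3 1;
     step (-1975) 1974 (-2008) 3 1; step (-1018) (-15) (-2023) 3 1; step 22 984 1021 3 1;
     step (-981) (-1969) (-983) 3 1; step 2029 1035 971 3 1], [:: step 39 36 1988 2 1;
     step 24 (-994) 2018 2 1; step 967 1965 2007 2 1;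
     step 1011 2010 (-1011) 2 1], [:: step (-2027) 2002 1036 3 1; step 977 990 (-31) 3 1])
   ([:: step (-982) (-10) 1971 3 1; step 2013 1982 (-1) 3 1; step 1004 26 10 3 1; step 37 34 969 3 1;
     step (-1993) 973 1969 3 1; step (-994) (-1971) 1013 3 1; step 1037 (-1983) 1024 3 1;
     step (-1989) 991 30 3 1; step (-24) 2004 (-1038) 3 1], [:: step (-1032) 1004 2026 2 1;
     step (-2016) (-968) 30 2 1], [:: step 1994 (-1040) (-2026) 3 1; step 1 1 1 3 1]);
  BaseCert 17 0 (-107) 116 (-43) 925
   ([:: step (-1646) 528 (-719) 4 42; step 974 1993 (-2017) 4 1; step (-1971) 2035 12 4 1;
     step (-1987) 2004 (-1990) 4 1; step (-1967) (-1011) 1961 4 1],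
    [:: step (-1340) 1599 723 3 88; step 2034 1040 (-2032) 3 1; step 990 1039 980 3 1;
      step (-2) (-2014) (-1974) 3 1; step (-11) (-1038) 40 3 1])
   ([:: step 1990 (-1034) (-1007) 4 1; step (-11) (-2001) (-1975) 4 1], [:: step (-1021) 2019 2033 2 1;
     step 2027 1979 (-961) 2 1; step 1974 (-2000) (-9) 2 1], [:: step (-2015) (-1975) 1005 4 1])
   ([:: step 2015 (-1037) (-18) 3 1; step 1018 2013 (-2032) 4 1], [:: step 25 (-1009) 982 2 1;
     step 2021 976 2016 2 1; step 980 (-1039) (-2020) 2 1;
     step 2008 (-989) (-1032) 2 1], [:: step 3 975 (-9) 4 1])
   ([:: step 1990 (-2033) (-1037) 3 1; step 1991 (-2015) 1038 3 1; step 1025 976 23 3 1;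
     step (-1000) (-2004) (-965) 3 1], [:: step 1019 (-988) 21 2 1; step (-1963) (-1964) (-2031) 2 1;
     step 1991 1966 (-999) 2 1], [:: step (-1981) (-2002) (-26) 3 1; step 1 1 1 3 1])
   ([:: step 1967 (-1983) (-27) 3 1; step 993 32 981 3 1;
     step 1991 1978 2001 3 1], [:: step 976 1960 29 2 1; step 17 1038 (-1031) 2 1;
     step (-1971) (-6) 1960 2 1; step 1974 (-967) 1990 2 1], [:: step 1025 (-1978) 14 3 1;
     step 1037 971 (-1999) 3 1]);
  BaseCert 17 1 118 (-89) (-81) 857
   ([:: step 942 (-1144) (-489) 4 40; step 999 998 (-37) 4 1; step 2 2035 985 4 1;
     step (-1040) 2032 (-29) 4 1; step 6 1038 1979 4 1],
    [:: step (-1217) 511 (-428) 3 84; step 40 (-33) (-1972) 3 1; step 1022 1990 30 3 1;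
      step 1961 (-1003) (-10) 3 1; step (-1981) 997 (-2008) 3 1])
   ([:: step (-2021) (-965) (-968) 4 1; step (-1969) 989 (-29) 4 1; step 1969 (-1017) (-963) 4 1;
     step (-968) 1998 1961 4 1], [:: step (-39) 29 (-2020) 2 1; step (-1023) (-1995) (-985) 2 1;
     step (-2019) (-1981) 2024 2 1; step (-32) 1039 (-1963) 2 1], [:: step (-18) 961 1006 4 1])
   ([:: step (-2037) 1030 1020 4 1; step (-1019) 1006 (-1000) 4 1; step (-987) 26 1016 4 1;
     step (-2019) (-1032) 1000 4 1;
     step (-2025) 2008 (-1006) 3 1], [:: step (-37) 994 1027 2 1], [:: step 34 (-1031) 1972 4 1])
   ([:: step (-2024) 9 1018 3 1; step (-24) 971 2017 3 1; step 1985 1979 (-2014) 3 1;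
     step (-2038) 2021 981 3 1; step 975 33 986 3 1; step (-1992) 20 (-2033) 3 1; step 1976 17 (-1965) 3 1;
     step (-989) 1963 (-993) 3 1], [:: step 1037 (-1032) 2024 2 1; step (-2000) (-977) 2003 2 1;
     step (-993) (-1005) 1023 2 1; step (-1992) 981 (-2037) 2 1], [:: step 1012 (-1985) 983 3 1;
     step (-26) (-986) (-993) 3 1])
   ([:: step 964 (-1970) 3 3 1; step 2039 (-2027) (-1032) 3 1; step 1999 (-1027) 978 3 1;
     step 1976 964 (-1967) 3 1; step 1991 1008 (-1980) 3 1; step (-1969) (-1033) (-24) 3 1;
     step 961 (-984) 1 3 1; step (-982) (-1987) 2023 3 1;
     step (-1005) 2018 1021 3 1], [:: step (-7) (-1974) 1970 2 1], [:: step (-975) (-1009) (-1027) 3 1;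
     step 1 1 1 3 1]);
  BaseCert 17 2 (-116) 100 (-119) 393
   ([:: step (-733) 1353 (-1808) 4 40; step 1973 1969 1 4 1; step 1973 1979 (-2007) 4 1;
     step (-964) (-36) 1034 4 1; step (-2020) 1994 38 4 1],
    [:: step (-975) 1464 797 3 84; step 2017 2036 (-1026) 3 1; step 1960 (-14) 1021 3 1;
      step (-984) 978 (-1972) 3 1; step (-18) (-1005) 1022 3 1])
   ([:: step 31 8 2039 4 1; step (-17) (-994) (-975) 4 1; step 2030 (-1037) 963 4 1;
     step (-991) 1984 (-1960) 4 1], [:: step (-3) (-1979) (-2018) 2 1; step 1027 (-15) 1015 2 1;
     step (-1021) 24 (-2037) 2 1; step 1017 1006 1038 2 1], [:: step 2012 (-1962) 22 4 1])
   ([:: step (-1013) 997 36 3 1; step (-2015) (-14) (-18) 4 1; step 1021 1989 2037 4 1;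
     step 1963 999 1002 4 1; step 27 (-988) 1033 4 1], [:: step 1993 18 1038 2 1;
     step (-1024) 2033 1026 2 1; step (-1002) (-2034) 32 2 1], [:: step (-37) (-977) (-2018) 4 1])
   ([:: step 969 24 (-992) 3 1; step 2007 (-2006) (-1025) 3 1; step (-978) 1029 (-989) 3 1;
     step 984 971 (-2019) 3 1; step (-1009) (-2009) (-1) 3 1; step 1015 (-965) 1983 3 1;
     step (-24) (-1012) 2013 3 1; step 1029 1020 (-1975) 3 1], [:: step 11 2034 (-7) 2 1;
     step (-2035) (-983) 998 2 1; step (-973) (-1968) 7 2 1;
     step 966 7 2012 2 1], [:: step 2006 (-1032) (-1031) 3 1; step (-2030) (-970) 2026 3 1])
   ([:: step (-1021) (-1005) (-1973) 3 1; step (-984) 28 966 3 1; step 995 28 968 3 1;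
     step 1027 2028 2013 3 1; step 17 1996 30 3 1; step 1002 (-1020) 1995 3 1; step 1976 (-2038) (-21) 3 1;
     step (-1981) (-985) (-1983) 3 1; step 1997 (-26) (-14) 3 1], [:: step (-2016) (-1007) (-1996) 2 1;
     step (-997) (-30) 970 2 1; step 966 (-23) 988 2 1], [:: step 2000 2021 1004 3 1; step 1 1 1 3 1]);
  BaseCert 17 3 (-113) 80 (-109) 433
   ([:: step (-1804) 1527 (-469) 4 42; step (-997) 1014 (-36) 4 1; step 2027 (-2026) 1026 4 1;
     step 1029 (-20) 28 4 1; step 991 983 (-985) 4 1],
    [:: step 453 1513 (-1783) 3 88; step (-1015) 2026 (-18) 3 1; step (-986) (-1033) 987 3 1;
      step (-2012) 2002 (-1996) 3 1; step (-2030) 966 970 3 1])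
   ([:: step 1023 14 970 4 1;
     step (-1024) 1997 (-969) 4 1], [:: step (-2004) (-1040) 33 2 1], [:: step 34 970 (-1960) 4 1])
   ([:: step (-2014) 2028 1988 4 1; step 26 (-27) 4 3 1], [:: step 1037 (-977) (-1982) 2 1;
     step 995 (-2016) 20 2 1; step 1964 (-2026) 1979 2 1;
     step 1031 22 (-1009) 2 1], [:: step 2015 2010 978 4 1])
   ([:: step 960 28 (-2039) 3 1; step 2040 (-1999) 988 3 1; step 2009 1037 31 3 1;
     step (-1986) 1037 2014 3 1], [:: step 984 (-13) 2000 2 1], [:: step 1990 (-2026) (-1027) 3 1;
     step 1 1 1 3 1])
   ([:: step 1010 (-2014) 999 3 1; step 1970 (-2028) 2011 3 1;
     step 971 1982 (-2012) 3 1], [:: step 1964 2002 (-977) 2 1; step 12 1984 990 2 1;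
     step (-980) 2029 1963 2 1; step (-1002) 1012 (-1009) 2 1], [:: step 2028 (-968) (-1961) 3 1;
     step (-1021) (-12) 972 3 1]);
  BaseCert 18 0 (-1515) 4412 (-4325) 38542
   ([:: step (-1913) 1666 (-553) 4 50; step (-1996) 1017 (-1992) 4 1; step 33 31 (-1037) 4 1;
     step 19 (-1021) 961 4 1; step (-1028) 1993 1970 4 1],
    [:: step 587 1314 (-1040) 3 104; step (-960) 972 1982 3 1; step (-1032) 1039 (-2028) 3 1;
      step (-38) 2023 1018 3 1; step 2015 (-1009) (-2029) 3 1])
   ([:: step (-1977) 1978 (-18) 4 1; step 989 979 35 4 1;
     step (-1025) (-966) 14 4 1], [:: ], [:: step 1 1 1 4 1])
   ([:: step 33 (-977) (-8) 3 1; step 12 (-973) 1986 4 1;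
     step (-1006) 24 985 4 1], [:: step 2021 (-15) (-1999) 2 1; step 2037 37 (-1023) 2 1;
     step 1965 (-975) (-1039) 2 1], [:: step 2022 (-2001) (-1038) 4 1])
   ([:: step (-1039) (-2002) 1979 3 1; step 30 (-2029) 25 3 1; step (-1983) 2018 (-5) 3 1;
     step (-979) 1015 995 3 1; step (-1979) 1035 (-26) 3 1;
     step (-963) 2024 1965 3 1], [:: ], [:: step 1 1 1 3 1; step 1 1 1 3 1])
   ([:: step (-1978) 1995 24 3 1; step 27 (-1018) 1992 3 1; step (-1993) 1008 (-1036) 3 1;
     step 1036 1971 (-1027) 3 1; step 997 978 960 3 1], [:: step (-1033) 2032 1028 2 1;
     step 1004 (-28) (-1980) 2 1; step (-965) (-1016) (-987) 2 1], [:: step 1017 (-2038) 38 3 1;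
     step 1 1 1 3 1]);
  BaseCert 19 0 (-3956) (-2361) 1661 4109
   ([:: step (-557) (-1922) 1106 4 58; step (-983) 1027 974 4 1; step (-2032) 23 (-1969) 4 1;
     step (-2032) (-987) 1025 4 1; step (-1013) (-1008) 1022 4 1],
    [:: step (-1806) (-787) 668 3 120; step 2019 980 35 3 1; step 1995 (-969) (-1978) 3 1;
      step (-1984) 1988 1969 3 1; step (-970) 2010 27 3 1])
   ([:: step (-1980) (-2007) 1978 4 1; step 2019 1987 (-991) 4 1; step (-1976) (-6) 2006 4 1;
     step (-1027) 1020 1986 4 1], [:: step (-2025) 988 (-977) 2 1; step 963 (-977) 1022 2 1;
     step 975 (-1025) 993 2 1], [:: step 2019 35 (-989) 4 1])
   ([:: step 23 (-1990) 2016 3 1; step 1978 39 10 4 1; step 2003 2029 1980 4 1;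
     step 974 (-2031) (-1000) 4 1; step (-2026) 990 (-2017) 4 1], [:: ], [:: step 1 1 1 4 1])
   ([:: step 1035 12 (-1010) 3 1; step 1029 (-1968) (-16) 3 1; step 1974 24 1027 3 1;
     step (-982) 2037 (-1966) 3 1; step 21 977 32 3 1; step 2027 974 (-1981) 3 1;
     step 961 1025 (-1993) 3 1; step 1038 (-1020) 32 3 1], [:: step (-1032) 2011 (-1024) 2 1;
     step 13 985 (-1981) 2 1; step (-1016) 1989 (-969) 2 1], [:: step (-2024) (-31) 2012 3 1;
     step 1 1 1 3 1])
   ([:: step (-994) (-2010) (-33) 3 1; step 972 1989 8 3 1; step 33 1994 (-988) 3 1;
     step (-1993) 1006 (-1979) 3 1; step (-983) (-2035) (-2007) 3 1; step (-28) (-1006) 26 3 1;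
     step 12 2019 1985 3 1; step 1966 1003 1962 3 1;
     step (-2025) (-32) (-1001) 3 1], [:: ], [:: step 1 1 1 3 1; step 1 1 1 3 1]);
  BaseCert 19 1 (-1464) 4092 (-1674) 41575
   ([:: step (-1060) 1382 (-1949) 4 59; step 2015 1012 (-40) 4 1; step (-1004) 3 994 4 1;
     step 2010 1010 (-981) 4 1; step (-2029) 2000 (-996) 4 1],
    [:: step (-725) 1651 (-1978) 3 122; step (-1022) 977 2019 3 1; step 1998 12 979 3 1;
      step 1020 1022 (-2012) 3 1; step 994 (-1998) (-2040) 3 1])
   ([:: step (-22) 2011 (-1034) 4 1; step (-976) (-982) 1998 4 1;
     step 1008 963 (-10) 4 1], [:: step (-974) 1016 1999 2 1; step (-1994) (-969) 1035 2 1;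
     step (-23) 1033 (-1982) 2 1; step (-1979) (-1030) 28 2 1], [:: step (-8) (-2031) 2014 4 1])
   ([:: step (-2017) 977 961 3 1; step (-1034) (-1994) (-971) 4 1; step 2039 (-1011) 1964 4 1;
     step (-2017) (-962) 20 4 1], [:: step (-1003) 1972 (-998) 2 1;
     step 1006 10 (-1003) 2 1], [:: step (-1973) 2029 1994 4 1])
   ([:: step (-984) (-15) (-7) 3 1; step 29 (-33) (-12) 3 1; step (-5) (-1993) (-2001) 3 1;
     step 2040 985 10 3 1; step (-989) 32 2026 3 1;
     step (-20) 25 (-1026) 3 1], [:: step (-1016) (-1024) (-39) 2 1; step (-981) (-1) (-1986) 2 1;
     step 963 (-1997) 982 2 1; step (-2040) 27 1998 2 1], [:: step (-1966) (-1015) (-1004) 3 1;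
     step 1977 1003 (-1040) 3 1])
   ([:: step 1979 (-2002) 979 3 1; step 1001 (-968) 1019 3 1; step (-1992) (-1974) (-2034) 3 1;
     step (-1034) 1007 984 3 1; step 1019 962 991 3 1; step 969 2018 1966 3 1;
     step (-987) (-25) (-17) 3 1], [:: step (-2010) 6 1984 2 1;
     step 21 2028 (-17) 2 1], [:: step (-988) 1000 (-1975) 3 1; step 1 1 1 3 1]);
  BaseCert 19 2 (-2082) 3418 1524 39901
   ([:: step (-1770) 614 (-436) 4 59; step (-1965) 998 2024 4 1; step 2036 7 976 4 1;
     step (-1000) 1979 (-2004) 4 1; step (-1979) (-2032) 1000 4 1],
    [:: step (-653) 1451 (-1805) 3 122; step (-2000) 1032 2003 3 1; step (-960) 982 2029 3 1;
      step (-1992) 20 1003 3 1; step (-991) 11 1967 3 1])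
   ([:: step 1974 1968 970 4 1; step 8 (-1992) 1030 4 1; step 1006 (-1966) (-2019) 4 1;
     step 25 (-2002) 1987 4 1], [:: ], [:: step 1 1 1 4 1])
   ([:: step 996 (-968) 1016 4 1; step (-984) (-2003) (-989) 4 1; step 2010 (-2029) (-1040) 4 1;
     step 24 973 2021 3 1], [:: step 2018 (-12) (-1024) 2 1; step 1021 2037 (-33) 2 1;
     step 1980 27 29 2 1], [:: step 1034 2019 (-1970) 4 1])
   ([:: step (-1961) (-1968) (-2024) 3 1; step (-1961) (-1969) 979 3 1; step 2006 973 18 3 1;
     step (-1038) (-2012) 2014 3 1; step (-2000) 39 (-1980) 3 1; step (-971) 2031 (-1001) 3 1;
     step (-994) (-964) (-992) 3 1; step 6 (-40) (-14) 3 1], [:: ], [:: step 1 1 1 3 1; step 1 1 1 3 1])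
   ([:: step 1036 32 (-997) 3 1; step (-1970) (-960) 3 3 1; step (-6) (-977) (-988) 3 1;
     step (-993) 1993 1039 3 1; step (-7) (-1017) (-960) 3 1; step 1995 (-986) (-16) 3 1;
     step 30 1007 (-2014) 3 1], [:: step (-29) (-9) 37 2 1; step 995 27 (-40) 2 1;
     step (-991) (-3) (-964) 2 1], [:: step 2000 985 2025 3 1; step 1 1 1 3 1]);
  BaseCert 19 3 (-1792) 3967 1360 46196
   ([:: step (-863) 1910 687 4 59; step 1968 (-975) (-9) 4 1; step 2014 (-999) (-992) 4 1;
     step 2016 1989 (-2018) 4 1; step (-1997) 1003 (-1981) 4 1],
    [:: step (-1193) 906 (-428) 3 122; step (-1996) (-20) (-961) 3 1; step 1999 (-2015) 30 3 1;
      step (-28) 1988 2031 3 1; step (-967) (-1993) 1010 3 1])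
   ([:: step 2026 (-2035) 984 4 1; step 1029 (-985) (-18) 4 1;
     step 990 982 (-1032) 4 1], [:: step 980 2035 1025 2 1;
     step 1003 2040 1974 2 1], [:: step 998 992 (-1985) 4 1])
   ([:: step (-2035) 979 (-2007) 3 1; step 997 (-29) (-966) 4 1;
     step 1975 (-975) 12 4 1], [:: step 1034 (-2039) 1964 2 1; step 2003 (-12) 1988 2 1;
     step (-2009) (-2006) (-977) 2 1; step (-1983) (-1980) (-2033) 2 1], [:: step 13 (-984) (-1037) 4 1])
   ([:: step 1029 1960 983 3 1; step 1966 1993 973 3 1; step (-2004) (-34) 20 3 1; step 1024 1998 13 3 1;
     step (-971) 8 (-2000) 3 1; step (-1006) (-1967) 998 3 1], [:: step (-38) 1970 2038 2 1;
     step (-994) (-1032) 1985 2 1], [:: step (-1960) 1028 (-1031) 3 1; step 1 1 1 3 1])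
   ([:: step (-1037) (-1997) (-2017) 3 1; step 1001 (-1997) 1040 3 1; step 1976 2035 (-1960) 3 1;
     step 2021 (-2038) (-2025) 3 1; step 972 1968 (-963) 3 1], [:: step (-1001) (-2016) (-1030) 2 1;
     step (-1969) (-997) (-996) 2 1; step (-27) (-1007) 1028 2 1;
     step (-1007) (-1) 983 2 1], [:: step (-1005) 1012 2022 3 1; step (-1976) (-2040) (-2033) 3 1])].

Lemma tetrahedron_check : certifies tetrahedron_cert (monos 4) (nseq 5 2) 0.
Proof. by vm_cast_no_check (erefl true). Qed.

Lemma brick_check : all (fun c => certifies c.2 brick (brick_units c.1) 0) brick_certs.
Proof. by vm_cast_no_check (erefl true). Qed.

Lemma slice_check : (size slice == 240) && certifies slice_cert slice (nseq 11 4 ++ nseq 2 3) 0.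
Proof. by vm_cast_no_check (erefl true). Qed.

Lemma block_check : all (fun c => (size (block c.1) == 20 * (2 * c.1 - 12)) && tile_ok (block c.1) c.2)
  (zip (iota 13 6) block_certs).
Proof. by vm_cast_no_check (erefl true). Qed.

Lemma slab_check : all (fun c => (size (slab c.1.1 c.1.2) <= 660) && tile_ok (slab c.1.1 c.1.2) c.2) slab_certs.
Proof. by vm_cast_no_check (erefl true). Qed.

Lemma base_check : all base_ok base_certs.
Proof. by vm_cast_no_check (erefl true). Qed.

Lemma slab_complete : all (fun nb => admissible nb.1 nb.2 ==> (nb \in map fst slab_certs))
  [seq (N, b) | N <- iota 12 4, b <- iota 0 4].
Proof. by vm_cast_no_check (erefl true). Qed.

Lemma base_complete :
  all (fun nb => admissible nb.1 nb.2 ==> (nb \in map (fun c => (base_N c, base_b c)) base_certs))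
    [seq (N, b) | N <- iota 10 10, b <- iota 0 4].
Proof. by vm_cast_no_check (erefl true). Qed.

(** * The simplex *)

(** On the simplex -6 j + a lies between -6 N and N, so the coefficient 10 N makes the layer
    decisive. Within layer 11, which is layer 1 of the next simplex, the functional orders the cells
    by 6 (N - 11 - j) + a, and the slab keeps the low ones that the next simplex lacks. *)
Lemma cut_below_layer11 N h i j a : 20 <= N -> h <= 14 -> i + j + a <= N ->
  (pairing ((10 * N)%:Z, -6, 1) (i, j, a) < 11 * (10 * N)%:Z + h%:Z - 6 * (N - 11)%:Z)%R
  = (i < 11) || (i == 11) && (6 * (N - 11 - j) + a < h).
Proof.
rewrite /pairing /= => hN hh hi; case: (ltngtP i 11) => [lt|gt|ei] /=; last by subst i; apply/idP/idP; lia.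
  have : (N%:Z * i%:Z <= 10 * N%:Z)%R by nia.
  lia.
have : (12 * N%:Z <= N%:Z * i%:Z)%R by nia.
by move=> ?; apply/negbTE; lia.
Qed.

(** The signs are reversed because in layer 10, which is layer 0 of the next simplex, the slab hands
    over the cells with small 6 (N - 10 - j) + a and keeps the others. The summand 1 - e turns the
    strict inequality into e <= 6 (N - 10 - j) + a. *)
Lemma cut_below_layer10 N e i j a : 20 <= N -> e <= 24 -> i + j + a <= N ->
  (pairing ((10 * N)%:Z, 6, -1) (i, j, a) < 10 * (10 * N)%:Z + 6 * (N - 10)%:Z + 1 - e%:Z)%R
  = (i < 10) || (i == 10) && (e <= 6 * (N - 10 - j) + a).
Proof.
rewrite /pairing /= => hN hh hi; case: (ltngtP i 10) => [lt|gt|ei] /=; last by subst i; apply/idP/idP; lia.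
  have : (N%:Z * i%:Z <= 9 * N%:Z)%R by nia.
  lia.
have : (11 * N%:Z <= N%:Z * i%:Z)%R by nia.
by move=> ?; apply/negbTE; lia.
Qed.

Section Main.
Variable K : closedFieldType.
Hypotheses (char2 : (2%:R != 0 :> K)%R) (char3 : (3%:R != 0 :> K)%R).
Local Notation absorbs := (absorbs K).
Local Notation good := (good K).
Local Notation completes := (completes K).

Lemma slice_absorbs12 : absorbs slice [::] 12 0.
Proof.
have /andP[/eqP hs h11] := slice_check.
apply: (slice_absorbs _ (certifies_sound char2 char3 h11) hs) => a ha.
have /mapP[c hc ->] : a \in map fst brick_certs by exact: ha.
exact: (certifies_sound char2 char3 (allP brick_check _ hc)).
Qed.

Lemma block_absorbs_cap l : 13 <= l <= 18 -> absorbs (block l) [::] (2 * l - 12) 24.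
Proof.
move=> hl.
have /mapP[c hc e] : l \in map fst (zip (iota 13 6) block_certs) by rewrite -/(unzip1 _) unzip1_zip // mem_iota; lia.
have /andP[/eqP hs ht] := allP block_check _ hc; rewrite -e in hs ht.
have := tile_okP char2 char3 (region_uniq _ _) ht; rewrite hs mulKn //.
by apply: absorbs_slack; lia.
Qed.

Lemma slab_absorbs_end N b : 12 <= N <= 15 -> admissible N b -> exists k, absorbs (slab N b) [::] k 33.
Proof.
move=> hN hb.
have /mapP[c hc e] : (N, b) \in map fst slab_certs.
  by apply: (implyP (allP slab_complete (N, b) (allpairs_f _ _ _)) hb); rewrite mem_iota; move: hN hb; rewrite /admissible; lia.
have [-> ->] : N = c.1.1 /\ b = c.1.2 by rewrite -e.
have /andP[hs ht] := allP slab_check _ hc.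
exists (size (slab c.1.1 c.1.2) %/ 20).
apply: absorbs_slack (tile_okP char2 char3 (region_uniq _ _) ht).
by rewrite -[33]/(660 %/ 20) leq_div2r.
Qed.

Lemma base_absorbs N b : 10 <= N <= 19 -> admissible N b -> exists k Om,
  [/\ absorbs (layered N b) Om k 64, completes Om 4, completes Om 3 & 10 <= size Om < 100].
Proof.
move=> hN hb.
have /(nthP (0, 0))[n] : (N, b) \in map (fun c => (base_N c, base_b c)) base_certs.
  by apply: (implyP (allP base_complete (N, b) (allpairs_f _ _ _)) hb); rewrite mem_iota; move: hN hb; rewrite /admissible; lia.
pose none : cert * cert * cert := ([::], [::], [::]).
pose c := nth (BaseCert 0 0 Z0 Z0 Z0 Z0 ([::], [::]) none none none none) base_certs n.
rewrite size_map => hn; rewrite (nth_map (BaseCert 0 0 Z0 Z0 Z0 Z0 ([::], [::]) none none none none)) // -/c => -[eN eb].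
have : base_ok c by move/all_nthP: base_check; apply.
rewrite /base_ok eN eb.
set inside := fun p => _; case/and5P=> h10 h100 hR ht /and4P[k40 k41 k30 k31].
set Om := [seq p <- _ | inside p] in h10 h100 k40 k41 k30 k31; set R := [seq p <- _ | ~~ inside p] in hR ht.
exists (size R %/ 20 + 0), Om; split; last by rewrite h10.
- have uL : uniq (layered N b) := region_uniq _ _.
  pose F := pairing_vec (base_F1 c, base_F2 c, base_F3 c).
  have eI p : inside p = (int_of_Z (base_c c) <= pairing F p)%R.
    by rewrite -key_pairing int_of_Z_le.
  apply: (absorbs_cut (D1 := R) (D2 := Om) (F := F) (c := int_of_Z (base_c c)) uL _ _
    (tile_okP char2 char3 (filter_uniq _ uL) ht) (absorbs_refl K (filter_uniq _ uL))).
  + by move=> p; rewrite mem_filter eI -ltNge andbC.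
  + by move=> p; rewrite mem_filter eI andbC.
  + by rewrite -[64]/(1299 %/ 20) leq_div2r.
  + exact: leq0n.
- exact: (corner_okP char2 char3 k40 k41).
- exact: (corner_okP char2 char3 k30 k31).
Qed.

(** The slack 64 of the certified simplices is inherited until the slab alone provides for it: 2 N -
    12 >= 64 from N = 38 on, where slabs have slack 0 themselves. *)
Lemma layered_absorbs N b : 10 <= N -> admissible N b -> exists k Om,
  [/\ absorbs (layered N b) Om k (if N < 38 then 64 else 0), completes Om 4, completes Om 3,
      10 <= size Om < 100 & 38 <= N -> 64 <= k].
Proof.
have hblock := block_absorbs slice_absorbs12 block_absorbs_cap.
have hslab := slab_absorbs hblock slab_absorbs_end.
elim/ltn_ind: N b => N ih b hN hb; have [le|gt] := leqP N 19.
  have [|k [Om [h1 h2 h3 h4]]] := base_absorbs _ hb; first by lia.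
  by exists k, Om; split=> //; [rewrite ifT //; lia|lia].
have [|k1 [hk1 h1]] := hslab N b _ hb; first by lia.
have oddN : odd (N - 10) = odd N by rewrite oddB ?addbF //; lia.
have hb' : admissible (N - 10) (next N b).
  move: hb; rewrite /admissible oddN /next; case: (odd N) => //.
  by rewrite ltn_mod.
have [||k2 [Om [h2 h4 h3 hsz _]]] := ih (N - 10) _ (next N b) _ hb'; [lia|lia|].
exists (k1 + k2), Om; split=> //; last by lia.
have hs1 : (if N < 25 then 33 else 0) <= (if N < 38 then 64 else 0) by case: (ltnP N 25); case: (ltnP N 38); lia.
have hs2 : (if N - 10 < 38 then 64 else 0) <= (if N < 38 then 64 else 0) + k1.
  by case: (ltnP (N - 10) 38); case: (ltnP N 38); lia.
have [[hA hR hA' hR'] _] := cells_small hb.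
(* No state both adds and removes cells, so only one layer is cut through and a single functional
   realises the cut. *)
have [hz|hz] : added (next N b) = 0 \/ removed (next N b) = 0.
  by rewrite /added /removed; case: (next N b) => [|[|[|[|n]]]]; rewrite /= ?nth_nil; auto.
- apply: (absorbs_cut_region (F := ((10 * N)%:Z, -6, 1)%R)
    (c := (11 * (10 * N)%:Z + (removed (next N b))%:Z - 6 * (N - 11)%:Z)%R)
    (v1 := (0, 0, 0)) (v2 := (10, 0, 0)) _ _ h1 h2 hs1 hs2) => -[[i j] a];
  rewrite /in_shifted /in_slab /in_layered hz /= !subn0;
  (have [hi|hi] : i + j + a <= N \/ N < i + j + a by [lia]; last by
    rewrite [i + j + a <= N]leqNgt hi /= ?andbF //; case: (leqP 10 i) => //= ?;
    rewrite [_ <= N - 10](_ : _ = false) ?andbF //; lia);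
  have [hi1 hi2 hi3] : [/\ i <= N, j <= N & a <= N] by [split; lia];
  rewrite ?[(_ <= pairing _ _)%R]leNgt cut_below_layer11 // hi !ltnS hi1 hi2 hi3 ?andbT /=;
  move: hi hi1; split_layers i; move=> hi _; rewrite /= ?orbF ?andbT ?subn0 ?andbF; first [reflexivity | lia].
- apply: (absorbs_cut_region (F := ((10 * N)%:Z, 6, -1)%R)
    (c := (10 * (10 * N)%:Z + 6 * (N - 10)%:Z + 1 - (added (next N b))%:Z)%R)
    (v1 := (0, 0, 0)) (v2 := (10, 0, 0)) _ _ h1 h2 hs1 hs2) => -[[i j] a];
  rewrite /in_shifted /in_slab /in_layered hz /= !subn0;
  (have [hi|hi] : i + j + a <= N \/ N < i + j + a by [lia]; last by
    rewrite [i + j + a <= N]leqNgt hi /= ?andbF //; case: (leqP 10 i) => //= ?;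
    rewrite [_ <= N - 10](_ : _ = false) ?andbF //; lia);
  have [hi1 hi2 hi3] : [/\ i <= N, j <= N & a <= N] by [split; lia];
  rewrite ?[(_ <= pairing _ _)%R]leNgt cut_below_layer10 // hi !ltnS hi1 hi2 hi3 ?andbT /=;
  move: hi hi1; split_layers i; move=> hi _; rewrite /= ?orbF ?andbT ?subn0 ?andbF; first [reflexivity | lia].
Qed.
End Main.

(** * From exponents to forms *)

Section Forms.
Local Open Scope ring_scope.

(** [good] knows the multiplicities only up to order; this lists the points in the order prescribed
    by [mult]. *)
Lemma perm_map_lift (T U : eqType) (h : T -> U) (s : seq T) (t : seq U) :
  perm_eq [seq h x | x <- s] t -> exists2 s', perm_eq s s' & [seq h x | x <- s'] = t.
Proof.
case: s => [|x0 s] hp.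
  by exists [::] => //; apply/esym/perm_small_eq => //; rewrite perm_sym.
have /(perm_iotaP (h x0))[Is pI ->] : perm_eq t [seq h x | x <- x0 :: s] by rewrite perm_sym.
rewrite size_map in pI; exists [seq nth x0 (x0 :: s) i | i <- Is].
  apply: (@perm_trans _ [seq nth x0 (x0 :: s) i | i <- iota 0 (size (x0 :: s))]).
    by rewrite map_nth_iota0 // take_size.
  by apply: perm_map; rewrite perm_sym.
rewrite -map_comp; apply/eq_in_map => i; rewrite (perm_mem pI) mem_iota => hi.
by rewrite /= -[h x0 :: _]/(map h (x0 :: s)) (nth_map x0).
Qed.

Lemma dim_lker_le (F : fieldType) (V W : vectType F) (L : 'Hom(V, W)) (k : nat) (G : {linear V -> 'rV[F]_k}) :
  (forall f, L f = 0 -> G f = 0 -> f = 0) -> (\dim (lker L) <= k)%N.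
Proof.
move=> inj; rewrite -(limg_ker_dim (linfun G) (lker L)).
have -> : (lker L :&: lker (linfun G) = 0)%VS.
  apply/eqP; rewrite -subv0; apply/subvP => f; rewrite memv_cap !memv_ker memv0 lfunE /=.
  by case/andP=> /eqP h1 /eqP h2; rewrite (inj f).
rewrite dimv0 add0n; apply: leq_trans (dimvS (subvf _)) _.
by rewrite dimvf /dim /= mul1n.
Qed.

Section Monomials.
Variable d : nat.

Definition dehom (a : mon d) : expn3 :=
  (val a (inord 1) : nat, val a (inord 2) : nat, val a (inord 3) : nat).

Lemma sum4 (a : {ffun 'I_4 -> 'I_d.+1}) :
  (\sum_i (a i : nat) = a ord0 + (a (inord 1) + a (inord 2) + a (inord 3)))%N.
Proof.
rewrite !big_ord_recl big_ord0 addn0 !addnA.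
by do ![congr (_ + _)%N]; congr (nat_of_ord (a _)); apply: val_inj; rewrite /= inordK.
Qed.

Lemma deg_dehom (a : mon d) : (val a ord0 + deg3 (dehom a) = d)%N.
Proof. by have /eqP := valP a; rewrite sum4. Qed.

Lemma ord4P (P : 'I_4 -> Prop) : P ord0 -> P (inord 1) -> P (inord 2) -> P (inord 3) -> forall i, P i.
Proof.
move=> h0 h1 h2 h3 [[|[|[|[|i]]]] hi] //.
- by rewrite (_ : Ordinal _ = ord0) //; apply: val_inj.
- by rewrite (_ : Ordinal _ = inord 1) //; apply: val_inj; rewrite /= inordK.
- by rewrite (_ : Ordinal _ = inord 2) //; apply: val_inj; rewrite /= inordK.
- by rewrite (_ : Ordinal _ = inord 3) //; apply: val_inj; rewrite /= inordK.
Qed.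

Lemma dehom_inj : injective dehom.
Proof.
move=> a b e; have [e1 e2 e3] := e; apply: val_inj; apply/ffunP; apply: ord4P; apply: val_inj => //.
by apply: (@addIn (deg3 (dehom b))); rewrite -[in LHS]e !deg_dehom.
Qed.

Definition ffun4 (T : Type) (x0 x1 x2 x3 : T) : {ffun 'I_4 -> T} :=
  [ffun i : 'I_4 => nth x0 [:: x0; x1; x2; x3] i].

Lemma ffun4E T (x0 x1 x2 x3 : T) : [/\ ffun4 x0 x1 x2 x3 ord0 = x0, ffun4 x0 x1 x2 x3 (inord 1) = x1,
  ffun4 x0 x1 x2 x3 (inord 2) = x2 & ffun4 x0 x1 x2 x3 (inord 3) = x3].
Proof. by split; rewrite ffunE //= inordK. Qed.

Lemma dehom_onto p : (deg3 p < d.+1)%N -> exists a, dehom a = p.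
Proof.
move=> hp; pose a := ffun4 (inord (d - deg3 p) : 'I_d.+1) (inord p.1.1) (inord p.1.2) (inord p.2).
have [a0 a1 a2 a3] := ffun4E (inord (d - deg3 p) : 'I_d.+1) (inord p.1.1) (inord p.1.2) (inord p.2).
rewrite /deg3 in hp.
have ha : (\sum_i (a i : nat) == d)%N.
  by rewrite sum4 a0 a1 a2 a3 !inordK ?/deg3; lia.
exists (Sub a ha); rewrite /dehom SubK a1 a2 a3 !inordK; try lia.
by case: p {hp a a0 a1 a2 a3 ha} => [[]].
Qed.

Lemma perm_dehom : perm_eq [seq dehom a | a <- enum {: mon d}] (monos d.+1).
Proof.
apply: uniq_perm; rewrite ?monos_uniq ?(map_inj_uniq dehom_inj) ?enum_uniq // => p.
rewrite mem_monos; apply/mapP/idP => [[a _ ->]|/dehom_onto[a <-]]; last by exists a; rewrite ?mem_enum.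
by have := deg_dehom a; lia.
Qed.

Lemma size_monos : size (monos d.+1) = 'C(d + 3, 3).
Proof.
rewrite -(perm_size perm_dehom) size_map -cardE addnC -(card_ord_partitions 3 d).
pose tof (a : mon d) : 4.-tuple 'I_d.+1 := [tuple val a i | i < 4].
have tof_inj : injective tof.
  move=> a b e; apply: val_inj; apply/ffunP => i.
  by have := congr1 (fun t => tnth t i) e; rewrite !tnth_mktuple.
rewrite -(card_codom tof_inj); apply: eq_card => t; rewrite inE.
have sumt (t' : 4.-tuple 'I_d.+1) : (\sum_(i <- t') i = \sum_(i < 4) tnth t' i)%N by rewrite big_tuple.
apply/codomP/eqP => [[a ->]|e].
  rewrite sumt -[RHS](eqP (valP a)); apply: eq_bigr => i _; by rewrite tnth_mktuple.
have ha : (\sum_i ([ffun i => tnth t i] i : nat) == d)%N.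
  by rewrite -[X in _ == X]e sumt; apply/eqP/eq_bigr => i _; rewrite ffunE.
by exists (Sub [ffun i => tnth t i] ha); apply: eq_from_tnth => i; rewrite tnth_mktuple SubK ffunE.
Qed.
End Monomials.

End Forms.

(** * From one configuration to a general one *)

Section Generality.
Local Open Scope ring_scope.

Section Transfer.
Variable K : closedFieldType.
Variables (d n : nat) (mult : 'I_n -> nat) (k : nat).
Local Notation conf := ('I_n -> pt K).

(** [polyfun] is not closed under pointwise equality; closing it spares functional extensionality
    when sums, products and determinants are rewritten. *)
Definition polynomial (g : conf -> K) : Prop := exists2 g', polyfun g' & g' =1 g.

Lemma polynomial_const c : polynomial (fun=> c).
Proof. by exists (fun=> c) => //; exact: pf_const. Qed.

Lemma polynomial_coord i j : polynomial (fun v => v i 0 j).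
Proof. by exists (fun v => v i 0 j) => //; exact: pf_coord. Qed.

Lemma polynomial_add g h : polynomial g -> polynomial h -> polynomial (fun v => g v + h v).
Proof.
move=> [g' pg eg] [h' ph eh]; exists (fun v => g' v + h' v); first exact: pf_add.
by move=> v; rewrite eg eh.
Qed.

Lemma polynomial_mul g h : polynomial g -> polynomial h -> polynomial (fun v => g v * h v).
Proof.
move=> [g' pg eg] [h' ph eh]; exists (fun v => g' v * h' v); first exact: pf_mul.
by move=> v; rewrite eg eh.
Qed.

Lemma polynomial_ext g h : g =1 h -> polynomial g -> polynomial h.
Proof. by move=> e [g' pg eg]; exists g' => // v; rewrite eg. Qed.

Lemma polynomial_sum (T : Type) (s : seq T) (g : T -> conf -> K) :
  (forall t, polynomial (g t)) -> polynomial (fun v => \sum_(t <- s) g t v).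
Proof.
move=> hg; elim: s => [|t s ih].
  by apply: polynomial_ext (polynomial_const 0) => v; rewrite big_nil.
by apply: polynomial_ext (polynomial_add (hg t) ih) => v; rewrite big_cons.
Qed.

Lemma polynomial_prod (T : Type) (s : seq T) (g : T -> conf -> K) :
  (forall t, polynomial (g t)) -> polynomial (fun v => \prod_(t <- s) g t v).
Proof.
move=> hg; elim: s => [|t s ih].
  by apply: polynomial_ext (polynomial_const 1) => v; rewrite big_nil.
by apply: polynomial_ext (polynomial_mul (hg t) ih) => v; rewrite big_cons.
Qed.

Lemma polynomial_exp g e : polynomial g -> polynomial (fun v => g v ^+ e).
Proof.
move=> hg; elim: e => [|e ih]; first by apply: polynomial_ext (polynomial_const 1) => v; rewrite expr0.
by apply: polynomial_ext (polynomial_mul hg ih) => v; rewrite exprS.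
Qed.

Lemma polynomial_det m (A : conf -> 'M[K]_m) :
  (forall i j, polynomial (fun v => A v i j)) -> polynomial (fun v => \det (A v)).
Proof.
move=> hA; rewrite /determinant; apply: polynomial_sum => s.
by apply: polynomial_mul (polynomial_const _) _; apply: polynomial_prod => i.
Qed.

Definition condition : finType := ('I_n * {ffun 'I_4 -> 'I_d.+1})%type.

Definition fat_coef (v : conf) (a : mon d) (c : condition) : K :=
  if (\sum_j (c.2 j : nat) < mult c.1)%N then
    \prod_(i < 4) ('C(val a i, c.2 i)%:R * v c.1 0 i ^+ (val a i - c.2 i)) else 0.

Lemma polynomial_fat_coef a c : polynomial (fun v => fat_coef v a c).
Proof.
apply: (@polynomial_ext (fun v => (\sum_j (c.2 j : nat) < mult c.1)%N%:R *
    \prod_(i < 4) ('C(val a i, c.2 i)%:R * v c.1 0 i ^+ (val a i - c.2 i)))).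
  by move=> v; rewrite /fat_coef; case: ifP => _; rewrite ?mul1r ?mul0r.
apply: polynomial_mul (polynomial_const _) _.
apply: polynomial_prod => i; apply: polynomial_mul (polynomial_const _) _.
exact/polynomial_exp/polynomial_coord.
Qed.

Lemma fat_evalE v f c : fat_eval mult v f c = \sum_a f a * fat_coef v a c.
Proof.
rewrite ffunE /fat_coef; case: ifP => _; first by [].
by rewrite big1 // => a _; rewrite mulr0.
Qed.

Lemma fat_eval_linear v : linear (@fat_eval K d n mult v).
Proof.
move=> t f g; apply/ffunP => c; rewrite !ffunE.
have e h : (if (\sum_j (c.2 j : nat) < mult c.1)%N then hasse_eval h c.2 (v c.1) else 0)
   = \sum_a h a * fat_coef v a c by rewrite -fat_evalE ffunE.
rewrite !e /GRing.scale /= big_distrr /= -big_split /=; apply: eq_bigr => a _.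
by rewrite !ffunE mulrDl mulrA.
Qed.

Variable G : nat -> expn3 -> K.

(** Rows are monomials. The columns are the conditions of the fat points, which vary with the
    configuration, followed by k fixed functionals; if the left kernel is trivial, then h0 <= k. *)
Definition system (v : conf) : 'M[K]_(#|{: mon d}|, #|{: condition}| + k) :=
  row_mx (\matrix_(i, j) fat_coef v (enum_val i) (enum_val j))
         (\matrix_(i, j) G j (dehom (enum_val i))).

Lemma systemP v (w : 'rV[K]_(#|{: mon d}|)) : w *m system v = 0 <->
  (forall c, \sum_a w 0 (enum_rank a) * fat_coef v a c = 0) /\
  (forall j, (j < k)%N -> \sum_a w 0 (enum_rank a) * G j (dehom a) = 0).
Proof.
have sumE (E : mon d -> K) : \sum_a w 0 (enum_rank a) * E a = \sum_i w 0 i * E (enum_val i).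
  by rewrite (reindex (enum_val : 'I_#|{: mon d}| -> mon d)) /=; [apply: eq_bigr => i _; rewrite enum_valK|apply: onW_bij; exact: enum_val_bij].
rewrite mul_mx_row; split=> [e|[e1 e2]].
  have := congr1 (@lsubmx _ _ _ _) e; have := congr1 (@rsubmx _ _ _ _) e.
  rewrite row_mxKl row_mxKr !linear0 => e2 e1; split=> [c|j hj].
    have /rowP/(_ (enum_rank c)) := e1; rewrite !mxE => h; apply: (eq_trans _ h).
    by rewrite sumE; apply: eq_bigr => i _; rewrite !mxE enum_rankK.
  have /rowP/(_ (Ordinal hj)) := e2; rewrite !mxE => h; apply: (eq_trans _ h).
  by rewrite sumE; apply: eq_bigr => i _; rewrite !mxE.
rewrite -[RHS]row_mx0; congr row_mx; apply/rowP => j; rewrite !mxE.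
  by apply: (eq_trans _ (e1 (enum_val j))); rewrite [RHS]sumE; apply: eq_bigr => i _; rewrite !mxE.
by apply: (eq_trans _ (e2 j (ltn_ord j))); rewrite [RHS]sumE; apply: eq_bigr => i _; rewrite !mxE.
Qed.

Definition extra (f : form K d) : 'rV[K]_k := \row_j \sum_a f a * G j (dehom a).

Lemma extra_linear : linear extra.
Proof.
move=> t f g; apply/rowP => j; rewrite !mxE big_distrr /= -big_split /=; apply: eq_bigr => a _.
by rewrite !ffunE mulrDl mulrA.
Qed.

Lemma h0_le (v : conf) (B : 'M_(#|{: condition}| + k, #|{: mon d}|)) :
  \det (system v *m B) != 0 -> (h0_IY d mult v <= k)%N.
Proof.
move=> hdet.
pose L : {linear _ -> _} := HB.pack (@fat_eval K d n mult v) (GRing.isLinear.Build _ _ _ _ _ (fat_eval_linear v)).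
pose E : {linear _ -> _} := HB.pack extra (GRing.isLinear.Build _ _ _ _ _ extra_linear).
apply: (@dim_lker_le _ _ _ (linfun L) k E) => f; rewrite lfunE /= => fL fE.
pose w := \row_(i < #|{: mon d}|) f (enum_val i).
have fw a : w 0 (enum_rank a) = f a by rewrite mxE enum_rankK.
have w0 : w *m system v = 0.
  apply/systemP; split=> [c|j hj].
    have /ffunP/(_ c) := fL; rewrite fat_evalE [RHS]ffunE => h; apply: (eq_trans _ h).
    by apply: eq_bigr => a _; rewrite fw.
  have /rowP/(_ (Ordinal hj)) := fE; rewrite !mxE => h; apply: (eq_trans _ h).
  by apply: eq_bigr => a _; rewrite fw.
have wB : w *m (system v *m B) = 0 by rewrite mulmxA w0 mul0mx.
have uB : system v *m B \in unitmx by rewrite unitmxE unitfE.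
have {}w0 : w = 0 by rewrite -[w]mulmx1 -(mulmxV uB) mulmxA wB mul0mx.
by apply/ffunP => a; rewrite -fw w0 mxE ffunE.
Qed.

End Transfer.

Section General.
Variable K : closedFieldType.
Variables (d n : nat) (mult : 'I_n -> nat) (k : nat).

Definition lift_pt (u : K * K * K) : pt K := \row_(i < 4) nth 0 [:: 1; u.1.1; u.1.2; u.2] i.

Lemma lift_ptE u : [/\ lift_pt u 0 ord0 = 1, lift_pt u 0 (inord 1) = u.1.1,
  lift_pt u 0 (inord 2) = u.1.2 & lift_pt u 0 (inord 3) = u.2].
Proof. by split; rewrite mxE //= inordK. Qed.

Lemma prod4 (E : 'I_4 -> K) : \prod_i E i = E ord0 * (E (inord 1) * E (inord 2) * E (inord 3)).
Proof.
rewrite !big_ord_recl big_ord0 mulr1 !mulrA.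
by do ![congr (_ * _)]; congr (E _); apply: val_inj; rewrite /= inordK.
Qed.

Lemma bin_expM (x : K) a b : 'C(a, b)%:R * x ^+ (a - b) * x ^+ b = 'C(a, b)%:R * x ^+ a.
Proof.
case: (leqP b a) => h; last by rewrite bin_small // !mul0r.
by rewrite -mulrA -exprD subnK.
Qed.

Lemma general_h0_le : (forall i, mult i <= d.+1)%N ->
  good K (monos d.+1) [seq mult i | i <- enum 'I_n] k ->
  @general_config K n (fun v => (h0_IY d mult v <= k)%N).
Proof.
move=> hmult [P [G [hP tP inj]]].
have [P' pP eP] := perm_map_lift hP.
have sP' : size P' = n by rewrite -(size_map fst) eP size_map size_enum_ord.
pose c0 : nat * (K * K * K) := (0%N, (1, 1, 1)).
pose v0 i : pt K := lift_pt (nth c0 P' i).2.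
have multE (i : 'I_n) : mult i = (nth c0 P' i).1.
  by rewrite -(nth_map _ 0%N) ?sP' // eP (nth_map i) ?size_enum_ord // nth_ord_enum.
pose A := @system K d n mult k G.
have inj0 (w : 'rV[K]_(#|{: mon d}|)) : w *m A v0 = 0 -> w = 0.
  move=> /systemP[hc hG].
  pose f (a : mon d) := w 0 (enum_rank a).
  pose F p := if [pick a : mon d | dehom a == p] is Some a then f a else 0.
  have FE a : F (dehom a) = f a.
    by rewrite /F; case: pickP => [b /eqP/dehom_inj -> //|/(_ a)]; rewrite eqxx.
  have sumE (E : expn3 -> K) : \sum_(p <- monos d.+1) F p * E p = \sum_a f a * E (dehom a).
    by rewrite -(perm_big _ (perm_dehom d)) big_map big_enum; apply: eq_bigr => a _; rewrite FE.
  have F0 : {in monos d.+1, forall p, F p = 0}.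
    apply: inj => [c cP b hb|j hj]; last by rewrite sumE hG.
    have [i hi ci] : exists2 i : 'I_n, mult i = c.1 & (nth c0 P' i).2 = c.2.
      rewrite (perm_mem pP) in cP; have hi : (index c P' < n)%N by rewrite -sP' index_mem.
      by exists (Ordinal hi); rewrite ?multE nth_index.
    under eq_bigr do rewrite -mulrA.
    rewrite sumE.
    have hbd : (deg3 b < d.+1)%N by apply: leq_trans hb _; rewrite -hi hmult.
    rewrite /deg3 in hbd.
    (* In the chart x0 = 1 the derivatives that do not involve x0 suffice. The multiplicity is at
       most d + 1, so the orders fit into 'I_d.+1. *)
    pose beta := ffun4 (ord0 : 'I_d.+1) (inord b.1.1) (inord b.1.2) (inord b.2).
    have [b0 b1 b2 b3] := ffun4E (ord0 : 'I_d.+1) (inord b.1.1) (inord b.1.2) (inord b.2).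
    have := hc (i, beta); rewrite /fat_coef /= sum4 b0 b1 b2 b3 !inordK; [|lia..].
    rewrite add0n hi -/(deg3 b) hb => h.
    apply: (eq_trans _ (etrans (congr1 ( *%R (expo c.2 b)) h) (mulr0 _))).
    rewrite big_distrr /=; apply: eq_bigr => a _; rewrite /f [RHS]mulrCA; congr (_ * _).
    rewrite prod4 b0 b1 b2 b3 bin0 mul1r !inordK; [|lia..].
    rewrite /v0 ci; have [-> -> -> ->] := lift_ptE c.2.
    rewrite expr1n mul1r /expo /wt /= !natrM.
    rewrite -!(mulrA _ _ (_%:R)).
    transitivity (('C(val a (inord 1), b.1.1)%:R * c.2.1.1 ^+ val a (inord 1)) *
      ('C(val a (inord 2), b.1.2)%:R * c.2.1.2 ^+ val a (inord 2)) *
      ('C(val a (inord 3), b.2)%:R * c.2.2 ^+ val a (inord 3))); first by ring.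
    by rewrite -!bin_expM; ring.
  apply/rowP => i; rewrite mxE -(enum_valK i) -/(f (enum_val i)) -FE F0 // mem_monos.
  by have := deg_dehom (enum_val i); lia.
have free0 : row_free (A v0).
  rewrite -kermx_eq0; apply/eqP/row_matrixP => i; rewrite row0; apply: inj0.
  by rewrite -row_mul mulmx_ker row0.
have [B AB] := row_freeP free0.
have [g' pg eg] : polynomial (fun v : 'I_n -> pt K => (\prod_i v i 0 ord0) * \det (A v *m B)).
  apply: polynomial_mul; first by apply: polynomial_prod => i; apply: polynomial_coord.
  apply: polynomial_det => i j.
  apply: (@polynomial_ext _ _ (fun v => \sum_l A v i l * B l j)); first by move=> v; rewrite mxE.
  apply: polynomial_sum => l.
  apply: (@polynomial_mul _ _ (fun v => A v i l) (fun=> B l j)); last exact: polynomial_const.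
  rewrite /A /system; case: (splitP l) => l' hl.
    have -> : l = lshift k l' by apply: val_inj.
    apply: (@polynomial_ext _ _ (fun v => fat_coef mult v (enum_val i) (enum_val l'))).
      by move=> v; rewrite row_mxEl mxE.
    exact: polynomial_fat_coef.
  have -> : l = rshift _ l' by apply: val_inj.
  apply: (@polynomial_ext _ _ (fun=> G l' (dehom (enum_val i)))); last exact: polynomial_const.
  by move=> v; rewrite row_mxEr mxE.
exists g'; split=> //.
  exists v0; rewrite eg AB det1 mulr1; apply/prodf_neq0 => i _.
  by have [-> _ _ _] := lift_ptE (nth c0 P' i).2; apply: oner_neq0.
move=> v; rewrite eg mulf_eq0 negb_or => /andP[/prodf_neq0 h1 h2]; split; last exact: h0_le h2.
by move=> i; apply: contraNneq (h1 i isT) => ->; rewrite mxE.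
Qed.

End General.

End Generality.

(** * Multiplicities, lengths and the conclusion *)

Lemma mult_xyz_seq x y z :
  [seq @mult_xyz x y z i | i <- enum 'I_(x + y + z)] = nseq x 4 ++ nseq y 3 ++ nseq z 2.
Proof.
apply: (@eq_from_nth _ 0) => [|i]; first by rewrite size_map size_enum_ord !size_cat !size_nseq addnA.
rewrite size_map size_enum_ord => hi.
rewrite (nth_map (Ordinal hi)) ?size_enum_ord // /mult_xyz nth_enum_ord //.
rewrite !nth_cat !size_nseq !nth_nseq; case: ltnP => h1 //.
have -> : (i - x < y) = (i < x + y) by lia.
by case: ltnP => h2 //; rewrite ifT //; lia.
Qed.

Lemma fat_length_xyz x y z : fat_length (@mult_xyz x y z) = 20 * x + 10 * y + 4 * z.
Proof.
transitivity (\sum_(m <- nseq x 4 ++ nseq y 3 ++ nseq z 2) 'C(m + 2, 3)).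
  by rewrite -mult_xyz_seq big_map big_enum.
have s n m : \sum_(i <- nseq n m) 'C(i + 2, 3) = n * 'C(m + 2, 3).
  by elim: n => [|n ih]; rewrite ?big_nil //= big_cons ih mulSn.
by rewrite !big_cat /= !s -['C(4 + 2, 3)]/20 -['C(3 + 2, 3)]/10 -['C(2 + 2, 3)]/4; lia.
Qed.

Lemma good_simplex (K : closedFieldType)
  (char2 : (2%:R != 0 :> K)%R) (char3 : (3%:R != 0 :> K)%R) d x y z : 41 <= d ->
  good K (monos d.+1) (nseq x 4 ++ nseq y 3 ++ nseq z 2) ('C(d + 3, 3) - (20 * x + 10 * y + 4 * z)).
Proof.
move=> hd; have hb : admissible d.+1 0 by rewrite /admissible orbT.
have [|k [Om [hL h4 h3 /andP[h10 h100] hk]]] := layered_absorbs char2 char3 _ hb; first by lia.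
have {}hL : absorbs K (layered d.+1 0) Om k 0 by move: hL; rewrite ifF //; lia.
have hk64 := hk ltac:(lia).
have five := certifies_sound char2 char3 tetrahedron_check.
have hsz : size Om < 20 * k by lia.
have g := good_all five hL h4 h3 h10 hsz x y z.
(* State 0 has no corrections, so the layered simplex for d + 1 is i >= 1, i + j + a <= d + 1, the
   translate of the exponents of degree at most d by (1, 0, 0). *)
have pL : perm_eq (layered d.+1 0) (map (shift3 (1, 0, 0)) (monos d.+1)).
  have [uL _ _] := hL.
  apply: uniq_perm; rewrite ?(map_inj_uniq (@shift3_inj _)) ?monos_uniq // => -[[i j] a].
  rewrite mem_shift3 mem_monos /layered mem_region /in_layered /added /removed /deg3 /=; mem_lia.
have := good_unshift (good_perm_dom pL g).
by rewrite (perm_size pL) size_map size_monos.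
Qed.

Theorem theorem1p1 (K : closedFieldType)
  (char2 : ((2%:R)%R : K) != 0%R) (char3 : ((3%:R)%R : K) != 0%R)
  (d x y z : nat) (hd : (41 <= d)%N) :
  @general_config K (x + y + z) (fun pts : 'I_(x + y + z) -> pt K =>
    ((20 * x + 10 * y + 4 * z <= 'C(d + 3, 3))%N ->
        @h1_IY K d (x + y + z) (@mult_xyz x y z) pts = 0%N) /\
    (('C(d + 3, 3) <= 20 * x + 10 * y + 4 * z)%N ->
        @h0_IY K d (x + y + z) (@mult_xyz x y z) pts = 0%N)).
Proof.
have hm i : @mult_xyz x y z i <= d.+1.
  by rewrite /mult_xyz; case: ifP => _; [|case: ifP => _]; lia.
have := good_simplex char2 char3 x y z hd; rewrite -mult_xyz_seq.
case/(general_h0_le hm) => g [pg g0 hg]; exists g; split=> // v /hg[v0 h]; split=> //.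
(* The bound on h0 is C(d+3,3) - length truncated at 0. It is 0 when the length is large; when the
   length is small it gives h0 + length <= C(d+3,3), that is, h1 = 0. *)
by rewrite /h1_IY fat_length_xyz; lia.
Qed.
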